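(* Let $X\subseteq\mathbb R^n$ be a nonempty compact convex set. The following are equivalent: (I) the Riesz space $\mathcal R(X)$ is strongly semisimple; (II) $X=\operatorname{conv}(x_1,\ldots,x_m)$ for some finitely many points $x_1,\ldots,x_m\in\mathbb R^n$, i.e. $X$ is a polyhedron; (III) $X$ has no outgoing tangent.
   Context: For $y\in\mathbb R^n$ and a linear subspace $L$, $\mathsf{proj}_L(y)$ is the orthogonal projection. Frenet frame of a sequence $\{x_i\}$ converging to $x$: $u_1$ is its Frenet $1$-frame if $x_i\ne x$ for all $i$ and $u_1=\lim_i (x_i-x)/\|x_i-x\|$; a $k$-tuple $(u_1,\ldots,u_k)$ of pairwise orthogonal unit vectors is its Frenet $k$-frame if $(u_1,\ldots,u_{k-1})$ is its Frenet $(k-1)$-frame and $u_k=\lim_i\frac{x_i-x-\mathsf{proj}_{\mathbb Ru_1+\cdots+\mathbb Ru_{k-1}}(x_i-x)}{\|x_i-x-\mathsf{proj}_{\mathbb Ru_1+\cdots+\mathbb Ru_{k-1}}(x_i-x)\|}$ (nonzero denominators). Tangent: $u=(u_1,\ldots,u_k)$ is a tangent of $X$ at $x$ if $X$ contains a sequence converging to $x$ whose Frenet $k$-frame is $u$; it is outgoing if there are $\lambda_1,\ldots,\lambda_k>0$ with $C\cap X=C'\cap X$, where $C=\operatorname{conv}(x,x+\lambda_1u_1,\ldots,x+\lambda_1u_1+\cdots+\lambda_ku_k)$ and $C'=\operatorname{conv}(x,x+\lambda_1u_1,\ldots,x+\lambda_1u_1+\cdots+\lambda_{k-1}u_{k-1})$.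 $\mathcal R(X)$: restrictions to $X$ of functions on a closed $n$-cube $K\supseteq X$ that are continuous and affine linear on each simplex of some triangulation of $K$; a Riesz space under pointwise operations. Principal ideal generated by $g$: $\{f:|f|\le m|g|\text{ for some }m\in\mathbb N\}$. Strongly semisimple: every principal ideal is an intersection of maximal ideals. *)

(* Defs.v *)
(* classical reals. Points of R^n are functions nat -> R whose
   coordinates of index >= n vanish (predicate Rn). *)
From Stdlib Require Import Reals Lra List.
Open Scope R_scope.

Definition vec := nat -> R.

Definition Rn (n : nat) (x : vec) : Prop := forall i, (n <= i)%nat -> x i = 0.

Fixpoint sumR (n : nat) (f : nat -> R) : R :=
  match n with O => 0 | S m => sumR m f + f m end.

Definition vadd (x y : vec) : vec := fun i => x i + y i.
Definition vsub (x y : vec) : vec := fun i => x i - y i.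
Definition vscale (r : R) (x : vec) : vec := fun i => r * x i.
Definition vzero : vec := fun _ => 0.

Definition dot (n : nat) (x y : vec) : R := sumR n (fun i => x i * y i).
Definition norm (n : nat) (x : vec) : R := sqrt (dot n x x).

Definition converges (n : nat) (s : nat -> vec) (x : vec) : Prop :=
  forall eps, eps > 0 -> exists N, forall k, (N <= k)%nat -> norm n (vsub (s k) x) < eps.

Fixpoint lincomb (w : list R) (l : list vec) : vec :=
  match w, l with
  | a :: w', p :: l' => fun i => a * p i + lincomb w' l' i
  | _, _ => vzero
  end.

Definition in_conv (l : list vec) (y : vec) : Prop :=
  exists w : list R, length w = length l /\ Forall (fun a => 0 <= a) w /\
    fold_right Rplus 0 w = 1 /\ y = lincomb w l.

Definition closed_set (n : nat) (X : vec -> Prop) : Prop :=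
  forall (s : nat -> vec) y, (forall k, X (s k)) -> Rn n y -> converges n s y -> X y.
Definition bounded_set (n : nat) (X : vec -> Prop) : Prop :=
  exists M, forall x, X x -> norm n x <= M.
Definition compact_set (n : nat) (X : vec -> Prop) : Prop :=
  closed_set n X /\ bounded_set n X.
Definition convex_set (X : vec -> Prop) : Prop :=
  forall x y t, X x -> X y -> 0 <= t <= 1 ->
    X (vadd (vscale (1 - t) x) (vscale t y)).

Definition is_polytope (n : nat) (X : vec -> Prop) : Prop :=
  exists ps : list vec, Forall (Rn n) ps /\ forall y, X y <-> in_conv ps y.

(* u : nat -> vec, u 0, ..., u (k-1) stand for u_1, ..., u_k *)

(* orthogonal projection onto R u_0 + ... + R u_(j-1), for orthonormal u's *)
Definition proj (n j : nat) (u : nat -> vec) (y : vec) : vec :=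
  fun i => sumR j (fun l => dot n y (u l) * u l i).

Definition residual (n j : nat) (u : nat -> vec) (y : vec) : vec :=
  vsub y (proj n j u y).

Definition frenet_frame (n : nat) (s : nat -> vec) (x : vec) (k : nat)
    (u : nat -> vec) : Prop :=
  (1 <= k)%nat /\
  (forall l, (l < k)%nat -> Rn n (u l) /\ norm n (u l) = 1) /\
  (forall l m, (l < k)%nat -> (m < k)%nat -> l <> m -> dot n (u l) (u m) = 0) /\
  (forall j, (j < k)%nat ->
     (forall i, norm n (residual n j u (vsub (s i) x)) <> 0) /\
     converges n (fun i => vscale (/ norm n (residual n j u (vsub (s i) x)))
                                  (residual n j u (vsub (s i) x))) (u j)).

Definition is_tangent (n : nat) (X : vec -> Prop) (x : vec) (k : nat)
    (u : nat -> vec) : Prop :=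
  exists s : nat -> vec, (forall i, X (s i)) /\ converges n s x /\
    frenet_frame n s x k u.

Definition chain_pts (x : vec) (lam : nat -> R) (u : nat -> vec) (j : nat)
  : list vec :=
  map (fun m => fun i => x i + sumR m (fun l => lam l * u l i)) (seq 0 (S j)).

Definition is_outgoing (n : nat) (X : vec -> Prop) (x : vec) (k : nat)
    (u : nat -> vec) : Prop :=
  exists lam : nat -> R, (forall j, (j < k)%nat -> lam j > 0) /\
    forall y, (in_conv (chain_pts x lam u k) y /\ X y) <->
              (in_conv (chain_pts x lam u (k - 1)) y /\ X y).

Definition has_outgoing_tangent (n : nat) (X : vec -> Prop) : Prop :=
  exists x k u, Rn n x /\ is_tangent n X x k u /\ is_outgoing n X x k u.

Definition cube (n : nat) (c : vec) (s : R) (y : vec) : Prop :=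
  Rn n y /\ forall i, (i < n)%nat -> Rabs (y i - c i) <= s.

Definition aff_indep (l : list vec) : Prop :=
  match l with
  | nil => False
  | p0 :: rest => forall c : list R, length c = length rest ->
      lincomb c (map (fun p => vsub p p0) rest) = vzero -> Forall (fun a => a = 0) c
  end.

(* T (a finite list of simplices, given by vertex lists) triangulates K:
   union is K and any two simplices meet in their common face *)
Definition triangulation (n : nat) (K : vec -> Prop) (T : list (list vec)) : Prop :=
  (forall S, In S T -> Forall (Rn n) S /\ aff_indep S) /\
  (forall y, K y <-> exists S, In S T /\ in_conv S y) /\
  (forall S S', In S T -> In S' T -> forall y,
     (in_conv S y /\ in_conv S' y) <->
     exists l, (forall p, In p l -> In p S /\ In p S') /\ in_conv l y).

Definition continuous_on (n : nat) (K : vec -> Prop) (g : vec -> R) : Prop :=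
  forall y eps, K y -> eps > 0 -> exists delta, delta > 0 /\
    forall z, K z -> norm n (vsub z y) < delta -> Rabs (g z - g y) < eps.

Definition affine_on (n : nat) (S : vec -> Prop) (g : vec -> R) : Prop :=
  exists (a : vec) (b : R), forall y, S y -> g y = dot n a y + b.

(* f (a function on R^n, considered by its restriction to X) belongs to R(X) *)
Definition in_RX (n : nat) (X : vec -> Prop) (f : vec -> R) : Prop :=
  exists (c : vec) (s : R) (T : list (list vec)) (g : vec -> R),
    s > 0 /\ Rn n c /\ (forall x, X x -> cube n c s x) /\
    triangulation n (cube n c s) T /\
    continuous_on n (cube n c s) g /\
    (forall S, In S T -> affine_on n (in_conv S) g) /\
    (forall x, X x -> f x = g x).

Definition riesz_ideal (n : nat) (X : vec -> Prop) (I : (vec -> R) -> Prop) : Prop :=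
  (forall f, I f -> in_RX n X f) /\
  I (fun _ => 0) /\
  (forall f g, I f -> I g -> I (fun y => f y + g y)) /\
  (forall r f, I f -> I (fun y => r * f y)) /\
  (forall f g, I g -> in_RX n X f -> (forall x, X x -> Rabs (f x) <= Rabs (g x)) -> I f).

Definition maximal_ideal (n : nat) (X : vec -> Prop) (I : (vec -> R) -> Prop) : Prop :=
  riesz_ideal n X I /\
  (exists f, in_RX n X f /\ ~ I f) /\
  (forall J, riesz_ideal n X J -> (forall f, I f -> J f) ->
     (forall f, J f -> I f) \/ (forall f, in_RX n X f -> J f)).

Definition principal_ideal (n : nat) (X : vec -> Prop) (g : vec -> R) (f : vec -> R)
  : Prop :=
  in_RX n X f /\ exists m : nat, forall x, X x -> Rabs (f x) <= INR m * Rabs (g x).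

Definition strongly_semisimple (n : nat) (X : vec -> Prop) : Prop :=
  forall g, in_RX n X g ->
    exists F : ((vec -> R) -> Prop) -> Prop,
      (forall I, F I -> maximal_ideal n X I) /\
      (forall f, principal_ideal n X g f <-> (in_RX n X f /\ forall I, F I -> I f)).

(* Main.v *)
(* The implications form a cycle: polytope => strongly semisimple => no outgoing tangent =>
   polytope.

   R(X) consists of the restrictions to X of the functions obtained from affine ones by
   sums, multiples and absolute values: a big simplex containing a cube can be subdivided
   by starring edges until no simplex crosses a given hyperplane, and conversely a
   continuous piecewise affine function on a cube is a maximum of minima of its pieces.
   Since a maximal ideal containing g contains every f vanishing on the zeros of g, strong
   semisimplicity says that |f| <= m|g| for some m as soon as f vanishes on the zeros of g.

   On a polytope the same subdivision reduces |f| <= m|g| to finitely many vertices.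

   If u is an outgoing tangent at x, let f = |<y - x, u_k>| and let g be a piecewise linear
   gauge with zero set C. Then f vanishes on C' and so on the zeros of g in X, but along the
   sequence defining u, g is bounded by the component of y - x orthogonal to u_1, ..., u_k,
   which is negligible against f.

   A compact convex set that is not a polytope has infinitely many extreme points. Take a
   sequence of them converging to x with a Frenet frame u_1, ..., u_k spanning all the
   differences. If no (u_1, ..., u_j) were outgoing, X would contain a simplex at x whose
   relative interior meets the sequence, contradicting extremality. *)
Require Import Defs.
From Stdlib Require Import Reals Arith List Lra Lia.
From Stdlib Require Import Classical ClassicalEpsilon FunctionalExtensionality.
Open Scope R_scope.

(** A member of [in_RX] comes with its own cube and triangulation, so even closure under sums would
    require common refinements. Passing to [PL] makes the Riesz operations immediate and confines
    triangulations to the two translations [PL_in_RX] and [in_RX_PL]. Subdivision is carried out on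
    lists of vertices by comparing weights: [simplicial] is uniqueness of weights, and affine
    independence and the common-face condition are derived from it only at the end. The facets of
    the cube are cut along like any other hyperplanes, which makes the cube a union of faces of the
    subdivided simplex. In the tangent arguments no rate of convergence is available, only that each
    frame coordinate is eventually below any prescribed multiple of the preceding one; hence every
    constant ([eps], the ratios of the [lam], the [d] of [triangular_solve]) is fixed before a term
    of the sequence is chosen. *)

Lemma choice_fun (A B : Type) (P : A -> B -> Prop) :
  (forall a, exists b, P a b) -> exists f, forall a, P a (f a).
Proof.
  intros H.
  exists (fun a => proj1_sig (constructive_indefinite_description _ (H a))).
  intros a. destruct (constructive_indefinite_description _ (H a)); assumption.
Qed.

(** * Finite sums, dot product and norm *)

Lemma sumR_ext n f g : (forall i, (i < n)%nat -> f i = g i) -> sumR n f = sumR n g.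
Proof.
  induction n as [|n IH]; intros H; simpl; [reflexivity|].
  rewrite IH by (intros; apply H; lia). rewrite H by lia. reflexivity.
Qed.

Lemma sumR_0 n f : (forall i, (i < n)%nat -> f i = 0) -> sumR n f = 0.
Proof.
  induction n as [|n IH]; intros H; simpl; [reflexivity|].
  rewrite IH by (intros; apply H; lia). rewrite H by lia. ring.
Qed.

Lemma sumR_plus n f g : sumR n (fun i => f i + g i) = sumR n f + sumR n g.
Proof. induction n as [|n IH]; simpl; [ring|]. rewrite IH. ring. Qed.

Lemma sumR_scal n c f : sumR n (fun i => c * f i) = c * sumR n f.
Proof. induction n as [|n IH]; simpl; [ring|]. rewrite IH. ring. Qed.

Lemma sumR_minus n f g : sumR n (fun i => f i - g i) = sumR n f - sumR n g.
Proof. induction n as [|n IH]; simpl; [ring|]. rewrite IH. ring. Qed.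

Lemma sumR_swap n m (f : nat -> nat -> R) :
  sumR n (fun i => sumR m (f i)) = sumR m (fun j => sumR n (fun i => f i j)).
Proof.
  induction n as [|n IH]; simpl.
  - symmetry; apply sumR_0; reflexivity.
  - rewrite IH, sumR_plus. reflexivity.
Qed.

Lemma sumR_le n f g : (forall i, (i < n)%nat -> f i <= g i) -> sumR n f <= sumR n g.
Proof.
  induction n as [|n IH]; intros H; simpl; [lra|].
  assert (sumR n f <= sumR n g) by (apply IH; intros; apply H; lia).
  assert (f n <= g n) by (apply H; lia). lra.
Qed.

Lemma sumR_nonneg n f : (forall i, (i < n)%nat -> 0 <= f i) -> 0 <= sumR n f.
Proof.
  intros H. rewrite <- (sumR_0 n (fun _ => 0)) by reflexivity.
  apply sumR_le; assumption.
Qed.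

Lemma sumR_const n c : sumR n (fun _ => c) = INR n * c.
Proof.
  induction n as [|n IH]; [simpl; ring|].
  change (sumR n (fun _ => c) + c = INR (S n) * c). rewrite IH, S_INR. ring.
Qed.

Lemma sumR_ge_term n f i :
  (forall i, (i < n)%nat -> 0 <= f i) -> (i < n)%nat -> f i <= sumR n f.
Proof.
  induction n as [|n IH]; intros H Hi; simpl; [lia|].
  assert (0 <= f n) by (apply H; lia).
  destruct (Nat.eq_dec i n) as [->|].
  - assert (0 <= sumR n f) by (apply sumR_nonneg; intros; apply H; lia). lra.
  - assert (f i <= sumR n f) by (apply IH; [intros; apply H|]; lia). lra.
Qed.

Lemma sumR_single n f i :
  (i < n)%nat -> (forall j, (j < n)%nat -> j <> i -> f j = 0) -> sumR n f = f i.
Proof.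
  induction n as [|n IH]; intros Hi H; simpl; [lia|].
  destruct (Nat.eq_dec i n) as [->|].
  - rewrite sumR_0; [ring|]. intros; apply H; lia.
  - rewrite IH; [rewrite (H n) by lia; ring|lia|]. intros; apply H; lia.
Qed.

Lemma dot_sym n x y : dot n x y = dot n y x.
Proof. apply sumR_ext; intros; ring. Qed.

Lemma dot_add_l n x y z : dot n (vadd x y) z = dot n x z + dot n y z.
Proof. unfold dot. rewrite <- sumR_plus. apply sumR_ext; intros; unfold vadd; ring. Qed.

Lemma dot_sub_l n x y z : dot n (vsub x y) z = dot n x z - dot n y z.
Proof. unfold dot. rewrite <- sumR_minus. apply sumR_ext; intros; unfold vsub; ring. Qed.

Lemma dot_scale_l n r x z : dot n (vscale r x) z = r * dot n x z.
Proof. unfold dot. rewrite <- sumR_scal. apply sumR_ext; intros; unfold vscale; ring. Qed.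

Lemma dot_add_r n x y z : dot n z (vadd x y) = dot n z x + dot n z y.
Proof. rewrite !(dot_sym n z). apply dot_add_l. Qed.

Lemma dot_sub_r n x y z : dot n z (vsub x y) = dot n z x - dot n z y.
Proof. rewrite !(dot_sym n z). apply dot_sub_l. Qed.

Lemma dot_scale_r n r x z : dot n z (vscale r x) = r * dot n z x.
Proof. rewrite !(dot_sym n z). apply dot_scale_l. Qed.

Lemma dot_sum_l n k (c : nat -> R) (u : nat -> vec) z :
  dot n (fun i => sumR k (fun l => c l * u l i)) z = sumR k (fun l => c l * dot n (u l) z).
Proof.
  unfold dot.
  transitivity (sumR n (fun i => sumR k (fun l => c l * (u l i * z i)))).
  - apply sumR_ext; intros i _. rewrite Rmult_comm, <- sumR_scal.
    apply sumR_ext; intros; ring.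
  - rewrite sumR_swap. apply sumR_ext; intros l _. apply sumR_scal.
Qed.

Lemma dot_self_nonneg n x : 0 <= dot n x x.
Proof. apply sumR_nonneg; intros; nra. Qed.

Lemma dot_self_coord n x i : (i < n)%nat -> x i * x i <= dot n x x.
Proof.
  intros Hi. apply (sumR_ge_term n (fun i => x i * x i)); [intros; nra|assumption].
Qed.

Lemma norm_sqr n x : norm n x * norm n x = dot n x x.
Proof. apply sqrt_sqrt, dot_self_nonneg. Qed.

Lemma norm_nonneg n x : 0 <= norm n x.
Proof. apply sqrt_pos. Qed.

Lemma norm_coord n x i : (i < n)%nat -> Rabs (x i) <= norm n x.
Proof.
  intros Hi. pose proof (dot_self_coord n x i Hi). pose proof (norm_sqr n x).
  pose proof (norm_nonneg n x). unfold Rabs; destruct (Rcase_abs (x i)); nra.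
Qed.

Lemma norm_dot_1 n x : norm n x = 1 <-> dot n x x = 1.
Proof.
  pose proof (norm_sqr n x). pose proof (norm_nonneg n x).
  split; intros H1; [rewrite <- H, H1; ring|].
  assert ((norm n x - 1) * (norm n x + 1) = 0) by nra.
  apply Rmult_integral in H2; lra.
Qed.

Lemma norm_0_dot n x : norm n x = 0 <-> dot n x x = 0.
Proof.
  pose proof (norm_sqr n x). split; intros H1; [rewrite <- H, H1; ring|].
  rewrite H1 in H. apply Rmult_integral in H; tauto.
Qed.

Lemma dot_self_0 n x : Rn n x -> dot n x x = 0 -> x = vzero.
Proof.
  intros HR H. extensionality i. destruct (Nat.lt_ge_cases i n) as [Hi|Hi].
  - pose proof (dot_self_coord n x i Hi). unfold vzero. nra.
  - apply HR; assumption.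
Qed.

Lemma Rn_sub n x y : Rn n x -> Rn n y -> Rn n (vsub x y).
Proof. intros Hx Hy i Hi; unfold vsub; rewrite Hx, Hy by assumption; ring. Qed.

Lemma Rn_scale n r x : Rn n x -> Rn n (vscale r x).
Proof. intros Hx i Hi; unfold vscale; rewrite Hx by assumption; ring. Qed.

Lemma Rn_add n x y : Rn n x -> Rn n y -> Rn n (vadd x y).
Proof. intros Hx Hy i Hi; unfold vadd; rewrite Hx, Hy by assumption; ring. Qed.

Lemma vsub_0 x y : vsub x y = vzero -> x = y.
Proof.
  intros H. extensionality i. assert (H' := f_equal (fun f => f i) H).
  unfold vsub, vzero in H'. lra.
Qed.

(** * Limits and compactness *)

(** Unlike [converges], this sees every coordinate, so it needs no dimension and determines the
    limit as a function. *)
Definition cvp (s : nat -> vec) (y : vec) : Prop :=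
  forall i, Un_cv (fun k => s k i) (y i).

Definition index_incr (sg : nat -> nat) : Prop := forall k, (sg k < sg (S k))%nat.

Lemma index_incr_ge sg : index_incr sg -> forall k, (k <= sg k)%nat.
Proof.
  intros H k; induction k as [|k IH]; [lia|]. specialize (H k). lia.
Qed.

Lemma index_incr_lt sg : index_incr sg -> forall i j, (i < j)%nat -> (sg i < sg j)%nat.
Proof.
  intros H i j Hij; induction Hij as [|j Hij IH]; [apply H|]. specialize (H j). lia.
Qed.

Lemma index_incr_comp sg tu :
  index_incr sg -> index_incr tu -> index_incr (fun k => sg (tu k)).
Proof. intros Hs Ht k. apply index_incr_lt; [assumption|apply Ht]. Qed.

Lemma cv_const c : Un_cv (fun _ => c) c.
Proof. intros eps He. exists 0%nat. intros. unfold Rdist. rewrite Rminus_diag, Rabs_R0. lra. Qed.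

Lemma cv_ext u v l : (forall k, u k = v k) -> Un_cv u l -> Un_cv v l.
Proof. intros H Hu eps He. destruct (Hu eps He) as [N HN]. exists N. intros. rewrite <- H. auto. Qed.

Lemma cv_subseq u l sg : index_incr sg -> Un_cv u l -> Un_cv (fun k => u (sg k)) l.
Proof.
  intros Hs Hu eps He. destruct (Hu eps He) as [N HN]. exists N. intros k Hk.
  apply HN. pose proof (index_incr_ge sg Hs k). lia.
Qed.

Lemma cvp_subseq s y sg : index_incr sg -> cvp s y -> cvp (fun k => s (sg k)) y.
Proof. intros Hs H i. apply (cv_subseq (fun k => s k i)); auto. Qed.

Lemma cv_sumR n (f : nat -> nat -> R) l :
  (forall j, (j < n)%nat -> Un_cv (fun k => f k j) (l j)) ->
  Un_cv (fun k => sumR n (f k)) (sumR n l).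
Proof.
  induction n as [|n IH]; intros H; simpl; [apply cv_const|].
  apply CV_plus; [apply IH; intros; apply H; lia|apply H; lia].
Qed.

Lemma cv_dot n s t x y :
  (forall i, (i < n)%nat -> Un_cv (fun k => s k i) (x i)) ->
  (forall i, (i < n)%nat -> Un_cv (fun k => t k i) (y i)) ->
  Un_cv (fun k => dot n (s k) (t k)) (dot n x y).
Proof. intros Hs Ht. apply cv_sumR. intros j Hj. apply CV_mult; auto. Qed.

Lemma cv_le u v l m : (forall k, u k <= v k) -> Un_cv u l -> Un_cv v m -> l <= m.
Proof.
  intros H Hu Hv. destruct (Rle_lt_dec l m) as [|Hlt]; [assumption|exfalso].
  destruct (Hu ((l - m) / 2)) as [N HN]; [lra|].
  destruct (Hv ((l - m) / 2)) as [N' HN']; [lra|].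
  specialize (HN (max N N') ltac:(lia)). specialize (HN' (max N N') ltac:(lia)).
  specialize (H (max N N')). unfold Rdist in *.
  apply Rabs_def2 in HN. apply Rabs_def2 in HN'. lra.
Qed.

Lemma converges_iff n s x :
  converges n s x <-> forall i, (i < n)%nat -> Un_cv (fun k => s k i) (x i).
Proof.
  split.
  - intros H i Hi eps He. destruct (H eps He) as [N HN]. exists N. intros k Hk.
    specialize (HN k Hk). pose proof (norm_coord n (vsub (s k) x) i Hi).
    unfold Rdist, vsub in *. lra.
  - intros H eps He.
    assert (Hc : Un_cv (fun k => dot n (vsub (s k) x) (vsub (s k) x)) (dot n vzero vzero)).
    { apply cv_dot; intros i Hi; unfold vsub, vzero;
        replace 0 with (x i - x i) by ring; apply CV_minus; auto using cv_const. }
    destruct (Hc (eps * eps)) as [N HN]; [nra|]. exists N. intros k Hk.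
    specialize (HN k ltac:(lia)). unfold Rdist in HN.
    replace (dot n vzero vzero) with 0 in HN
      by (symmetry; apply sumR_0; intros; unfold vzero; ring).
    apply Rabs_def2 in HN. pose proof (norm_sqr n (vsub (s k) x)).
    pose proof (norm_nonneg n (vsub (s k) x)). nra.
Qed.

Lemma converges_cvp n s x :
  (forall k, Rn n (s k)) -> Rn n x -> (converges n s x <-> cvp s x).
Proof.
  intros Hs Hx. rewrite converges_iff. split; intros H i; [|intros _; apply H].
  destruct (Nat.lt_ge_cases i n) as [Hi|Hi]; [apply H; assumption|].
  apply (cv_ext (fun _ => 0)); [intros; rewrite Hs; auto|].
  rewrite Hx by assumption. apply cv_const.
Qed.

(** A choice is made for all pairs (k, N) beforehand; the recursion then feeds in as N the successor
    of the previous index. *)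
Lemma extraction (Q : nat -> nat -> Prop) :
  (forall k N, exists p, (N <= p)%nat /\ Q k p) ->
  exists sg, index_incr sg /\ forall k, Q k (sg k).
Proof.
  intros H.
  destruct (choice_fun (nat * nat) nat (fun a p => (snd a <= p)%nat /\ Q (fst a) p))
    as [f Hf]; [intros [k N]; apply H|].
  set (sg := fix sg k := match k with
               | O => f (O, O) | S k' => f (S k', S (sg k')) end).
  exists sg. split.
  - intros k. apply (Hf (S k, S (sg k))).
  - intros [|k]; [apply (Hf (O, O))|apply (Hf (S k, S (sg k)))].
Qed.

Lemma inv_INR_pos k : 0 < / INR (S k).
Proof. apply Rinv_0_lt_compat, lt_0_INR; lia. Qed.

Lemma archimed_inv eps : 0 < eps -> exists N, forall k, (N <= k)%nat -> / INR (S k) < eps.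
Proof.
  intros He. destruct (archimed_cor1 eps He) as [N [HN HN0]]. exists N. intros k Hk.
  apply Rle_lt_trans with (/ INR N); [|assumption].
  apply Rinv_le_contravar; [apply lt_0_INR; lia|apply le_INR; lia].
Qed.

(** A cluster point becomes the limit of a subsequence by picking at stage k an index with error
    below 1/(k+1). *)
Lemma bolzano_weierstrass u M :
  (forall k, Rabs (u k) <= M) -> exists sg l, index_incr sg /\ Un_cv (fun k => u (sg k)) l.
Proof.
  intros HM.
  destruct (Bolzano_Weierstrass u (fun c => - M <= c <= M)) as [l Hl].
  - apply compact_P3.
  - intros k. specialize (HM k). unfold Rabs in HM; destruct (Rcase_abs (u k)); lra.
  - destruct (extraction (fun k p => Rabs (u p - l) < / INR (S k))) as [sg [Hs Hq]].
    + intros k N.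
      assert (Hn : neighbourhood (disc l (mkposreal _ (inv_INR_pos k))) l)
        by (exists (mkposreal _ (inv_INR_pos k)); intros z Hz; exact Hz).
      destruct (Hl _ N Hn) as [p Hp]. exists p. exact Hp.
    + exists sg, l. split; [assumption|]. intros eps He.
      destruct (archimed_inv eps He) as [N HN]. exists N. intros k Hk.
      eapply Rlt_trans; [apply Hq|apply HN; lia].
Qed.

Lemma bolzano_weierstrass_vec n s M :
  (forall k i, (i < n)%nat -> Rabs (s k i) <= M) ->
  exists sg y, index_incr sg /\ Rn n y /\
    forall i, (i < n)%nat -> Un_cv (fun k => s (sg k) i) (y i).
Proof.
  induction n as [|n IH]; intros HM.
  - exists (fun k => k), vzero. repeat split; [intros k; lia|intros; lia].
  - destruct IH as [sg [y [Hs [Hy Hc]]]]; [intros; apply HM; lia|].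
    destruct (bolzano_weierstrass (fun k => s (sg k) n) M) as [tu [l [Ht Hl]]];
      [intros; apply HM; lia|].
    exists (fun k => sg (tu k)), (fun i => if Nat.eq_dec i n then l else y i).
    split; [apply index_incr_comp; assumption|split].
    + intros i Hi. destruct (Nat.eq_dec i n); [lia|apply Hy; lia].
    + intros i Hi. destruct (Nat.eq_dec i n) as [->|]; [assumption|].
      apply (cv_subseq (fun k => s (sg k) i)); [assumption|apply Hc; lia].
Qed.

Definition seq_compact (A : vec -> Prop) : Prop :=
  forall s, (forall k, A (s k)) ->
  exists sg y, index_incr sg /\ A y /\ cvp (fun k => s (sg k)) y.

Lemma compact_seq_compact n X :
  (forall x, X x -> Rn n x) -> compact_set n X -> seq_compact X.
Proof.
  intros HX [Hcl [M HM]] s Hs.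
  destruct (bolzano_weierstrass_vec n s M) as [sg [y [Hsg [Hy Hc]]]].
  - intros k i Hi. eapply Rle_trans; [apply norm_coord; eassumption|auto].
  - exists sg, y. split; [assumption|].
    assert (Hcv : converges n (fun k => s (sg k)) y) by (apply converges_iff; assumption).
    split; [apply (Hcl (fun k => s (sg k))); auto|].
    apply (converges_cvp n); auto.
Qed.

(** Compactness is used twice: a sequence with [psi > k] would have a convergent subsequence, which
    gives boundedness; a sequence within 1/(k+1) of the supremum then converges along a subsequence
    to a maximiser. *)
Lemma seq_compact_max A (psi : vec -> R) :
  (exists x, A x) -> seq_compact A ->
  (forall s y, (forall k, A (s k)) -> cvp s y -> Un_cv (fun k => psi (s k)) (psi y)) ->
  exists y, A y /\ forall z, A z -> psi z <= psi y.
Proof.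
  intros [x0 Hx0] HA Hpsi.
  set (E := fun r => exists z, A z /\ r = psi z).
  assert (Hb : bound E).
  { apply NNPP. intros Hn.
    destruct (choice_fun nat vec (fun k z => A z /\ INR k < psi z)) as [s Hs].
    { intros k. apply NNPP. intros Hk. apply Hn. exists (INR k). intros r [z [Hz ->]].
      apply Rnot_lt_le. intros Hlt. apply Hk. eauto. }
    destruct (HA s) as [sg [y [Hsg [Hy Hc]]]]; [intros; apply Hs|].
    specialize (Hpsi _ _ (fun k => proj1 (Hs (sg k))) Hc).
    destruct (Hpsi 1 ltac:(lra)) as [N HN].
    destruct (INR_unbounded (psi y + 1)) as [m Hm].
    set (k := max N m). specialize (HN k ltac:(lia)).
    destruct (Hs (sg k)) as [_ Hk].
    assert (INR m <= INR (sg k))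
      by (apply le_INR; pose proof (index_incr_ge sg Hsg k); lia).
    unfold Rdist in HN. apply Rabs_def2 in HN. lra. }
  destruct (completeness E Hb) as [M [HM1 HM2]]; [exists (psi x0), x0; auto|].
  destruct (choice_fun nat vec (fun k z => A z /\ M - / INR (S k) < psi z)) as [s Hs].
  { intros k. apply NNPP. intros Hk. pose proof (inv_INR_pos k).
    assert (M <= M - / INR (S k)); [|lra]. apply HM2. intros r [z [Hz ->]].
    apply Rnot_lt_le. intros Hlt. apply Hk. eauto. }
  destruct (HA s) as [sg [y [Hsg [Hy Hc]]]]; [intros; apply Hs|].
  exists y. split; [assumption|]. intros z Hz.
  apply Rle_trans with M; [apply HM1; exists z; auto|].
  apply Rnot_lt_le. intros Hlt.
  specialize (Hpsi _ _ (fun k => proj1 (Hs (sg k))) Hc).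
  destruct (Hpsi ((M - psi y) / 2) ltac:(lra)) as [N HN].
  destruct (archimed_inv ((M - psi y) / 2) ltac:(lra)) as [m Hm].
  set (k := max N m). specialize (HN k ltac:(lia)).
  specialize (Hm (sg k) ltac:(pose proof (index_incr_ge sg Hsg k); lia)).
  destruct (Hs (sg k)) as [_ Hk]. unfold Rdist in HN. apply Rabs_def2 in HN. lra.
Qed.

(** * Barycentric weights *)

Definition vec_dec (p q : vec) : {p = q} + {p <> q} := excluded_middle_informative (p = q).

Definition delta (p q : vec) : R := if vec_dec p q then 1 else 0.

Lemma delta_same p : delta p p = 1.
Proof. unfold delta; destruct (vec_dec p p); congruence. Qed.

Lemma delta_diff p q : p <> q -> delta p q = 0.
Proof. unfold delta; destruct (vec_dec p q); congruence. Qed.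

Lemma delta_nonneg p q : 0 <= delta p q.
Proof. unfold delta; destruct (vec_dec p q); lra. Qed.

Definition lsum (V : list vec) (f : vec -> R) : R :=
  fold_right (fun p acc => f p + acc) 0 V.

Lemma lsum_ext V f g : (forall p, In p V -> f p = g p) -> lsum V f = lsum V g.
Proof.
  induction V as [|a V IH]; intros H; simpl; [reflexivity|].
  rewrite H by (left; reflexivity). rewrite IH by (intros; apply H; right; assumption).
  reflexivity.
Qed.

Lemma lsum_lin V a b f g :
  lsum V (fun p => a * f p + b * g p) = a * lsum V f + b * lsum V g.
Proof. induction V as [|c V IH]; simpl; [ring|]. rewrite IH. ring. Qed.

Lemma lsum_0 V f : (forall p, In p V -> f p = 0) -> lsum V f = 0.
Proof.
  intros H. rewrite (lsum_ext V f (fun _ => 0 * 0 + 0 * 0)).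
  - rewrite (lsum_lin V 0 0 (fun _ => 0) (fun _ => 0)). ring.
  - intros p Hp. rewrite H by assumption. ring.
Qed.

Lemma lsum_delta V a f :
  NoDup V -> In a V -> lsum V (fun p => delta a p * f p) = f a.
Proof.
  induction V as [|c V IH]; intros HV Ha; [destruct Ha|]. inversion HV; subst. simpl.
  destruct (vec_dec a c) as [->|Hac].
  - rewrite delta_same, lsum_0; [ring|].
    intros p Hp. rewrite delta_diff by (intros ->; contradiction). ring.
  - rewrite delta_diff by assumption. rewrite IH; [ring|assumption|].
    destruct Ha; [congruence|assumption].
Qed.

Lemma lsum_sumR V n (f : vec -> nat -> R) :
  lsum V (fun p => sumR n (f p)) = sumR n (fun i => lsum V (fun p => f p i)).
Proof.
  induction V as [|a V IH]; simpl; [symmetry; apply sumR_0; reflexivity|].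
  rewrite IH, <- sumR_plus. reflexivity.
Qed.

(** Pairs a weight list with an arbitrary function: a coordinate function gives [lincomb], the
    constant 1 gives the total weight. *)
Fixpoint lin (W : list R) (S : list vec) (f : vec -> R) : R :=
  match W, S with
  | a :: W', s :: S' => a * f s + lin W' S' f
  | _, _ => 0
  end.

Lemma lin_lincomb W S i : lincomb W S i = lin W S (fun p => p i).
Proof.
  revert S; induction W as [|a W IH]; intros [|s S]; simpl; try reflexivity.
  rewrite IH. reflexivity.
Qed.

Lemma lin_one W S : length W = length S -> fold_right Rplus 0 W = lin W S (fun _ => 1).
Proof.
  revert S; induction W as [|a W IH]; intros [|s S] H; simpl in *; try congruence.
  rewrite (IH S) by congruence. ring.
Qed.

(** If [S] lists a vertex several times, the weights of its occurrences add up. *)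
Fixpoint wfun (W : list R) (S : list vec) (p : vec) : R :=
  match W, S with
  | a :: W', s :: S' => a * delta s p + wfun W' S' p
  | _, _ => 0
  end.

Lemma lsum_wfun V W S f :
  NoDup V -> incl S V -> lsum V (fun p => wfun W S p * f p) = lin W S f.
Proof.
  intros HV. revert S; induction W as [|a W IH]; intros [|s S] HS; simpl;
    try (apply lsum_0; intros; ring).
  rewrite (lsum_ext V _ (fun p => a * (delta s p * f p) + 1 * (wfun W S p * f p)))
    by (intros; ring).
  rewrite lsum_lin, lsum_delta, IH; [ring| |assumption|].
  - intros p Hp; apply HS; right; assumption.
  - apply HS; left; reflexivity.
Qed.

Lemma wfun_nonneg W S p : Forall (fun a => 0 <= a) W -> 0 <= wfun W S p.
Proof.
  revert S; induction W as [|a W IH]; intros [|s S] H; simpl; try lra.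
  inversion H; subst. specialize (IH S H3). pose proof (delta_nonneg s p). nra.
Qed.

Lemma wfun_supp W S p : wfun W S p <> 0 -> In p S.
Proof.
  revert S; induction W as [|a W IH]; intros [|s S] H; simpl in *; try lra.
  destruct (vec_dec s p) as [->|Hs]; [left; reflexivity|right; apply IH].
  rewrite delta_diff in H by assumption. intros H0; apply H; rewrite H0; ring.
Qed.

Lemma wfun_inj S W W' :
  NoDup S -> length W = length S -> length W' = length S ->
  (forall p, wfun W S p = wfun W' S p) -> W = W'.
Proof.
  intros HS. revert W W'; induction HS as [|s S Hs HS IH]; intros [|a W] [|a' W'] H1 H2 H;
    simpl in *; try congruence.
  assert (H0 : forall W0, wfun W0 S s = 0)
    by (intros W0; apply NNPP; intros Hn; apply Hs; eapply wfun_supp; eassumption).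
  assert (a = a')
    by (specialize (H s); rewrite delta_same, !H0 in H; lra).
  subst. f_equal. apply IH; try congruence. intros p. specialize (H p). lra.
Qed.

(** Weights are functions supported in [S] instead of lists indexed by [S]: thus representations
    over different vertex lists can be compared by equality, and exchanging a vertex changes values
    at a few points only. [V] is meant as a duplicate-free list of all vertices in play, the domain
    of summation. *)
Definition rep (V S : list vec) (w : vec -> R) (y : vec) : Prop :=
  (forall p, 0 <= w p) /\ (forall p, w p <> 0 -> In p S) /\ lsum V w = 1 /\
  forall i, lsum V (fun p => w p * p i) = y i.

Lemma rep_of_weights V S W :
  NoDup V -> incl S V -> length W = length S -> Forall (fun a => 0 <= a) W ->
  fold_right Rplus 0 W = 1 -> rep V S (wfun W S) (lincomb W S).
Proof.
  intros HV HS HW H0 H1. repeat split.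
  - intros p; apply wfun_nonneg; assumption.
  - intros p; apply wfun_supp.
  - rewrite <- H1, (lin_one W S), <- (lsum_wfun V) by assumption.
    apply lsum_ext; intros; ring.
  - intros i. rewrite lin_lincomb. apply lsum_wfun; assumption.
Qed.

Lemma rep_exists V S y : NoDup V -> incl S V -> in_conv S y -> exists w, rep V S w y.
Proof.
  intros HV HS [W [HW [H0 [H1 ->]]]]. exists (wfun W S). apply rep_of_weights; assumption.
Qed.

(** The first occurrence of a vertex in [S] takes its whole weight and later occurrences get 0, so
    [S] may contain repetitions. *)
Lemma weights_of_fun V S w :
  NoDup V -> incl S V -> (forall p, 0 <= w p) -> (forall p, w p <> 0 -> In p S) ->
  exists W, length W = length S /\ Forall (fun a => 0 <= a) W /\
    forall f, lin W S f = lsum V (fun p => w p * f p).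
Proof.
  intros HV. revert w; induction S as [|s S IH]; intros w HS H0 Hsupp.
  - exists nil. repeat split; [constructor|]. intros f. simpl. symmetry. apply lsum_0.
    intros p _. replace (w p) with 0; [ring|].
    apply NNPP; intros Hn; apply (Hsupp p); auto.
  - destruct (IH (fun p => w p - w s * delta s p)) as [W [HW [HW0 HWf]]].
    + intros p Hp; apply HS; right; assumption.
    + intros p. destruct (vec_dec s p) as [->|Hs].
      * rewrite delta_same. lra.
      * rewrite delta_diff by assumption. specialize (H0 p). lra.
    + intros p Hp. destruct (vec_dec s p) as [->|Hs].
      * rewrite delta_same in Hp. lra.
      * rewrite delta_diff in Hp by assumption.
        destruct (Hsupp p) as [|]; [lra|congruence|assumption].
    + exists (w s :: W). repeat split; [simpl; congruence|constructor; auto|].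
      intros f. simpl. rewrite HWf.
      rewrite (lsum_ext V (fun p => (w p - w s * delta s p) * f p)
        (fun p => 1 * (w p * f p) + - w s * (delta s p * f p))) by (intros; ring).
      rewrite lsum_lin, lsum_delta; [ring|assumption|apply HS; left; reflexivity].
Qed.

Lemma rep_in_conv V S w y : NoDup V -> incl S V -> rep V S w y -> in_conv S y.
Proof.
  intros HV HS [H0 [Hs [H1 Hy]]].
  destruct (weights_of_fun V S w HV HS H0 Hs) as [W [HW [HW0 HWf]]].
  exists W. repeat split; try assumption.
  - rewrite (lin_one W S HW), HWf. transitivity (lsum V w); [|assumption].
    apply lsum_ext; intros; ring.
  - extensionality i. rewrite lin_lincomb, HWf, Hy. reflexivity.
Qed.

Lemma nodup_incl_l (S : list vec) : incl S (nodup vec_dec S).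
Proof. intros p; apply nodup_In. Qed.

Lemma in_conv_incl S S' y : incl S S' -> in_conv S y -> in_conv S' y.
Proof.
  intros H Hy.
  destruct (rep_exists (nodup vec_dec S') S y) as [w [H0 [Hs [H1 Hw]]]];
    [apply NoDup_nodup| |assumption|].
  - intros p Hp. apply nodup_incl_l; auto.
  - apply (rep_in_conv (nodup vec_dec S') _ w); [apply NoDup_nodup|apply nodup_incl_l|].
    repeat split; auto.
Qed.

Lemma in_conv_In S p : In p S -> in_conv S p.
Proof.
  intros Hp. apply (rep_in_conv (nodup vec_dec S) _ (delta p));
    [apply NoDup_nodup|apply nodup_incl_l|].
  assert (Hp' : In p (nodup vec_dec S)) by (apply nodup_incl_l; assumption).
  repeat split.
  - intros; apply delta_nonneg.
  - intros q Hq. destruct (vec_dec p q) as [<-|]; [assumption|].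
    rewrite delta_diff in Hq by assumption. lra.
  - rewrite (lsum_ext _ _ (fun q => delta p q * 1)) by (intros; ring).
    apply (lsum_delta _ p (fun _ => 1)); [apply NoDup_nodup|assumption].
  - intros i. apply (lsum_delta _ p (fun q => q i)); [apply NoDup_nodup|assumption].
Qed.

Lemma in_conv_convex S : convex_set (in_conv S).
Proof.
  intros x y t Hx Hy Ht.
  destruct (rep_exists (nodup vec_dec S) S x) as [w [H0 [Hs [H1 Hw]]]];
    [apply NoDup_nodup|apply nodup_incl_l|assumption|].
  destruct (rep_exists (nodup vec_dec S) S y) as [v [G0 [Gs [G1 Gw]]]];
    [apply NoDup_nodup|apply nodup_incl_l|assumption|].
  apply (rep_in_conv (nodup vec_dec S) _ (fun p => (1 - t) * w p + t * v p));
    [apply NoDup_nodup|apply nodup_incl_l|].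
  repeat split.
  - intros p. specialize (H0 p). specialize (G0 p). nra.
  - intros p Hp. destruct (Req_dec (w p) 0) as [E|]; [|apply Hs; assumption].
    apply Gs. intros E'. apply Hp. rewrite E, E'. ring.
  - rewrite lsum_lin, H1, G1. ring.
  - intros i. unfold vadd, vscale. rewrite <- Hw, <- Gw, <- lsum_lin.
    apply lsum_ext; intros; ring.
Qed.

Lemma in_conv_nil y : ~ in_conv nil y.
Proof. intros [[|a W] [HW [_ [H _]]]]; simpl in *; [lra|congruence]. Qed.

Lemma weights_sum_0 W :
  Forall (fun a => 0 <= a) W -> fold_right Rplus 0 W = 0 ->
  forall S i, lincomb W S i = 0.
Proof.
  induction 1 as [|a W Ha HW IH]; intros H1 [|s S] i; simpl in *; try reflexivity.
  assert (Hf : 0 <= fold_right Rplus 0 W).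
  { clear -HW. induction HW; simpl; lra. }
  rewrite IH by lra. replace a with 0 by lra. ring.
Qed.

Lemma lincomb_scale r W S i : lincomb (map (Rmult r) W) S i = r * lincomb W S i.
Proof.
  revert S; induction W as [|a W IH]; intros [|s S]; simpl; unfold vzero; try ring.
  rewrite IH. ring.
Qed.

Lemma fold_scale r W : fold_right Rplus 0 (map (Rmult r) W) = r * fold_right Rplus 0 W.
Proof. induction W as [|a W IH]; simpl; [ring|]. rewrite IH. ring. Qed.

(** The weights of the tail are divided by their sum; when that sum is 0 the point is [p] itself. *)
Lemma in_conv_cons p S y :
  in_conv (p :: S) y ->
  y = p \/ exists t z, 0 <= t <= 1 /\ in_conv S z /\
    y = vadd (vscale (1 - t) p) (vscale t z).
Proof.
  intros [[|a W] [HW [H0 [H1 ->]]]]; simpl in *; [congruence|].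
  inversion H0 as [|? ? Ha HW0]; subst.
  assert (Hf : 0 <= fold_right Rplus 0 W).
  { clear -HW0. induction HW0; simpl; lra. }
  set (r := fold_right Rplus 0 W) in *.
  destruct (Req_dec r 0) as [E|E].
  - left. extensionality i. rewrite weights_sum_0 by assumption.
    replace a with 1 by lra. ring.
  - right. exists r, (lincomb (map (Rmult (/ r)) W) S). split; [lra|split].
    + exists (map (Rmult (/ r)) W). repeat split.
      * rewrite length_map. congruence.
      * rewrite Forall_map. eapply Forall_impl; [|eassumption]. intros b Hb.
        assert (0 < / r) by (apply Rinv_0_lt_compat; lra). simpl in *. nra.
      * rewrite fold_scale. fold r. field. assumption.
    + extensionality i. unfold vadd, vscale. rewrite lincomb_scale.
      replace (1 - r) with a by lra. field. assumption.
Qed.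

(** Allows hulls to be handled without weights: affine inequalities and inclusions pass from the
    vertices to the hull through this lemma. *)
Lemma in_conv_ind (Q : vec -> Prop) S :
  convex_set Q -> (forall p, In p S -> Q p) -> forall y, in_conv S y -> Q y.
Proof.
  intros HQ. induction S as [|s S IH]; intros HS y Hy; [destruct (in_conv_nil _ Hy)|].
  apply in_conv_cons in Hy as [->|[t [z [Ht [Hz ->]]]]]; [apply HS; left; reflexivity|].
  apply HQ; [apply HS; left; reflexivity| |assumption].
  apply IH; [intros; apply HS; right; assumption|assumption].
Qed.

Lemma in_conv_sub S S' y :
  (forall p, In p S -> in_conv S' p) -> in_conv S y -> in_conv S' y.
Proof. intros H. apply in_conv_ind; [apply in_conv_convex|assumption]. Qed.

(** * Refinement along hyperplanes *)

Definition aff (n : nat) (l : vec * R) (y : vec) : R := dot n (fst l) y + snd l.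

Lemma aff_comb n l x y t :
  aff n l (vadd (vscale (1 - t) x) (vscale t y)) = (1 - t) * aff n l x + t * aff n l y.
Proof. unfold aff. rewrite dot_add_r, !dot_scale_r. ring. Qed.

Lemma aff_nonneg_convex n l : convex_set (fun y => 0 <= aff n l y).
Proof. intros x y t Hx Hy Ht. rewrite aff_comb. nra. Qed.

Lemma aff_nonpos_convex n l : convex_set (fun y => aff n l y <= 0).
Proof. intros x y t Hx Hy Ht. rewrite aff_comb. nra. Qed.

Lemma rep_aff V S w y n l :
  rep V S w y -> aff n l y = lsum V (fun p => w p * aff n l p).
Proof.
  intros [_ [_ [H1 Hy]]]. unfold aff.
  rewrite (lsum_ext V _ (fun p => snd l * w p + 1 * (sumR n (fun i => w p * (fst l i * p i))))).
  - rewrite lsum_lin, H1, lsum_sumR. rewrite !Rmult_1_r, Rmult_1_l, Rplus_comm. f_equal.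
    apply sumR_ext. intros i _. rewrite <- Hy.
    transitivity (fst l i * lsum V (fun p => p i * w p) + 0 * lsum V (fun _ => 0)).
    + rewrite (lsum_ext V (fun p => p i * w p) (fun p => w p * p i)) by (intros; ring). ring.
    + rewrite <- lsum_lin. apply lsum_ext; intros; ring.
  - intros p _. unfold dot. rewrite sumR_scal. ring.
Qed.

(* A list of vertex lists is simplicial when a point has at most one barycentric
   representation, across all its members; this is affine independence of each member
   together with the common-face condition for each pair. *)
Definition simplicial (T : list (list vec)) : Prop :=
  forall V, NoDup V -> (forall S, In S T -> incl S V) ->
  forall S S' w w' y, In S T -> In S' T -> rep V S w y -> rep V S' w' y -> w = w'.

(** Stellar subdivision of the edge from [p] to [q] at [m], seen from a single new member; [star]
    computes the whole list. *)
Definition child (p q m : vec) (S' S : list vec) : Prop :=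
  (In p S /\ In q S /\
    (S' = m :: remove vec_dec p S \/ S' = m :: remove vec_dec q S)) \/
  (~ (In p S /\ In q S) /\ S' = S).

Definition star (p q m : vec) (T : list (list vec)) : list (list vec) :=
  flat_map (fun S => if in_dec vec_dec p S then
                       if in_dec vec_dec q S then
                         (m :: remove vec_dec p S) :: (m :: remove vec_dec q S) :: nil
                       else S :: nil
                     else S :: nil) T.

Lemma in_star p q m T S' : In S' (star p q m T) <-> exists S, In S T /\ child p q m S' S.
Proof.
  unfold star, child. rewrite in_flat_map. split; intros [S [HS H]]; exists S;
    (split; [assumption|]);
    destruct (in_dec vec_dec p S), (in_dec vec_dec q S); simpl in *; intuition auto.
Qed.

(** Redistributes the weight at [m] to [p] and [q] according to m = (1-t)p + tq, which turns weights
    on a subdivided simplex into weights on the old one. *)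
Definition push (t : R) (p q m : vec) (w : vec -> R) (r : vec) : R :=
  w r + w m * ((1 - t) * delta p r + t * delta q r - delta m r).

Lemma lsum_move V a b c (p q m : vec) (w : vec -> R) f :
  NoDup V -> In p V -> In q V -> In m V ->
  lsum V (fun r => (w r + (a * delta p r + b * delta q r + c * delta m r)) * f r) =
  lsum V (fun r => w r * f r) + a * f p + b * f q + c * f m.
Proof.
  intros HV Hp Hq Hm.
  rewrite (lsum_ext V _ (fun r => 1 * (1 * (w r * f r) + a * (delta p r * f r)) +
    1 * (b * (delta q r * f r) + c * (delta m r * f r)))) by (intros; ring).
  rewrite lsum_lin, !lsum_lin, !lsum_delta by assumption. ring.
Qed.

Section Star.
Variables (V : list vec) (t : R) (p q m : vec).
Hypotheses (HV : NoDup V) (Ht : 0 < t < 1) (Hpq : p <> q) (Hmp : m <> p) (Hmq : m <> q)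
  (HpV : In p V) (HqV : In q V) (HmV : In m V)
  (Hm : m = vadd (vscale (1 - t) p) (vscale t q)).

Lemma push_rep S S' w y :
  In p S -> In q S -> (forall r, In r S' -> r = m \/ In r S) ->
  rep V S' w y -> rep V S (push t p q m w) y.
Proof.
  intros HpS HqS HS' [H0 [Hs [H1 Hy]]].
  assert (Hlin : forall f, lsum V (fun r => push t p q m w r * f r) =
    lsum V (fun r => w r * f r) + w m * ((1 - t) * f p + t * f q - f m)).
  { intros f. rewrite (lsum_ext V _ (fun r => (w r + ((w m * (1 - t)) * delta p r +
      (w m * t) * delta q r + - w m * delta m r)) * f r))
      by (intros; unfold push; ring).
    rewrite lsum_move by assumption. ring. }
  repeat split.
  - intros r. unfold push. pose proof (H0 r). pose proof (H0 m).
    pose proof (delta_nonneg p r). pose proof (delta_nonneg q r).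
    assert (0 <= (1 - t) * delta p r + t * delta q r) by nra.
    destruct (vec_dec m r) as [<-|Hr]; [rewrite delta_same; nra|].
    rewrite (delta_diff m r) by assumption. nra.
  - intros r Hr. unfold push in Hr.
    destruct (vec_dec p r) as [<-|Hpr]; [assumption|].
    destruct (vec_dec q r) as [<-|Hqr]; [assumption|].
    rewrite (delta_diff p r), (delta_diff q r) in Hr by assumption.
    destruct (vec_dec m r) as [<-|Hmr].
    + exfalso; apply Hr. rewrite delta_same. ring.
    + rewrite (delta_diff m r) in Hr by assumption.
      destruct (HS' r) as [->|]; [apply Hs; intros E; apply Hr; rewrite E; ring| |assumption].
      congruence.
  - rewrite (lsum_ext V _ (fun r => push t p q m w r * 1)) by (intros; ring).
    rewrite (Hlin (fun _ => 1)).
    rewrite (lsum_ext V (fun r => w r * 1) w) by (intros; ring). rewrite H1. ring.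
  - intros i. rewrite (Hlin (fun r => r i)), Hy.
    replace (m i) with ((1 - t) * p i + t * q i) by (rewrite Hm; reflexivity). ring.
Qed.

(** If [w m < w' m], comparing the pushed weights at [p] and at [q] gives [w p > w' p >= 0] and
    [w q > w' q >= 0], yet one of [w p], [w q] is 0; the opposite case is symmetric. Once the
    weights at [m] agree, [push] has changed both functions by the same amount. *)
Lemma push_inj w w' :
  (forall r, 0 <= w r) -> (forall r, 0 <= w' r) -> w p = 0 \/ w q = 0 ->
  w' p = 0 \/ w' q = 0 -> push t p q m w = push t p q m w' -> w = w'.
Proof.
  intros H0 G0 Hw Hw' E.
  assert (Ep := f_equal (fun f => f p) E). assert (Eq := f_equal (fun f => f q) E).
  unfold push in Ep, Eq. rewrite !delta_same in Ep, Eq.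
  rewrite (delta_diff q p), (delta_diff m p) in Ep by congruence.
  rewrite (delta_diff p q), (delta_diff m q) in Eq by congruence.
  pose proof (H0 p); pose proof (H0 q); pose proof (G0 p); pose proof (G0 q).
  assert (Em : w m = w' m).
  { destruct (Rtotal_order (w m) (w' m)) as [Hlt|[|Hlt]]; [|assumption|];
      exfalso; assert ((1 - t) * (w m - w' m) <> 0) by nra; nra. }
  extensionality r. assert (Er := f_equal (fun f => f r) E). unfold push in Er.
  rewrite Em in Er. lra.
Qed.

(** Weight is moved from [p] and [q] to [m] in the ratio (1-t) : t until one end is exhausted;
    comparing [w p * t] with [w q * (1 - t)] tells which end. *)
Lemma pull_rep S w y :
  In p S -> In q S -> rep V S w y ->
  exists w', rep V (m :: remove vec_dec p S) w' y \/ rep V (m :: remove vec_dec q S) w' y.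
Proof.
  intros HpS HqS [H0 [Hs [H1 Hy]]].
  (* [a] is the end that runs out and [mu] the weight arriving at [m]; the last hypothesis says, for
     both choices of [a] at once, that no weight is left at [a]. *)
  assert (Hgen : forall mu a b, a = p /\ b = q \/ a = q /\ b = p -> 0 <= mu ->
    0 <= w p - mu * (1 - t) -> 0 <= w q - mu * t ->
    w a + - mu * ((1 - t) * delta p a + t * delta q a) = 0 ->
    rep V (m :: remove vec_dec a S)
      (fun r => w r + (- (mu * (1 - t)) * delta p r + - (mu * t) * delta q r + mu * delta m r))
      y).
  { intros mu a b Hab Hmu Hp0 Hq0 Ha. repeat split.
    - intros r. pose proof (H0 r). pose proof (delta_nonneg m r).
      destruct (vec_dec p r) as [<-|Hpr].
      + rewrite delta_same, (delta_diff q p), (delta_diff m p) by congruence. lra.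
      + rewrite (delta_diff p r) by assumption. destruct (vec_dec q r) as [<-|Hqr].
        * rewrite delta_same, (delta_diff m q) by congruence. lra.
        * rewrite (delta_diff q r) by assumption. nra.
    - intros r Hr. destruct (vec_dec m r) as [<-|Hmr]; [left; reflexivity|right].
      rewrite (delta_diff m r) in Hr by assumption. apply in_in_remove.
      + intros ->. apply Hr. lra.
      + destruct (vec_dec p r) as [<-|Hpr]; [assumption|].
        destruct (vec_dec q r) as [<-|Hqr]; [assumption|].
        rewrite (delta_diff p r), (delta_diff q r) in Hr by assumption.
        apply Hs. intros E; apply Hr; rewrite E; ring.
    - rewrite (lsum_ext V _ (fun r => (w r + (- (mu * (1 - t)) * delta p r +
        - (mu * t) * delta q r + mu * delta m r)) * 1)) by (intros; ring).
      rewrite (lsum_move V _ _ _ p q m w (fun _ => 1)) by assumption.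
      rewrite (lsum_ext V (fun r => w r * 1) w) by (intros; ring). lra.
    - intros i. rewrite (lsum_move V _ _ _ p q m w (fun r => r i)) by assumption.
      rewrite Hy. replace (m i) with ((1 - t) * p i + t * q i)
        by (rewrite Hm; reflexivity). ring. }
  pose proof (H0 p) as Hp0. pose proof (H0 q) as Hq0.
  destruct (Rle_lt_dec (w p * t) (w q * (1 - t))) as [Hle|Hlt].
  - eexists. left. apply (Hgen (w p / (1 - t)) p q); [left; auto| | | |].
    + apply Rmult_le_pos; [lra|]. apply Rlt_le, Rinv_0_lt_compat; lra.
    + right. field. lra.
    + replace (w q - w p / (1 - t) * t) with ((w q * (1 - t) - w p * t) * / (1 - t))
        by (field; lra).
      apply Rmult_le_pos; [lra|]. apply Rlt_le, Rinv_0_lt_compat; lra.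
    + rewrite delta_same, (delta_diff q p) by congruence. field. lra.
  - eexists. right. apply (Hgen (w q / t) q p); [right; auto| | | |].
    + apply Rmult_le_pos; [lra|]. apply Rlt_le, Rinv_0_lt_compat; lra.
    + replace (w p - w q / t * (1 - t)) with ((w p * t - w q * (1 - t)) * / t)
        by (field; lra).
      apply Rmult_le_pos; [lra|]. apply Rlt_le, Rinv_0_lt_compat; lra.
    + right. field. lra.
    + rewrite delta_same, (delta_diff p q) by congruence. field. lra.
Qed.

End Star.

(** The last clause is an implication because the same notion is applied to the generating points of
    a polytope, which may be affinely dependent. *)
Definition refines (T' T : list (list vec)) : Prop :=
  (forall S', In S' T' -> exists S, In S T /\ forall r, In r S' -> in_conv S r) /\
  (forall S y, In S T -> in_conv S y -> exists S', In S' T' /\ in_conv S' y) /\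
  (simplicial T -> simplicial T').

Lemma refines_refl T : refines T T.
Proof.
  split; [|split]; auto.
  - intros S HS; exists S. split; [assumption|]. intros; apply in_conv_In; assumption.
  - eauto.
Qed.

Lemma refines_trans T1 T2 T3 : refines T1 T2 -> refines T2 T3 -> refines T1 T3.
Proof.
  intros [A1 [B1 C1]] [A2 [B2 C2]]. split; [|split]; auto.
  - intros S HS. destruct (A1 S HS) as [S2 [HS2 H2]].
    destruct (A2 S2 HS2) as [S3 [HS3 H3]]. exists S3. split; [assumption|].
    intros r Hr. apply (in_conv_sub S2); auto.
  - intros S y HS Hy. destruct (B2 S y HS Hy) as [S2 [HS2 H2]]. eauto.
Qed.

(** Covering comes from [pull_rep]. For uniqueness, [push] sends two new representations of a point
    to old ones, which coincide, and [push_inj] brings the equality back. That the edge occurs in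
    [T] puts [p], [q] and [m] into [V] and keeps [m] from being an old vertex. *)
Lemma star_refines p q t T :
  0 < t < 1 -> p <> q -> (exists S, In S T /\ In p S /\ In q S) ->
  refines (star p q (vadd (vscale (1 - t) p) (vscale t q)) T) T.
Proof.
  intros Ht Hpq Hedge. set (m := vadd (vscale (1 - t) p) (vscale t q)).
  assert (Hne : exists i, p i <> q i).
  { apply NNPP; intros Hn; apply Hpq; extensionality i.
    apply NNPP; intros Hi; apply Hn; eauto. }
  assert (Hmp : m <> p).
  { intros E. destruct Hne as [i Hi]. assert (E' := f_equal (fun f => f i) E).
    unfold m, vadd, vscale in E'. apply Hi. nra. }
  assert (Hmq : m <> q).
  { intros E. destruct Hne as [i Hi]. assert (E' := f_equal (fun f => f i) E).
    unfold m, vadd, vscale in E'. apply Hi. nra. }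
  split; [|split].
  - intros S' HS'. apply in_star in HS' as [S [HS Hc]]. exists S. split; [assumption|].
    intros r Hr. destruct Hc as [[Hp [Hq Hc]]|[_ ->]]; [|apply in_conv_In; assumption].
    assert (Hr' : r = m \/ In r S).
    { destruct Hc as [->| ->]; destruct Hr as [<-|Hr]; auto;
        apply in_remove in Hr; tauto. }
    destruct Hr' as [->|]; [|apply in_conv_In; assumption].
    apply in_conv_convex; [apply in_conv_In|apply in_conv_In|lra]; assumption.
  - intros S y HS Hy.
    destruct (classic (In p S /\ In q S)) as [[Hp Hq]|Hn].
    + set (V := nodup vec_dec (m :: S)).
      assert (HV : NoDup V) by apply NoDup_nodup.
      assert (HS0 : incl (m :: S) V) by apply nodup_incl_l.
      destruct (rep_exists V S y) as [w Hw]; [assumption| |assumption|].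
      { intros r Hr; apply HS0; right; assumption. }
      assert (HSr : forall a, incl (m :: remove vec_dec a S) V).
      { intros a r [<-|Hr]; [apply HS0; left; reflexivity|].
        apply in_remove in Hr. apply HS0; right; tauto. }
      destruct (pull_rep V t p q m HV Ht Hpq Hmp Hmq) with (S := S) (w := w) (y := y)
        as [w' [Hw'|Hw']]; try assumption; try reflexivity;
        try (apply HS0; simpl; tauto).
      * exists (m :: remove vec_dec p S). split.
        -- apply in_star. exists S. split; [assumption|]. left; auto.
        -- apply (rep_in_conv V _ w'); auto.
      * exists (m :: remove vec_dec q S). split.
        -- apply in_star. exists S. split; [assumption|]. left; auto.
        -- apply (rep_in_conv V _ w'); auto.
    + exists S. split; [|assumption]. apply in_star. exists S. split; [assumption|].
      right; auto.
  - intros HT V HV HTV.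
    destruct Hedge as [S0 [HS0 [Hp0 Hq0]]].
    assert (HA : incl (m :: remove vec_dec p S0) V).
    { apply HTV, in_star. exists S0. split; [assumption|left; auto]. }
    assert (HB : incl (m :: remove vec_dec q S0) V).
    { apply HTV, in_star. exists S0. split; [assumption|left; auto]. }
    assert (HmV : In m V) by (apply HA; left; reflexivity).
    assert (HpV : In p V) by (apply HB; right; apply in_in_remove; congruence).
    assert (HqV : In q V) by (apply HA; right; apply in_in_remove; congruence).
    assert (HTV' : forall S, In S T -> incl S V).
    { intros S HS. destruct (classic (In p S /\ In q S)) as [[Hp Hq]|Hn].
      - intros r Hr. destruct (vec_dec r p) as [->|Hrp]; [assumption|].
        apply (HTV (m :: remove vec_dec p S)).
        + apply in_star. exists S. split; [assumption|left; auto].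
        + right. apply in_in_remove; assumption.
      - apply HTV, in_star. exists S. split; [assumption|right; auto]. }
    (* As an old vertex, [m] would have two representations in [T]: the trivial one, and the one on
       the edge. *)
    assert (HmT : forall S, In S T -> ~ In m S).
    { intros S HS HmS.
      assert (E : delta m = push t p q m (delta m)).
      { apply (HT V HV HTV' S S0 _ _ m); try assumption.
        - repeat split.
          + apply delta_nonneg.
          + intros r Hr. destruct (vec_dec m r) as [<-|]; [assumption|].
            rewrite delta_diff in Hr by assumption; lra.
          + rewrite (lsum_ext V _ (fun r => delta m r * 1)) by (intros; ring).
            apply (lsum_delta V m (fun _ => 1)); assumption.
          + intros i. apply (lsum_delta V m (fun r => r i)); assumption.
        - apply (push_rep V t p q m HV Ht HpV HqV HmV eq_refl S0 (m :: nil));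
            try assumption; [intros r [->|[]]; left; reflexivity|].
          repeat split.
          + apply delta_nonneg.
          + intros r Hr. destruct (vec_dec m r) as [<-|]; [left; reflexivity|].
            rewrite delta_diff in Hr by assumption; lra.
          + rewrite (lsum_ext V _ (fun r => delta m r * 1)) by (intros; ring).
            apply (lsum_delta V m (fun _ => 1)); assumption.
          + intros i. apply (lsum_delta V m (fun r => r i)); assumption. }
      assert (E' := f_equal (fun f => f m) E). unfold push in E'.
      rewrite delta_same, (delta_diff p m), (delta_diff q m) in E' by congruence. lra. }
    assert (Hpush : forall S' w y, In S' (star p q m T) -> rep V S' w y ->
      (w p = 0 \/ w q = 0) /\ exists S, In S T /\ rep V S (push t p q m w) y).
    { intros S' w y HS' Hw. apply in_star in HS' as [S [HS Hc]].
      destruct Hc as [[Hp [Hq Hc]]|[Hn ->]].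
      - split.
        + destruct Hw as [_ [Hs _]]. destruct Hc as [->| ->]; [left|right];
            apply NNPP; intros Hn; destruct (Hs _ Hn) as [E|Hr];
            try congruence; apply in_remove in Hr; tauto.
        + exists S. split; [assumption|].
          apply (push_rep V t p q m HV Ht HpV HqV HmV eq_refl S S'); try assumption.
          intros r Hr. destruct Hc as [->| ->]; destruct Hr as [<-|Hr]; auto;
            apply in_remove in Hr; tauto.
      - assert (Hm0 : w m = 0).
        { destruct Hw as [_ [Hs _]]. apply NNPP; intros Hn'. apply (HmT S HS), Hs, Hn'. }
        split.
        + destruct Hw as [_ [Hs _]]. apply NNPP. intros Hn'. apply Hn.
          split; apply Hs; tauto.
        + exists S. split; [assumption|]. replace (push t p q m w) with w; [assumption|].
          extensionality r. unfold push. rewrite Hm0. ring. }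
    intros S1 S2 w1 w2 y HS1 HS2 Hw1 Hw2.
    destruct (Hpush S1 w1 y HS1 Hw1) as [Hz1 [P1 [HP1 Hr1]]].
    destruct (Hpush S2 w2 y HS2 Hw2) as [Hz2 [P2 [HP2 Hr2]]].
    apply (push_inj t p q m Ht Hpq Hmp Hmq); try assumption.
    + apply Hw1.
    + apply Hw2.
    + apply (HT V HV HTV' P1 P2 _ _ y); assumption.
Qed.

Definition one_sided (n : nat) (l : vec * R) (S : list vec) : Prop :=
  (forall p, In p S -> 0 <= aff n l p) \/ (forall p, In p S -> aff n l p <= 0).

(* Starring all crossing edges terminates: a new edge ends in a point of the hyperplane,
   so the finite set E of crossing edges only shrinks. *)
Lemma refine_crossing n l (E : list (vec * vec)) T :
  (forall S p q, In S T -> In p S -> In q S -> aff n l p < 0 < aff n l q -> In (p, q) E) ->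
  exists T', refines T' T /\ forall S, In S T' -> one_sided n l S.
Proof.
  revert T; induction E as [|[p q] E IH]; intros T HT.
  - exists T. split; [apply refines_refl|]. intros S HS. unfold one_sided.
    destruct (classic (exists p, In p S /\ aff n l p < 0)) as [[p [Hp Hlp]]|Hn].
    + right. intros q Hq. apply Rnot_lt_le. intros Hlq.
      apply (HT S p q); auto.
    + left. intros q Hq. apply Rnot_lt_le. intros Hlq. apply Hn. eauto.
  - destruct (classic (aff n l p < 0 < aff n l q /\ exists S, In S T /\ In p S /\ In q S))
      as [[Hc Hedge]|Hn].
    (* The parameter at which [l] vanishes on the segment from [p] to [q]. *)
    + set (t := - aff n l p / (aff n l q - aff n l p)).
      assert (Hi : 0 < / (aff n l q - aff n l p)) by (apply Rinv_0_lt_compat; lra).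
      assert (E1 : (aff n l q - aff n l p) * / (aff n l q - aff n l p) = 1)
        by (field; lra).
      assert (Ht : 0 < t < 1) by (unfold t, Rdiv; split; nra).
      assert (Hpq : p <> q) by (intros ->; lra).
      set (m := vadd (vscale (1 - t) p) (vscale t q)).
      assert (Hm : aff n l m = 0) by (unfold m; rewrite aff_comb; unfold t; field; lra).
      destruct (IH (star p q m T)) as [T' [HT' Hs]].
      * intros S' p' q' HS' Hp' Hq' Hc'. apply in_star in HS' as [S [HS Hch]].
        (* Since [l] vanishes at [m], both ends of a crossing edge of the new list are old
           vertices. *)
        assert (Hold : forall r, aff n l r <> 0 -> In r S' -> In r S).
        { intros r Hr Hin. destruct Hch as [[_ [_ [->| ->]]]|[_ ->]]; [| |assumption];
            (destruct Hin as [<-|Hin]; [lra|apply in_remove in Hin; tauto]). }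
        assert (Hin : In (p', q') ((p, q) :: E))
          by (apply (HT S); [assumption|apply Hold|apply Hold|]; auto; lra).
        destruct Hin as [Heq|]; [exfalso|assumption]. injection Heq as <- <-.
        destruct Hch as [[_ [_ [->| ->]]]|[Hn ->]]; [| |tauto].
        -- destruct Hp' as [Heq|Hin]; [rewrite <- Heq in Hc; lra|].
           apply in_remove in Hin. tauto.
        -- destruct Hq' as [Heq|Hin]; [rewrite <- Heq in Hc; lra|].
           apply in_remove in Hin. tauto.
      * exists T'. split; [|assumption].
        eapply refines_trans; [exact HT'|]. apply star_refines; assumption.
    + apply IH. intros S p' q' HS Hp' Hq' Hc.
      destruct (HT S p' q' HS Hp' Hq' Hc) as [Heq|]; [exfalso|assumption].
      injection Heq as <- <-. apply Hn. eauto.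
Qed.

(** Cutting along a further hyperplane does not spoil the others: the vertices of a new member lie
    in the hull of an old one, and half-spaces are convex. *)
Lemma refine_hyperplanes n (L : list (vec * R)) T :
  exists T', refines T' T /\ forall S l, In S T' -> In l L -> one_sided n l S.
Proof.
  induction L as [|l L [T1 [H1 Hs1]]].
  - exists T. split; [apply refines_refl|]. intros S l _ [].
  - destruct (refine_crossing n l (list_prod (concat T1) (concat T1)) T1) as [T2 [H2 Hs2]].
    + intros S p q HS Hp Hq _. apply in_prod; apply in_concat; eauto.
    + exists T2. split; [eapply refines_trans; eassumption|].
      intros S l' HS [<-|Hl']; [apply Hs2; assumption|].
      destruct H2 as [A2 _]. destruct (A2 S HS) as [S1 [HS1 Hin]].
      destruct (Hs1 S1 l' HS1 Hl') as [Hge|Hle]; [left|right]; intros p Hp.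
      * apply (in_conv_ind (fun y => 0 <= aff n l' y) S1); auto using aff_nonneg_convex.
      * apply (in_conv_ind (fun y => aff n l' y <= 0) S1); auto using aff_nonpos_convex.
Qed.

(** * Triangulations from simplicial families *)

Lemma lsum_extend V V' f :
  NoDup V -> NoDup V' -> incl V V' -> (forall p, f p <> 0 -> In p V) ->
  lsum V f = lsum V' f.
Proof.
  intros HV HV'. revert f; induction HV as [|a V Ha HV IH]; intros f Hi Hf.
  - symmetry. apply lsum_0. intros p _. apply NNPP; intros Hn; apply (Hf p Hn).
  - assert (E : forall p, f p = 1 * (f p - f a * delta a p) + f a * (delta a p * 1))
      by (intros; ring).
    rewrite (lsum_ext V' _ _ (fun p _ => E p)), lsum_lin.
    rewrite (lsum_delta V' a (fun _ => 1)) by (auto; apply Hi; left; reflexivity).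
    rewrite <- IH; simpl.
    + rewrite (lsum_ext V (fun p => f p - f a * delta a p) f); [ring|].
      intros p Hp. rewrite delta_diff by (intros ->; contradiction). ring.
    + intros p Hp; apply Hi; right; assumption.
    + intros p Hp. destruct (vec_dec a p) as [<-|Hap].
      * rewrite delta_same in Hp. lra.
      * rewrite delta_diff in Hp by assumption.
        destruct (Hf p) as [|]; [lra|congruence|assumption].
Qed.

Lemma rep_extend V V' S w y :
  NoDup V -> NoDup V' -> incl V V' -> incl S V -> rep V S w y -> rep V' S w y.
Proof.
  intros HV HV' Hi HS [H0 [Hs [H1 Hy]]]. repeat split; auto.
  - rewrite <- H1. symmetry. apply lsum_extend; auto.
  - intros i. rewrite <- Hy. symmetry. apply lsum_extend; auto.
    intros p Hp. apply HS, Hs. intros E; apply Hp; rewrite E; ring.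
Qed.

(** Weights on a face are weights on the whole simplex. The summation list is enlarged first, since
    [simplicial T] speaks only of lists containing all vertices of [T]. *)
Lemma simplicial_faces T T' :
  (forall S', In S' T' -> exists S, In S T /\ incl S' S) -> simplicial T -> simplicial T'.
Proof.
  intros Hf HT V HV HTV S1 S2 w1 w2 y HS1 HS2 Hw1 Hw2.
  set (V' := nodup vec_dec (V ++ concat T)).
  assert (HV' : NoDup V') by apply NoDup_nodup.
  assert (Hi : incl (V ++ concat T) V') by apply nodup_incl_l.
  assert (HiV : incl V V') by (intros p Hp; apply Hi, in_or_app; auto).
  destruct (Hf S1 HS1) as [P1 [HP1 Hi1]]. destruct (Hf S2 HS2) as [P2 [HP2 Hi2]].
  apply (HT V' HV') with (S := P1) (S' := P2) (y := y); try assumption.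
  - intros S HS p Hp. apply Hi, in_or_app. right. apply in_concat. eauto.
  - apply (rep_extend V V') in Hw1; auto. destruct Hw1 as [? [? [? ?]]]. repeat split; auto.
  - apply (rep_extend V V') in Hw2; auto. destruct Hw2 as [? [? [? ?]]]. repeat split; auto.
Qed.

Lemma fold_perturb c d e :
  fold_right Rplus 0 (map (fun x => d + e * x) c) =
  fold_right Rplus 0 (map (fun _ => d) c) + e * fold_right Rplus 0 c.
Proof. induction c as [|a c IH]; simpl; [ring|]. rewrite IH. ring. Qed.

Lemma lin_perturb c S d e f :
  lin (map (fun x => d + e * x) c) S f = lin (map (fun _ => d) c) S f + e * lin c S f.
Proof.
  revert S; induction c as [|a c IH]; intros [|s S]; simpl; try ring. rewrite IH. ring.
Qed.

Lemma lincomb_sub c S p0 i :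
  length c = length S ->
  lincomb c (map (fun p => vsub p p0) S) i = lincomb c S i - fold_right Rplus 0 c * p0 i.
Proof.
  revert S; induction c as [|a c IH]; intros [|s S] H; simpl in *; try congruence;
    unfold vzero; try ring.
  rewrite IH by congruence. unfold vsub. ring.
Qed.

Lemma fold_const (c : list R) d :
  fold_right Rplus 0 (map (fun _ => d) c) = INR (length c) * d.
Proof.
  induction c as [|a c IH]; [simpl; ring|].
  change (length (a :: c)) with (S (length c)). rewrite S_INR. simpl. rewrite IH. ring.
Qed.

Lemma fold_Rabs_bound c :
  Forall (fun x => Rabs x <= fold_right Rplus 0 (map Rabs c)) c /\
  Rabs (fold_right Rplus 0 c) <= fold_right Rplus 0 (map Rabs c).
Proof.
  induction c as [|a c [IH1 IH2]]; simpl; [split; [constructor|rewrite Rabs_R0; lra]|].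
  assert (H0 : 0 <= fold_right Rplus 0 (map Rabs c)).
  { clear. induction c as [|a c IH]; simpl; [lra|]. pose proof (Rabs_pos a). lra. }
  split.
  - constructor; [lra|]. eapply Forall_impl; [|exact IH1]. intros x Hx. simpl in Hx.
    pose proof (Rabs_pos a). lra.
  - pose proof (Rabs_triang a (fold_right Rplus 0 c)). lra.
Qed.

(** An affine dependence, scaled down, perturbs the weights of the barycentre into a second
    representation of the same point. *)
Lemma simplicial_aff_indep T S :
  simplicial T -> In S T -> NoDup S -> S <> nil -> aff_indep S.
Proof.
  intros HT HS Hnd Hne. destruct S as [|p0 S]; [congruence|]. intros c Hc Hz.
  (* [d] = 1/N is the weight of each vertex in the barycentre. With [e = d / B], neither a
     coefficient of [c] nor their sum, multiplied by [e], exceeds [d] in absolute value, so the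
     perturbed weights stay nonnegative. *)
  set (N := INR (length (p0 :: S))). set (B := 1 + fold_right Rplus 0 (map Rabs c)).
  destruct (fold_Rabs_bound c) as [Hb1 Hb2].
  assert (HN : 0 < N) by (apply lt_0_INR; simpl; lia).
  assert (HB : 1 <= B) by (unfold B; pose proof (Rabs_pos (fold_right Rplus 0 c)); lra).
  set (d := / N). assert (Hd : 0 < d) by (apply Rinv_0_lt_compat; assumption).
  set (e := d / B).
  assert (HBi : 0 < / B) by (apply Rinv_0_lt_compat; lra).
  assert (He : 0 < e) by (unfold e, Rdiv; nra).
  assert (HeB : e * B = d) by (unfold e; field; lra).
  assert (Hsmall : forall x, Rabs x <= fold_right Rplus 0 (map Rabs c) -> Rabs (e * x) <= d).
  { intros x Hx. rewrite Rabs_mult, (Rabs_pos_eq e) by lra. unfold B in HeB. nra. }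
  set (W1 := d :: map (fun _ => d) c).
  set (W2 := (d - e * fold_right Rplus 0 c) :: map (fun x => d + e * x) c).
  assert (HNd : N * d = 1) by (unfold d; field; lra).
  assert (HN1 : N = INR (length c) + 1)
    by (unfold N; change (length (p0 :: S)) with (Datatypes.S (length S));
        rewrite S_INR, Hc; reflexivity).
  set (V := nodup vec_dec (concat T)).
  assert (HV : NoDup V) by apply NoDup_nodup.
  assert (HTV : forall S0, In S0 T -> incl S0 V).
  { intros S0 HS0 p Hp. apply nodup_incl_l, in_concat. eauto. }
  assert (Hl1 : length W1 = length (p0 :: S)) by (simpl; rewrite length_map; congruence).
  assert (Hl2 : length W2 = length (p0 :: S)) by (simpl; rewrite length_map; congruence).
  assert (Hr1 : rep V (p0 :: S) (wfun W1 (p0 :: S)) (lincomb W1 (p0 :: S))).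
  { apply rep_of_weights; auto.
    - constructor; [lra|]. apply Forall_map, Forall_forall. intros; lra.
    - simpl. rewrite fold_const. rewrite HN1 in HNd. lra. }
  assert (Hr2 : rep V (p0 :: S) (wfun W2 (p0 :: S)) (lincomb W2 (p0 :: S))).
  { apply rep_of_weights; auto.
    - constructor.
      + specialize (Hsmall _ Hb2). pose proof (Rle_abs (e * fold_right Rplus 0 c)). lra.
      + apply Forall_map. eapply Forall_impl; [|exact Hb1]. intros x Hx. simpl in *.
        specialize (Hsmall _ Hx). rewrite <- Rabs_Ropp in Hsmall.
        pose proof (Rle_abs (- (e * x))). lra.
    - simpl. rewrite fold_perturb, fold_const. rewrite HN1 in HNd. lra. }
  assert (Heq : lincomb W2 (p0 :: S) = lincomb W1 (p0 :: S)).
  { extensionality i. simpl. rewrite !lin_lincomb, lin_perturb, <- !lin_lincomb.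
    assert (Hzi := f_equal (fun f => f i) Hz). simpl in Hzi.
    rewrite lincomb_sub in Hzi by assumption. unfold vzero in Hzi.
    replace (lincomb c S i) with (fold_right Rplus 0 c * p0 i) by lra. ring. }
  rewrite Heq in Hr2.
  assert (Hw := HT V HV HTV _ _ _ _ _ HS HS Hr1 Hr2).
  assert (HW : W1 = W2) by (apply (wfun_inj (p0 :: S)); auto; intros; rewrite Hw; reflexivity).
  unfold W1, W2 in HW. injection HW as _ HW. clearbody e d. clear -HW He.
  induction c as [|a c IH]; simpl in HW; [constructor|]. injection HW as Ha HW.
  constructor; [|apply IH; assumption]. apply Rmult_eq_reg_l with e; lra.
Qed.

(** A point of two members has the same weights in both, hence these are supported on the common
    vertices. *)
Lemma simplicial_triangulation n K T :
  simplicial T -> (forall S, In S T -> S <> nil /\ NoDup S /\ Forall (Rn n) S) ->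
  (forall y, K y <-> exists S, In S T /\ in_conv S y) -> triangulation n K T.
Proof.
  intros HT HS HK. split; [|split; [assumption|]].
  - intros S HST. destruct (HS S HST) as [Hne [Hnd HR]].
    split; [assumption|]. apply (simplicial_aff_indep T); assumption.
  - intros S S' HST HST' y. split.
    + intros [Hy Hy'].
      set (V := nodup vec_dec (concat T)).
      assert (HV : NoDup V) by apply NoDup_nodup.
      assert (HTV : forall S0, In S0 T -> incl S0 V).
      { intros S0 HS0 p Hp. apply nodup_incl_l, in_concat. eauto. }
      destruct (rep_exists V S y) as [w Hw]; auto.
      destruct (rep_exists V S' y) as [w' Hw']; auto.
      assert (E := HT V HV HTV _ _ _ _ _ HST HST' Hw Hw'). subst w'.
      set (inS' := fun p => if in_dec vec_dec p S' then true else false).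
      assert (Hl : forall p, In p (filter inS' S) <-> In p S /\ In p S').
      { intros p. rewrite filter_In. unfold inS'. destruct (in_dec vec_dec p S'); intuition congruence. }
      exists (filter inS' S). split; [intros p; apply Hl|].
      apply (rep_in_conv V _ w); [assumption| |].
      * intros p Hp. apply Hl in Hp. apply (HTV S); tauto.
      * destruct Hw as [H0 [Hs [H1 H2]]]. destruct Hw' as [_ [Hs' _]].
        repeat split; auto. intros p Hp. apply Hl. auto.
    + intros [l [Hl Hy]]. split; apply (in_conv_incl l); auto; intros p Hp; apply Hl; auto.
Qed.

(** * Triangulating a cube compatibly with hyperplanes *)

Definition evec (i j : nat) : R := if Nat.eq_dec j i then 1 else 0.

Lemma dot_evec n i y : (i < n)%nat -> dot n (evec i) y = y i.
Proof.
  intros Hi. unfold dot. rewrite (sumR_single n _ i); [|assumption|].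
  - unfold evec. destruct (Nat.eq_dec i i); [ring|congruence].
  - intros j _ Hj. unfold evec. destruct (Nat.eq_dec j i); [congruence|ring].
Qed.

Lemma lin_app W1 W2 S1 S2 f :
  length W1 = length S1 -> lin (W1 ++ W2) (S1 ++ S2) f = lin W1 S1 f + lin W2 S2 f.
Proof.
  revert S1; induction W1 as [|a W1 IH]; intros [|s S1] H; simpl in *; try congruence.
  - ring.
  - rewrite IH by congruence. ring.
Qed.

Lemma lin_map_seq (t : nat -> R) (b : nat -> vec) m f :
  lin (map t (seq 0 m)) (map b (seq 0 m)) f = sumR m (fun j => t j * f (b j)).
Proof.
  induction m as [|m IH]; [reflexivity|].
  rewrite seq_S, !map_app, lin_app by (rewrite !length_map; reflexivity).
  rewrite IH. simpl. ring.
Qed.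

Section Cube.
Variables (n : nat) (c : vec) (s : R).
Hypothesis Hs : s > 0.

(** The cube is enclosed in a simplex with corner [a], its lowest vertex, and legs of length [M]
    along the axes: the coordinates of y - a add up to at most 2sn on the cube. The added 1 keeps
    [M] positive when n = 0. *)
Let a : vec := fun i => if lt_dec i n then c i - s else 0.
Let M : R := 2 * s * INR n + 1.
Let b (i : nat) : vec := fun j => a j + M * evec i j.
Let S0 : list vec := a :: map b (seq 0 n).

Lemma cube_M_pos : 0 < M.
Proof. unfold M. pose proof (pos_INR n). nra. Qed.

Lemma cube_b_diag i : b i i = a i + M.
Proof. unfold b, evec. destruct (Nat.eq_dec i i); [ring|congruence]. Qed.

Lemma cube_b_off i j : j <> i -> b i j = a j.
Proof. intros H. unfold b, evec. destruct (Nat.eq_dec j i); [congruence|ring]. Qed.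

Lemma cube_corner_Rn : forall p, In p S0 -> Rn n p.
Proof.
  assert (Ha : Rn n a) by (intros i Hi; unfold a; destruct (lt_dec i n); [lia|reflexivity]).
  intros p [<-|Hp]; [exact Ha|]. apply in_map_iff in Hp as [i [<- Hi]]. apply in_seq in Hi.
  intros j Hj. rewrite cube_b_off by lia. apply Ha; assumption.
Qed.

Lemma cube_in_corner y : cube n c s y -> in_conv S0 y.
Proof.
  intros [Hy Hcy]. pose proof cube_M_pos as HM.
  assert (Hab : forall i, (i < n)%nat -> 0 <= y i - a i <= 2 * s).
  { intros i Hi. specialize (Hcy i Hi). unfold a. destruct (lt_dec i n); [|lia].
    unfold Rabs in Hcy. destruct (Rcase_abs (y i - c i)); lra. }
  assert (HMi : 0 < / M) by (apply Rinv_0_lt_compat; assumption).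
  set (t := fun i => (y i - a i) / M).
  assert (Hsum : sumR n t <= 1).
  { apply Rle_trans with (sumR n (fun _ => 2 * s / M)).
    - apply sumR_le. intros i Hi. unfold t, Rdiv. specialize (Hab i Hi). nra.
    - rewrite sumR_const. replace (INR n * (2 * s / M)) with ((M - 1) / M)
        by (unfold M; field; unfold M in HM; lra).
      replace ((M - 1) / M) with (1 - / M) by (field; lra). lra. }
  exists ((1 - sumR n t) :: map t (seq 0 n)). repeat split.
  - simpl. rewrite !length_map. reflexivity.
  - constructor; [lra|]. apply Forall_map, Forall_forall. intros i Hi. apply in_seq in Hi.
    unfold t, Rdiv. specialize (Hab i ltac:(lia)). nra.
  - simpl. rewrite (lin_one _ (map b (seq 0 n))) by (rewrite !length_map; reflexivity).
    rewrite lin_map_seq. rewrite (sumR_ext n (fun j => t j * 1) t) by (intros; ring). ring.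
  - extensionality j. simpl. rewrite lin_lincomb, lin_map_seq.
    rewrite (sumR_ext n (fun i => t i * b i j) (fun i => a j * t i + t i * (M * evec i j)))
      by (intros; unfold b; ring).
    rewrite sumR_plus, sumR_scal.
    destruct (Nat.lt_ge_cases j n) as [Hj|Hj].
    + rewrite (sumR_single n (fun i => t i * (M * evec i j)) j); [|assumption|].
      * assert (Htj : t j * M = y j - a j) by (unfold t; field; lra).
        change (sumR n (fun i => t i)) with (sumR n t).
        unfold evec. destruct (Nat.eq_dec j j); [|congruence]. lra.
      * intros i _ Hi. unfold evec. destruct (Nat.eq_dec j i); [congruence|ring].
    + rewrite (sumR_0 n (fun i => t i * (M * evec i j))).
      * rewrite Hy by assumption. unfold a. destruct (lt_dec j n); [lia|ring].
      * intros i Hi. unfold evec. destruct (Nat.eq_dec j i); [lia|ring].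
Qed.

(** Coordinate i of a point determines its weight at [b i], and the total weight 1 then determines
    the weight at [a]. *)
Lemma corner_simplicial : simplicial (S0 :: nil).
Proof.
  pose proof cube_M_pos as HM.
  assert (Hba : forall i, b i <> a).
  { intros i E. assert (E' := f_equal (fun f => f i) E). simpl in E'.
    rewrite cube_b_diag in E'. lra. }
  assert (Hbb : forall i j, i <> j -> b i <> b j).
  { intros i j Hij E. assert (E' := f_equal (fun f => f i) E). simpl in E'.
    rewrite cube_b_diag, cube_b_off in E' by assumption. lra. }
  intros V HV HTV S S' w w' y [<-|[]] [<-|[]] Hw Hw'.
  assert (HSV : incl S0 V) by (apply HTV; left; reflexivity).
  assert (Hcoord : forall v i, rep V S0 v y -> (i < n)%nat -> y i = a i + M * v (b i)).
  { intros v i [H0 [Hsupp [H1 Hy]]] Hi. rewrite <- Hy.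
    rewrite (lsum_ext V _ (fun p => a i * v p + M * (delta (b i) p * v p))).
    - rewrite lsum_lin, H1, lsum_delta; [ring|assumption|].
      apply HSV. right. apply in_map, in_seq. lia.
    - intros p _. destruct (Req_dec (v p) 0) as [->|Hp]; [ring|].
      destruct (Hsupp p Hp) as [<-|Hin].
      + rewrite delta_diff by apply Hba. ring.
      + apply in_map_iff in Hin as [j [<- _]]. destruct (Nat.eq_dec i j) as [<-|Hij].
        * rewrite delta_same, cube_b_diag. ring.
        * rewrite delta_diff by (apply Hbb; assumption). rewrite cube_b_off by assumption. ring. }
  assert (Hoff : forall p, p <> a -> w p = w' p).
  { intros p Hpa. destruct (classic (In p S0)) as [[Hp|Hp]|Hp]; [congruence| |].
    - apply in_map_iff in Hp as [i [<- Hi]]. apply in_seq in Hi.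
      assert (E := Hcoord w i Hw ltac:(lia)). assert (E' := Hcoord w' i Hw' ltac:(lia)).
      apply Rmult_eq_reg_l with M; lra.
    - destruct Hw as [_ [Hsw _]]. destruct Hw' as [_ [Hsw' _]].
      transitivity 0; [|symmetry]; apply NNPP; auto. }
  extensionality p. destruct (vec_dec p a) as [->|Hpa]; [|auto].
  assert (E : lsum V w - lsum V w' = w a - w' a).
  { transitivity (1 * lsum V w + -1 * lsum V w'); [ring|].
    rewrite <- lsum_lin. rewrite (lsum_ext V _ (fun p => delta a p * (w p - w' p))).
    - apply (lsum_delta V a (fun p => w p - w' p)); [assumption|].
      apply HSV; left; reflexivity.
    - intros p _. destruct (vec_dec a p) as [<-|Hap]; [rewrite delta_same; ring|].
      rewrite delta_diff by assumption. rewrite (Hoff p) by congruence. ring. }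
  destruct Hw as [_ [_ [H1 _]]]. destruct Hw' as [_ [_ [H1' _]]]. lra.
Qed.

Definition cube_faces : list (vec * R) :=
  flat_map (fun i => (evec i, s - c i) :: (vscale (-1) (evec i), s + c i) :: nil) (seq 0 n).

Lemma cube_faces_spec y :
  Rn n y -> (cube n c s y <-> forall l, In l cube_faces -> 0 <= aff n l y).
Proof.
  intros Hy. unfold cube, cube_faces. split.
  - intros [_ H] l Hl. apply in_flat_map in Hl as [i [Hi Hl]]. apply in_seq in Hi.
    specialize (H i ltac:(lia)).
    unfold Rabs in H; destruct (Rcase_abs (y i - c i));
      destruct Hl as [<-|[<-|[]]]; unfold aff; simpl;
      rewrite ?dot_scale_l, dot_evec by lia; lra.
  - intros H. split; [assumption|]. intros i Hi.
    assert (H1 : 0 <= aff n (evec i, s - c i) y).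
    { apply H, in_flat_map. exists i. split; [apply in_seq; lia|simpl; auto]. }
    assert (H2 : 0 <= aff n (vscale (-1) (evec i), s + c i) y).
    { apply H, in_flat_map. exists i. split; [apply in_seq; lia|simpl; auto]. }
    unfold aff in H1, H2. cbn [fst snd] in H1, H2.
    rewrite dot_evec in H1 by assumption. rewrite dot_scale_l, dot_evec in H2 by assumption.
    unfold Rabs; destruct (Rcase_abs (y i - c i)); lra.
Qed.

Lemma cube_convex : convex_set (cube n c s).
Proof.
  intros x y t [Hx Hcx] [Hy Hcy] Ht. split.
  - apply Rn_add; apply Rn_scale; assumption.
  - intros i Hi. specialize (Hcx i Hi). specialize (Hcy i Hi). unfold vadd, vscale.
    unfold Rabs in *. destruct (Rcase_abs (x i - c i)), (Rcase_abs (y i - c i)),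
      (Rcase_abs ((1 - t) * x i + t * y i - c i)); nra.
Qed.

(** The big simplex is cut along the facets of the cube together with [L], and each member is
    replaced by the face spanned by its vertices inside the cube. These faces still cover the cube,
    because a point of the cube has no weight on a vertex outside it. *)
Lemma triangulation_one_sided (L : list (vec * R)) :
  exists T, triangulation n (cube n c s) T /\
    forall S l, In S T -> In l L -> one_sided n l S.
Proof.
  destruct (refine_hyperplanes n (cube_faces ++ L) (S0 :: nil)) as [T1 [[HA [HB HC]] Hos]].
  set (inK := fun p => if excluded_middle_informative (cube n c s p) then true else false).
  assert (HinK : forall p, inK p = true <-> cube n c s p).
  { intros p. unfold inK. destruct (excluded_middle_informative (cube n c s p));
      intuition congruence. }
  set (face := fun S => nodup vec_dec (filter inK S)).
  assert (Hface : forall S p, In p (face S) <-> In p S /\ cube n c s p).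
  { intros S p. unfold face. rewrite nodup_In, filter_In, HinK. reflexivity. }
  (* Empty faces are discarded: [aff_indep nil] is false. *)
  set (T := filter (fun S => match S with nil => false | _ => true end) (map face T1)).
  assert (HT : forall S, In S T <-> S <> nil /\ exists S1, In S1 T1 /\ S = face S1).
  { intros S. unfold T. rewrite filter_In, in_map_iff. split.
    - intros [[S1 [<- HS1]] Hne]. split; [intros E; rewrite E in Hne; discriminate|eauto].
    - intros [Hne [S1 [HS1 ->]]]. split; [eauto|]. destruct (face S1); congruence. }
  assert (HR1 : forall S p, In S T1 -> In p S -> Rn n p).
  { intros S p HS Hp. destruct (HA S HS) as [S' [[<-|[]] Hin]].
    apply (in_conv_ind (Rn n) S0); [|exact cube_corner_Rn|auto].
    intros x y t Hx Hy _. apply Rn_add; apply Rn_scale; assumption. }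
  exists T. split.
  - apply simplicial_triangulation.
    + apply (simplicial_faces T1); [|apply HC, corner_simplicial].
      intros S HS. apply HT in HS as [_ [S1 [HS1 ->]]]. exists S1. split; [assumption|].
      intros p Hp. apply Hface in Hp. tauto.
    + intros S HS. apply HT in HS as [Hne [S1 [HS1 ->]]]. split; [assumption|split].
      * apply NoDup_nodup.
      * apply Forall_forall. intros p Hp. apply Hface in Hp. apply Hp.
    + intros y. split.
      * intros Hy. destruct (HB S0 y) as [S1 [HS1 Hy1]];
          [left; reflexivity|apply cube_in_corner; assumption|].
        assert (Hyf : in_conv (face S1) y).
        { set (V := nodup vec_dec S1).
          assert (HV : NoDup V) by apply NoDup_nodup.
          assert (HSV : incl S1 V) by apply nodup_incl_l.
          destruct (rep_exists V S1 y HV HSV Hy1) as [w Hw].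
          apply (rep_in_conv V _ w _ HV).
          - intros p Hp. apply Hface in Hp. apply HSV; tauto.
          - assert (Haff := fun l => rep_aff V S1 w y n l Hw).
            destruct Hw as [H0 [Hsupp [H1 Hyc]]]. repeat split; auto.
            intros p Hp. apply Hface. split; [auto|].
            apply cube_faces_spec; [apply (HR1 S1); auto|]. intros l Hl.
            destruct (Hos S1 l HS1 ltac:(apply in_or_app; auto)) as [Hge|Hle]; [auto|].
            (* [l <= 0] on the vertices but [l y >= 0], so [l] vanishes on the support. *)
            assert (Hly : 0 <= aff n l y)
              by (apply cube_faces_spec; [apply Hy|assumption|assumption]).
            rewrite Haff in Hly. apply Rnot_lt_le. intros Hlt.
            assert (Hneg : lsum V (fun q => w q * aff n l q) < 0); [|lra].
            assert (HpV : In p V) by auto.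
            assert (Hall : forall q, w q * aff n l q <= 0).
            { intros q. destruct (Req_dec (w q) 0) as [->|Hq]; [lra|].
              specialize (Hle q (Hsupp q Hq)). specialize (H0 q). nra. }
            assert (Hpp : w p * aff n l p < 0).
            { specialize (H0 p). assert (0 < w p) by lra. nra. }
            clear -HpV Hall Hpp. revert HpV. generalize V.
            intros V0. induction V0 as [|q V0 IH]; intros Hin; [destruct Hin|].
            assert (Hrest : lsum V0 (fun q0 => w q0 * aff n l q0) <= 0).
            { clear -Hall. induction V0 as [|q V0 IH]; simpl; [lra|]. specialize (Hall q). lra. }
            simpl. pose proof (Hall q). destruct Hin as [->|Hin]; [lra|].
            specialize (IH Hin). lra. }
        exists (face S1). split; [|assumption]. apply HT. split; [|eauto].
        intros E. rewrite E in Hyf. apply (in_conv_nil _ Hyf).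
      * intros [S [HS Hy]]. apply HT in HS as [_ [S1 [HS1 ->]]].
        apply (in_conv_ind (cube n c s) (face S1)); [exact cube_convex| |assumption].
        intros p Hp. apply Hface in Hp. tauto.
  - intros S l HS Hl. apply HT in HS as [_ [S1 [HS1 ->]]].
    destruct (Hos S1 l HS1 ltac:(apply in_or_app; auto)) as [Hge|Hle]; [left|right];
      intros p Hp; apply Hface in Hp; [apply Hge|apply Hle]; tauto.
Qed.

End Cube.

(** * Piecewise linear functions as lattice expressions *)

(** Lattice expressions in affine functions on the whole space. Absolute value is the only lattice
    constructor, as max(f, g) = (f + g + |f - g|) / 2. *)
Inductive PL (n : nat) : (vec -> R) -> Prop :=
| PL_aff l : PL n (aff n l)
| PL_add f g : PL n f -> PL n g -> PL n (fun y => f y + g y)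
| PL_scale r f : PL n f -> PL n (fun y => r * f y)
| PL_abs f : PL n f -> PL n (fun y => Rabs (f y)).

Lemma PL_ext n f g : (forall y, f y = g y) -> PL n f -> PL n g.
Proof. intros H. replace g with f; [auto|]. extensionality y. apply H. Qed.

Lemma PL_const n r : PL n (fun _ => r).
Proof.
  apply (PL_ext n (aff n (vzero, r))); [|constructor]. intros y. unfold aff. cbn [fst snd].
  unfold dot. rewrite sumR_0; [ring|]. intros; unfold vzero; ring.
Qed.

Lemma PL_sub n f g : PL n f -> PL n g -> PL n (fun y => f y - g y).
Proof.
  intros Hf Hg. apply (PL_ext n (fun y => f y + -1 * g y)); [intros; ring|].
  apply PL_add; [|apply PL_scale]; assumption.
Qed.

Lemma PL_max n f g : PL n f -> PL n g -> PL n (fun y => Rmax (f y) (g y)).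
Proof.
  intros Hf Hg.
  apply (PL_ext n (fun y => (1 / 2) * ((f y + g y) + Rabs (f y - g y)))).
  - intros y. unfold Rmax, Rabs. destruct (Rle_dec (f y) (g y)), (Rcase_abs (f y - g y)); lra.
  - apply PL_scale, PL_add; [apply PL_add; assumption|]. apply PL_abs, PL_sub; assumption.
Qed.

Lemma PL_sum n k (f : nat -> vec -> R) :
  (forall i, (i < k)%nat -> PL n (f i)) -> PL n (fun y => sumR k (fun i => f i y)).
Proof.
  induction k as [|k IH]; intros H; simpl; [apply PL_const|].
  apply PL_add; [apply IH; intros; apply H; lia|apply H; lia].
Qed.

Lemma PL_dot n v : PL n (fun y => dot n y v).
Proof.
  apply (PL_ext n (aff n (v, 0))); [|constructor]. intros y. unfold aff. cbn [fst snd].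
  rewrite dot_sym. ring.
Qed.

Lemma PL_coord n i : (i < n)%nat -> PL n (fun y => y i).
Proof.
  intros Hi. apply (PL_ext n (fun y => dot n y (evec i))); [|apply PL_dot].
  intros y. rewrite dot_sym. apply dot_evec; assumption.
Qed.

Lemma PL_max_list n Fs :
  Fs <> nil -> (forall f, In f Fs -> PL n f) ->
  exists h, PL n h /\ (forall f y, In f Fs -> f y <= h y) /\
    forall y, exists f, In f Fs /\ h y = f y.
Proof.
  induction Fs as [|f Fs IH]; intros Hne HF; [congruence|].
  destruct Fs as [|f' Fs].
  - exists f. split; [apply HF; left; reflexivity|split].
    + intros g y [->|[]]. lra.
    + intros y. exists f. split; [left|]; reflexivity.
  - destruct IH as [h [Hh [H1 H2]]]; [congruence|intros; apply HF; right; assumption|].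
    exists (fun y => Rmax (f y) (h y)). split; [|split].
    + apply PL_max; [apply HF; left; reflexivity|assumption].
    + intros g y [->|Hg]; [apply Rmax_l|].
      eapply Rle_trans; [apply H1; eassumption|apply Rmax_r].
    + intros y. unfold Rmax. destruct (Rle_dec (f y) (h y)).
      * destruct (H2 y) as [g [Hg Hy]]. exists g. split; [right|]; assumption.
      * exists f. split; [left|]; reflexivity.
Qed.

Lemma PL_min_aff n (J : list (vec * R)) :
  J <> nil -> exists h, PL n h /\ (forall l y, In l J -> h y <= aff n l y) /\
    forall y, exists l, In l J /\ h y = aff n l y.
Proof.
  intros Hne.
  destruct (PL_max_list n (map (fun l y => -1 * aff n l y) J)) as [h [Hh [H1 H2]]].
  - destruct J; simpl; congruence.
  - intros f Hf. apply in_map_iff in Hf as [l [<- _]]. apply PL_scale, PL_aff.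
  - exists (fun y => -1 * h y). split; [apply PL_scale; assumption|split].
    + intros l y Hl. specialize (H1 _ y (in_map _ _ _ Hl)). simpl in H1. lra.
    + intros y. destruct (H2 y) as [f [Hf Hy]]. apply in_map_iff in Hf as [l [<- Hl]].
      exists l. split; [assumption|]. lra.
Qed.

Definition sign_constant (n : nat) (L : list (vec * R)) (C : vec -> Prop) : Prop :=
  forall l, In l L -> (forall y, C y -> 0 <= aff n l y) \/ (forall y, C y -> aff n l y <= 0).

Lemma sign_constant_app n L L' C :
  sign_constant n (L ++ L') C -> sign_constant n L C /\ sign_constant n L' C.
Proof. intros H; split; intros l Hl; apply H, in_or_app; auto. Qed.

Definition affine_among (n : nat) (M : list (vec * R)) (h : vec -> R) (C : vec -> Prop) :=
  exists l, In l M /\ forall y, C y -> h y = aff n l y.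

(** [L] collects the affine functions whose signs decide the absolute values; for |f| these include
    all possible pieces of f. The region [C] is quantified last, so one pair of finite lists serves
    all cells of any subdivision. *)
Lemma PL_pieces n h :
  PL n h -> exists L M, forall C, sign_constant n L C -> affine_among n M h C.
Proof.
  induction 1 as [l|f g _ [L1 [M1 H1]] _ [L2 [M2 H2]]|r f _ [L [M H]]|f _ [L [M H]]].
  - exists nil, (l :: nil). intros C _. exists l. split; [left|]; reflexivity.
  - exists (L1 ++ L2),
      (map (fun a => (vadd (fst (fst a)) (fst (snd a)), snd (fst a) + snd (snd a)))
        (list_prod M1 M2)).
    intros C HC. apply sign_constant_app in HC as [HC1 HC2].
    destruct (H1 C HC1) as [l1 [Hl1 E1]]. destruct (H2 C HC2) as [l2 [Hl2 E2]].
    exists (vadd (fst l1) (fst l2), snd l1 + snd l2). split.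
    + apply in_map_iff. exists (l1, l2). split; [reflexivity|]. apply in_prod; assumption.
    + intros y Hy. rewrite E1, E2 by assumption. unfold aff. cbn [fst snd].
      rewrite dot_add_l. ring.
  - exists L, (map (fun l => (vscale r (fst l), r * snd l)) M). intros C HC.
    destruct (H C HC) as [l [Hl E]]. exists (vscale r (fst l), r * snd l). split.
    + apply in_map_iff. exists l. auto.
    + intros y Hy. rewrite E by assumption. unfold aff. cbn [fst snd].
      rewrite dot_scale_l. ring.
  - exists (L ++ M), (M ++ map (fun l => (vscale (-1) (fst l), -1 * snd l)) M).
    intros C HC. apply sign_constant_app in HC as [HC1 HC2].
    destruct (H C HC1) as [l [Hl E]]. destruct (HC2 l Hl) as [Hge|Hle].
    + exists l. split; [apply in_or_app; auto|]. intros y Hy. rewrite E by assumption.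
      apply Rabs_pos_eq; auto.
    + exists (vscale (-1) (fst l), -1 * snd l). split.
      * apply in_or_app. right. apply in_map_iff. exists l. auto.
      * intros y Hy. rewrite E by assumption. rewrite Rabs_left1 by auto.
        unfold aff. cbn [fst snd]. rewrite dot_scale_l. ring.
Qed.

Lemma dot_bound n v w : Rabs (dot n v w) <= sumR n (fun i => Rabs (v i)) * norm n w.
Proof.
  unfold dot. assert (H : forall k, (k <= n)%nat -> Rabs (sumR k (fun i => v i * w i)) <=
    sumR k (fun i => Rabs (v i)) * norm n w); [|apply H; lia].
  induction k as [|k IH]; intros Hk; simpl; [rewrite Rabs_R0; lra|].
  specialize (IH ltac:(lia)). pose proof (norm_coord n w k ltac:(lia)).
  pose proof (Rabs_triang (sumR k (fun i => v i * w i)) (v k * w k)).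
  rewrite Rabs_mult in H0. pose proof (Rabs_pos (v k)). nra.
Qed.

Lemma PL_lipschitz n h :
  PL n h -> exists k, 0 <= k /\ forall y z, Rabs (h z - h y) <= k * norm n (vsub z y).
Proof.
  induction 1 as [l|f g _ [k1 [K1 H1]] _ [k2 [K2 H2]]|r f _ [k [K H]]|f _ [k [K H]]].
  - exists (sumR n (fun i => Rabs (fst l i))). split.
    + apply sumR_nonneg; intros; apply Rabs_pos.
    + intros y z. replace (aff n l z - aff n l y) with (dot n (fst l) (vsub z y))
        by (unfold aff; rewrite dot_sub_r; ring). apply dot_bound.
  - exists (k1 + k2). split; [lra|]. intros y z. specialize (H1 y z). specialize (H2 y z).
    pose proof (Rabs_triang (f z - f y) (g z - g y)).
    replace (f z + g z - (f y + g y)) with (f z - f y + (g z - g y)) by ring. lra.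
  - exists (Rabs r * k). split; [apply Rmult_le_pos; [apply Rabs_pos|assumption]|].
    intros y z. replace (r * f z - r * f y) with (r * (f z - f y)) by ring.
    rewrite Rabs_mult, Rmult_assoc. apply Rmult_le_compat_l; [apply Rabs_pos|apply H].
  - exists k. split; [assumption|]. intros y z. eapply Rle_trans; [apply Rabs_triang_inv2|].
    apply H.
Qed.

Lemma PL_continuous_on n K h : PL n h -> continuous_on n K h.
Proof.
  intros Hh. destruct (PL_lipschitz n h Hh) as [k [Hk H]]. intros y eps _ He.
  assert (Hi : 0 < / (k + 1)) by (apply Rinv_0_lt_compat; lra).
  exists (eps * / (k + 1)). split; [nra|]. intros z _ Hz. specialize (H y z).
  pose proof (norm_nonneg n (vsub z y)).
  assert (eps * / (k + 1) * (k + 1) = eps) by (field; lra). nra.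
Qed.

Lemma PL_sign_constant_affine n L M h S :
  (forall C, sign_constant n L C -> affine_among n M h C) ->
  (forall l, In l L -> one_sided n l S) -> affine_among n M h (in_conv S).
Proof.
  intros H HS. apply H. intros l Hl. destruct (HS l Hl) as [Hge|Hle]; [left|right].
  - apply in_conv_ind; [apply aff_nonneg_convex|assumption].
  - apply in_conv_ind; [apply aff_nonpos_convex|assumption].
Qed.

Lemma PL_in_RX n X f h :
  (forall x, X x -> Rn n x) -> bounded_set n X -> PL n h -> (forall x, X x -> f x = h x) ->
  in_RX n X f.
Proof.
  intros HX [B HB] Hh Hf. set (s := Rabs B + 1).
  assert (Hs : s > 0) by (unfold s; pose proof (Rabs_pos B); lra).
  assert (Hc : Rn n vzero) by (intros i _; reflexivity).
  destruct (PL_pieces n h Hh) as [L [M HLM]].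
  destruct (triangulation_one_sided n vzero s Hs L) as [T [HT Hos]].
  exists vzero, s, T, h.
  refine (conj Hs (conj Hc (conj _ (conj HT (conj _ (conj _ Hf)))))).
  - intros x Hx. split; [apply HX; assumption|]. intros i Hi. unfold vzero.
    rewrite Rminus_0_r. pose proof (norm_coord n x i Hi). specialize (HB x Hx).
    pose proof (Rle_abs B). unfold s. lra.
  - apply PL_continuous_on; assumption.
  - intros S HS. destruct (PL_sign_constant_affine n L M h S HLM) as [l [_ Hl]].
    + intros l Hl. apply Hos; assumption.
    + exists (fst l), (snd l). exact Hl.
Qed.

(** * Continuous piecewise affine functions as maxima of minima *)

Definition continuous_01 (phi : R -> R) : Prop :=
  forall t eps, 0 <= t <= 1 -> eps > 0 ->
  exists d, d > 0 /\ forall t', 0 <= t' <= 1 -> Rabs (t' - t) < d -> Rabs (phi t' - phi t) < eps.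

(** A piece that differs from [phi] at [t0] differs from it on a whole neighbourhood; finitely many
    pieces have a common one. *)
Lemma active_pieces_local phi (A : list (R * R)) t0 :
  continuous_01 phi -> 0 <= t0 <= 1 ->
  exists d, d > 0 /\ forall t, 0 <= t <= 1 -> Rabs (t - t0) < d ->
    forall l, In l A -> phi t = fst l * t + snd l -> phi t0 = fst l * t0 + snd l.
Proof.
  intros Hphi Ht0. induction A as [|[m c] A [d [Hd IH]]].
  - exists 1. split; [lra|]. intros t _ _ l [].
  - destruct (Req_dec (phi t0) (m * t0 + c)) as [E|E].
    + exists d. split; [assumption|]. intros t Ht Htd l [<-|Hl] Hlt; [assumption|].
      apply (IH t); assumption.
    + set (e := Rabs (phi t0 - (m * t0 + c))).
      assert (He : 0 < e) by (apply Rabs_pos_lt; lra).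
      destruct (Hphi t0 (e / 2) Ht0 ltac:(lra)) as [d' [Hd' Hc]].
      assert (Hm : 0 < 2 * (Rabs m + 1)) by (pose proof (Rabs_pos m); lra).
      (* Within [d''] of [t0] the piece changes by less than e/2, and within [d'] so does [phi];
         together they cannot close a gap of [e]. *)
      set (d'' := e / (2 * (Rabs m + 1))).
      assert (Hd'' : 0 < d'')
        by (unfold d'', Rdiv; apply Rmult_lt_0_compat;
            [|apply Rinv_0_lt_compat]; assumption).
      assert (Hd''e : d'' * (2 * (Rabs m + 1)) = e) by (unfold d''; field; lra).
      exists (Rmin d (Rmin d' d'')). split; [repeat apply Rmin_glb_lt; assumption|].
      intros t Ht Htd.
      assert (H1 : Rabs (t - t0) < d) by (eapply Rlt_le_trans; [exact Htd|apply Rmin_l]).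
      assert (H2 : Rabs (t - t0) < Rmin d' d'')
        by (eapply Rlt_le_trans; [exact Htd|apply Rmin_r]).
      assert (H3 : Rabs (t - t0) < d') by (eapply Rlt_le_trans; [exact H2|apply Rmin_l]).
      assert (H4 : Rabs (t - t0) < d'') by (eapply Rlt_le_trans; [exact H2|apply Rmin_r]).
      intros l [<-|Hl] Hlt; [exfalso|apply (IH t); assumption].
      simpl in Hlt. specialize (Hc t Ht H3).
      assert (H5 : Rabs (m * (t - t0)) < e / 2).
      { rewrite Rabs_mult. pose proof (Rabs_pos m). pose proof (Rabs_pos (t - t0)). nra. }
      assert (H6 : e <= Rabs (phi t - phi t0) + Rabs (m * (t - t0))).
      { unfold e. rewrite <- (Rabs_Ropp (phi t - phi t0)).
        eapply Rle_trans; [|apply Rabs_triang]. right. f_equal. rewrite Hlt. ring. }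
      lra.
Qed.

(** Otherwise every piece nonpositive at 0 is negative at 1. The pieces active just after 0 vanish
    at 0, so [phi] turns negative; let [tau] be the end of the initial interval where it stays so. A
    piece active just before [tau] is also active at [tau] and rises from a negative value to
    [phi tau >= 0]. Hence it is negative at 0 and nonnegative at 1, a contradiction. *)
Lemma pieces_1d_zero phi (A : list (R * R)) :
  continuous_01 phi -> phi 0 = 0 -> phi 1 = 0 ->
  (forall t, 0 <= t <= 1 -> exists l, In l A /\ phi t = fst l * t + snd l) ->
  exists l, In l A /\ snd l <= 0 /\ 0 <= fst l + snd l.
Proof.
  intros Hphi H0 H1 HA. apply NNPP. intros Hn.
  assert (Hneg : forall l, In l A -> snd l <= 0 -> fst l + snd l < 0).
  { intros l Hl Hc. apply Rnot_le_lt. intros Hle. apply Hn. eauto. }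
  set (E := fun t => 0 <= t <= 1 /\ forall s, 0 < s <= t -> phi s < 0).
  destruct (active_pieces_local phi A 0 Hphi ltac:(lra)) as [d0 [Hd0 Hloc0]].
  assert (HE0 : E (Rmin (d0 / 2) (1 / 2))).
  { assert (0 < Rmin (d0 / 2) (1 / 2)) by (apply Rmin_glb_lt; lra).
    pose proof (Rmin_l (d0 / 2) (1 / 2)). pose proof (Rmin_r (d0 / 2) (1 / 2)).
    split; [lra|]. intros s Hs. destruct (HA s ltac:(lra)) as [l [Hl Hls]].
    assert (E0 := Hloc0 s ltac:(lra)
      ltac:(rewrite Rminus_0_r, Rabs_pos_eq; lra) l Hl Hls).
    specialize (Hneg l Hl). nra. }
  destruct (completeness E) as [tau [Hub Hlub]].
  { exists 1. intros t [Ht _]. lra. }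
  { eauto. }
  assert (Htau0 : 0 < tau).
  { apply Rlt_le_trans with (Rmin (d0 / 2) (1 / 2)); [apply Rmin_glb_lt; lra|auto]. }
  assert (Htau1 : tau <= 1) by (apply Hlub; intros t [Ht _]; lra).
  assert (Hbelow : forall s, 0 < s < tau -> phi s < 0).
  { intros s Hs. apply NNPP. intros Hns. assert (tau <= s); [|lra].
    apply Hlub. intros t [Ht Hneg']. apply Rnot_lt_le. intros Hst.
    apply Hns, Hneg'. lra. }
  (* At [tau = 1] this is the boundary value; elsewhere a negative value would let the interval be
     prolonged past [tau]. *)
  assert (Htau : 0 <= phi tau).
  { destruct (Req_dec tau 1) as [->|Hne]; [lra|]. apply Rnot_lt_le. intros Hlt.
    destruct (Hphi tau (- phi tau) ltac:(lra) ltac:(lra)) as [d [Hd Hc]].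
    assert (HE : E (Rmin 1 (tau + d / 2))).
    { pose proof (Rmin_l 1 (tau + d / 2)). pose proof (Rmin_r 1 (tau + d / 2)).
      assert (0 < Rmin 1 (tau + d / 2)) by (apply Rmin_glb_lt; lra).
      split; [lra|]. intros s Hs. destruct (Rlt_le_dec s tau); [apply Hbelow; lra|].
      specialize (Hc s ltac:(lra) ltac:(rewrite Rabs_pos_eq; lra)).
      apply Rabs_def2 in Hc. lra. }
    specialize (Hub _ HE). assert (tau < Rmin 1 (tau + d / 2)) by (apply Rmin_glb_lt; lra).
    lra. }
  destruct (active_pieces_local phi A tau Hphi ltac:(lra)) as [d [Hd Hloc]].
  set (t := Rmax (tau / 2) (tau - d / 2)).
  assert (Ht1 : tau / 2 <= t) by apply Rmax_l. assert (Ht2 : tau - d / 2 <= t) by apply Rmax_r.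
  assert (Ht3 : t < tau) by (apply Rmax_lub_lt; lra).
  destruct (HA t ltac:(lra)) as [l [Hl Hlt]].
  assert (Et := Hloc t ltac:(lra) ltac:(rewrite Rabs_left; lra) l Hl Hlt).
  pose proof (Hbelow t ltac:(lra)) as Hphit. specialize (Hneg l Hl).
  assert (Hm : 0 < fst l) by (apply Rnot_le_lt; intros Hm; nra).
  assert (Hc : snd l < 0) by nra. specialize (Hneg ltac:(lra)). nra.
Qed.

(** Subtracting the chord of [phi] from [phi] and from all pieces reduces to boundary values 0. *)
Lemma pieces_1d phi (A : list (R * R)) :
  continuous_01 phi ->
  (forall t, 0 <= t <= 1 -> exists l, In l A /\ phi t = fst l * t + snd l) ->
  exists l, In l A /\ snd l <= phi 0 /\ phi 1 <= fst l + snd l.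
Proof.
  intros Hphi HA. set (m := phi 1 - phi 0).
  destruct (pieces_1d_zero (fun t => phi t - phi 0 - m * t)
    (map (fun l => (fst l - m, snd l - phi 0)) A)) as [l [Hl [H1 H2]]].
  - intros t eps Ht He. destruct (Hphi t (eps / 2) Ht ltac:(lra)) as [d [Hd Hc]].
    assert (Hm : 0 < 2 * (Rabs m + 1)) by (pose proof (Rabs_pos m); lra).
    set (d' := eps / (2 * (Rabs m + 1))).
    assert (Hd' : 0 < d')
      by (unfold d', Rdiv; apply Rmult_lt_0_compat; [|apply Rinv_0_lt_compat]; lra).
    assert (Hd'e : d' * (2 * (Rabs m + 1)) = eps) by (unfold d'; field; lra).
    exists (Rmin d d'). split; [apply Rmin_glb_lt; assumption|]. intros t' Ht' Htd.
    assert (G1 : Rabs (t' - t) < d) by (eapply Rlt_le_trans; [exact Htd|apply Rmin_l]).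
    assert (G2 : Rabs (t' - t) < d') by (eapply Rlt_le_trans; [exact Htd|apply Rmin_r]).
    specialize (Hc t' Ht' G1).
    replace (phi t' - phi 0 - m * t' - (phi t - phi 0 - m * t))
      with ((phi t' - phi t) + - (m * (t' - t))) by ring.
    eapply Rle_lt_trans; [apply Rabs_triang|]. rewrite Rabs_Ropp, Rabs_mult.
    pose proof (Rabs_pos m). pose proof (Rabs_pos (t' - t)). nra.
  - ring.
  - unfold m. ring.
  - intros t Ht. destruct (HA t Ht) as [l [Hl E]].
    exists (fst l - m, snd l - phi 0). split; [apply in_map_iff; exists l; auto|].
    cbn [fst snd]. rewrite E. ring.
  - apply in_map_iff in Hl as [l' [<- Hl']]. cbn [fst snd] in *. exists l'.
    split; [assumption|]. unfold m in *. lra.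
Qed.

Lemma norm_scale n r x : norm n (vscale r x) = Rabs r * norm n x.
Proof.
  unfold norm. rewrite dot_scale_l, dot_scale_r, <- Rmult_assoc.
  rewrite sqrt_mult_alt by nra. f_equal. apply sqrt_Rsqr_abs.
Qed.

(** The one-dimensional lemma on the segment from [a] to [b]. It is what makes the max-min formula
    hold: among the pieces lying above [g] at [b] there is one lying below [g] at [a]. *)
Lemma pieces_segment n K g (L : list (vec * R)) a b :
  convex_set K -> continuous_on n K g ->
  (forall y, K y -> exists l, In l L /\ g y = aff n l y) -> K a -> K b ->
  exists l, In l L /\ aff n l a <= g a /\ g b <= aff n l b.
Proof.
  intros HK Hg HL Ha Hb.
  set (z := fun t => vadd (vscale (1 - t) a) (vscale t b)).
  assert (HzK : forall t, 0 <= t <= 1 -> K (z t)) by (intros; apply HK; assumption).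
  assert (Hz0 : z 0 = a) by (extensionality i; unfold z, vadd, vscale; ring).
  assert (Hz1 : z 1 = b) by (extensionality i; unfold z, vadd, vscale; ring).
  destruct (pieces_1d (fun t => g (z t))
    (map (fun l => (aff n l b - aff n l a, aff n l a)) L)) as [l [Hl [H1 H2]]].
  - intros t eps Ht He. destruct (Hg (z t) eps (HzK t Ht) He) as [d [Hd Hc]].
    set (N := norm n (vsub b a)). assert (HN : 0 <= N) by apply norm_nonneg.
    assert (Hi : 0 < / (N + 1)) by (apply Rinv_0_lt_compat; lra).
    exists (d * / (N + 1)). split; [nra|]. intros t' Ht' Htd. apply Hc; [auto|].
    replace (vsub (z t') (z t)) with (vscale (t' - t) (vsub b a))
      by (extensionality i; unfold z, vsub, vscale, vadd; ring).
    rewrite norm_scale. fold N.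
    assert (d * / (N + 1) * (N + 1) = d) by (field; lra).
    pose proof (Rabs_pos (t' - t)). nra.
  - intros t Ht. destruct (HL (z t) (HzK t Ht)) as [l [Hl E]].
    exists (aff n l b - aff n l a, aff n l a). split; [apply in_map_iff; exists l; auto|].
    cbn [fst snd]. rewrite E. unfold z. rewrite aff_comb. ring.
  - apply in_map_iff in Hl as [l' [<- Hl']]. cbn [fst snd] in *.
    rewrite Hz0 in H1. rewrite Hz1 in H2. exists l'. split; [assumption|]. lra.
Qed.

(** The points [b] form an infinite set, but only finitely many sublists arise from them; this makes
    the outer maximum finite. *)
Lemma filter_images (A B : Type) (p : B -> A -> bool) (L : list A) :
  exists LL, forall b, In (filter (p b) L) LL.
Proof.
  induction L as [|x L [LL H]].
  - exists (nil :: nil). intros b; left; reflexivity.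
  - exists (LL ++ map (cons x) LL). intros b. simpl. apply in_or_app.
    destruct (p b x); [right; apply in_map|left]; apply H.
Qed.

(* [g] is the maximum over [b] of the minimum of the pieces lying above [g] at [b]. *)
Lemma pieces_PL n K g (L : list (vec * R)) :
  convex_set K -> (exists x, K x) -> continuous_on n K g ->
  (forall y, K y -> exists l, In l L /\ g y = aff n l y) ->
  exists h, PL n h /\ forall y, K y -> g y = h y.
Proof.
  intros HK [x0 Hx0] Hg HL.
  set (p := fun b l => if Rle_dec (g b) (aff n l b) then true else false).
  assert (Hp : forall b l, In l (filter (p b) L) <-> In l L /\ g b <= aff n l b).
  { intros b l. rewrite filter_In. unfold p.
    destruct (Rle_dec (g b) (aff n l b)); intuition congruence. }
  assert (Hne : forall b, K b -> filter (p b) L <> nil).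
  { intros b Hb E. destruct (HL b Hb) as [l [Hl El]].
    assert (Hin : In l (filter (p b) L)) by (apply Hp; split; [assumption|lra]).
    rewrite E in Hin. destruct Hin. }
  destruct (filter_images _ _ p L) as [LL HLL].
  (* A sublist that arises from a point of [K] is nonempty, so that its minimum exists. *)
  set (good := fun J => exists b, K b /\ J = filter (p b) L).
  destruct (choice_fun (list (vec * R)) (vec -> R) (fun J f => good J ->
    PL n f /\ (forall l y, In l J -> f y <= aff n l y) /\
    forall y, exists l, In l J /\ f y = aff n l y)) as [F HF].
  { intros J. destruct (classic (J = nil)) as [->|HJ].
    - exists (fun _ => 0). intros [b [Hb E]]. symmetry in E. destruct (Hne b Hb E).
    - destruct (PL_min_aff n J HJ) as [f Hf]. exists f. auto. }
  set (Js := filter (fun J => if excluded_middle_informative (good J) then true else false) LL).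
  assert (HJs : forall J, In J Js <-> In J LL /\ good J).
  { intros J. unfold Js. rewrite filter_In.
    destruct (excluded_middle_informative (good J)); intuition congruence. }
  assert (HJb : forall b, K b -> In (filter (p b) L) Js).
  { intros b Hb. apply HJs. split; [apply HLL|]. exists b. auto. }
  destruct (PL_max_list n (map F Js)) as [h [Hh [H1 H2]]].
  - intros E. apply map_eq_nil in E. specialize (HJb x0 Hx0). rewrite E in HJb. destruct HJb.
  - intros f Hf. apply in_map_iff in Hf as [J [<- HJ]]. apply HF, HJs, HJ.
  - exists h. split; [assumption|]. intros a Ha. apply Rle_antisym.
    (* The sublist selected at [a] itself contains only pieces above [g] at [a]. *)
    + eapply Rle_trans; [|apply (H1 (F (filter (p a) L)))].
      * destruct (HF (filter (p a) L)) as [_ [_ Hl]]; [apply HJs, HJb, Ha|].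
        destruct (Hl a) as [l [Hin E]]. rewrite E. apply Hp in Hin. tauto.
      * apply in_map, HJb, Ha.
    (* The maximum at [a] is attained by the sublist of some [b], and [pieces_segment] finds in it a
       piece below [g] at [a]. *)
    + destruct (H2 a) as [f [Hf ->]]. apply in_map_iff in Hf as [J [<- HJ]].
      apply HJs in HJ as [_ HJ]. destruct (HF J HJ) as [_ [Hle _]].
      destruct HJ as [b [Hb ->]].
      destruct (pieces_segment n K g L a b HK Hg HL Ha Hb) as [l [Hl [Hla Hlb]]].
      eapply Rle_trans; [apply Hle|exact Hla]. apply Hp. auto.
Qed.

Lemma in_RX_PL n X f :
  in_RX n X f -> exists h, PL n h /\ forall x, X x -> f x = h x.
Proof.
  intros [c [s [T [g [Hs [Hc [HX [[_ [Hcov _]] [Hg [Haff Hf]]]]]]]]]].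
  destruct (choice_fun (list vec) (vec * R) (fun S l => In S T ->
    forall y, in_conv S y -> g y = aff n l y)) as [F HF].
  { intros S. destruct (classic (In S T)) as [HS|HS].
    - destruct (Haff S HS) as [a [b Hab]]. exists (a, b). intros _. exact Hab.
    - exists (vzero, 0). tauto. }
  destruct (pieces_PL n (cube n c s) g (map F T)) as [h [Hh E]].
  - apply cube_convex; assumption.
  - exists c. split; [assumption|]. intros i _. rewrite Rminus_diag, Rabs_R0. lra.
  - assumption.
  - intros y Hy. apply Hcov in Hy as [S [HS Hy]]. exists (F S).
    split; [apply in_map; assumption|]. apply HF; assumption.
  - exists h. split; [assumption|]. intros x Hx. rewrite Hf, E; auto.
Qed.

(** * Ideals *)

Lemma PL_cvp n h s y : PL n h -> cvp s y -> Un_cv (fun k => h (s k)) (h y).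
Proof.
  intros Hh Hs. induction Hh as [l|f g _ IHf _ IHg|r f _ IH|f _ IH].
  - apply CV_plus; [|apply cv_const]. apply (cv_dot n (fun _ => fst l)); intros i _;
      [apply cv_const|apply Hs].
  - apply (CV_plus (fun k => f (s k)) (fun k => g (s k))); assumption.
  - apply (CV_mult (fun _ => r) (fun k => f (s k))); [apply cv_const|assumption].
  - apply (cv_cvabs (fun k => f (s k))); assumption.
Qed.

Definition point_ideal (n : nat) (X : vec -> Prop) (x : vec) (f : vec -> R) : Prop :=
  in_RX n X f /\ f x = 0.

Section Ideals.
Variables (n : nat) (X : vec -> Prop).
Hypotheses (HXn : forall x, X x -> Rn n x) (Hne : exists x, X x) (Hcpt : compact_set n X).

Lemma RX_PL f : PL n f -> in_RX n X f.
Proof. intros Hf. apply (PL_in_RX n X f f); auto. apply Hcpt. Qed.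

Lemma RX_add f g : in_RX n X f -> in_RX n X g -> in_RX n X (fun y => f y + g y).
Proof.
  intros Hf Hg. apply in_RX_PL in Hf as [hf [Hhf Ef]]. apply in_RX_PL in Hg as [hg [Hhg Eg]].
  apply (PL_in_RX n X _ (fun y => hf y + hg y)); auto; [apply Hcpt|apply PL_add; assumption|].
  intros x Hx. rewrite Ef, Eg by assumption. reflexivity.
Qed.

Lemma RX_scale r f : in_RX n X f -> in_RX n X (fun y => r * f y).
Proof.
  intros Hf. apply in_RX_PL in Hf as [hf [Hhf Ef]].
  apply (PL_in_RX n X _ (fun y => r * hf y)); auto; [apply Hcpt|apply PL_scale; assumption|].
  intros x Hx. rewrite Ef by assumption. reflexivity.
Qed.

Lemma RX_abs f : in_RX n X f -> in_RX n X (fun y => Rabs (f y)).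
Proof.
  intros Hf. apply in_RX_PL in Hf as [hf [Hhf Ef]].
  apply (PL_in_RX n X _ (fun y => Rabs (hf y))); auto; [apply Hcpt|apply PL_abs; assumption|].
  intros x Hx. rewrite Ef by assumption. reflexivity.
Qed.

Lemma RX_max f : in_RX n X f -> exists x, X x /\ forall y, X y -> f y <= f x.
Proof.
  intros Hf. apply in_RX_PL in Hf as [h [Hh E]].
  destruct (seq_compact_max X h Hne (compact_seq_compact n X HXn Hcpt)) as [x [Hx Hmax]].
  - intros s y _ Hs. apply (PL_cvp n); assumption.
  - exists x. split; [assumption|]. intros y Hy. rewrite !E by assumption. auto.
Qed.

Lemma point_ideal_riesz x : X x -> riesz_ideal n X (point_ideal n X x).
Proof.
  intros Hx. split; [intros f Hf; apply Hf|split; [|split; [|split]]].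
  - split; [apply RX_PL, PL_const|reflexivity].
  - intros f g [Hf Ef] [Hg Eg]. split; [apply RX_add; assumption|]. rewrite Ef, Eg. ring.
  - intros r f [Hf Ef]. split; [apply RX_scale; assumption|]. rewrite Ef. ring.
  - intros f g [Hg Eg] Hf Hle. split; [assumption|]. specialize (Hle x Hx).
    rewrite Eg, Rabs_R0 in Hle. apply NNPP; intros Hn. apply Rabs_pos_lt in Hn. lra.
Qed.

(** An ideal above this one with some f such that f(x) is nonzero contains every h, because h -
    (h(x)/f(x)) f vanishes at x. *)
Lemma point_ideal_maximal x : X x -> maximal_ideal n X (point_ideal n X x).
Proof.
  intros Hx. split; [apply point_ideal_riesz; assumption|split].
  - exists (fun _ => 1). split; [apply RX_PL, PL_const|]. intros [_ E]. lra.
  - intros J [HJ [_ [Hadd [Hsc _]]]] HIJ.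
    destruct (classic (forall f, J f -> point_ideal n X x f)) as [|Hn]; [left; assumption|right].
    apply not_all_ex_not in Hn as [f Hn]. apply imply_to_and in Hn as [Hf Hn].
    assert (Hfx : f x <> 0) by (intros E; apply Hn; split; auto).
    intros h Hh. set (r := h x / f x).
    replace h with (fun y => (h y + - r * f y) + r * f y) by (extensionality y; ring).
    apply (Hadd (fun y => h y + - r * f y) (fun y => r * f y)); [|apply Hsc; assumption].
    apply HIJ. split.
    + apply (RX_add h (fun y => - r * f y)); [assumption|apply RX_scale; auto].
    + unfold r. field. assumption.
Qed.

(* If [f] were not in [I], then [1 <= |h| + m |f|] on [X] for some [h] in [I], and
   [|h| + |g|], which lies in [I], would have a positive minimum on [X]. *)
Lemma maximal_ideal_zeros I f g :
  maximal_ideal n X I -> I g -> in_RX n X f -> (forall x, X x -> g x = 0 -> f x = 0) -> I f.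
Proof.
  intros [[HI [H0 [Hadd [Hsc Hsol]]]] [_ Hmax]] Hg Hf Hz. apply NNPP. intros Hnf.
  assert (Habs : forall h, I h -> I (fun y => Rabs (h y))).
  { intros h Hh. apply (Hsol _ h Hh); [apply RX_abs; auto|]. intros x _.
    rewrite Rabs_Rabsolu. lra. }
  (* The ideal generated by [I] and [f]. *)
  set (J := fun p => in_RX n X p /\ exists h m, I h /\ 0 <= m /\
    forall x, X x -> Rabs (p x) <= Rabs (h x) + m * Rabs (f x)).
  assert (HJ : riesz_ideal n X J).
  { split; [intros p Hp; apply Hp|split; [|split; [|split]]].
    - split; [auto|]. exists (fun _ => 0), 0. split; [assumption|split; [lra|]].
      intros x _. rewrite Rabs_R0. lra.
    - intros p q [Hp [h [m [Hh [Hm Hle]]]]] [Hq [h' [m' [Hh' [Hm' Hle']]]]].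
      split; [apply RX_add; assumption|].
      exists (fun y => Rabs (h y) + Rabs (h' y)), (m + m').
      split; [apply (Hadd (fun y => Rabs (h y)) (fun y => Rabs (h' y))); auto|split; [lra|]].
      intros x Hx. specialize (Hle x Hx). specialize (Hle' x Hx).
      pose proof (Rabs_triang (p x) (q x)). pose proof (Rabs_pos (h x)).
      pose proof (Rabs_pos (h' x)). rewrite (Rabs_pos_eq (Rabs (h x) + _)) by lra. lra.
    - intros r p [Hp [h [m [Hh [Hm Hle]]]]]. split; [apply RX_scale; assumption|].
      exists (fun y => r * h y), (Rabs r * m). split; [auto|split].
      + apply Rmult_le_pos; [apply Rabs_pos|assumption].
      + intros x Hx. rewrite !Rabs_mult. specialize (Hle x Hx). pose proof (Rabs_pos r). nra.
    - intros p q [Hq [h [m [Hh [Hm Hle]]]]] Hp Hpq. split; [assumption|].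
      exists h, m. split; [assumption|split; [assumption|]]. intros x Hx.
      eapply Rle_trans; [apply Hpq|apply Hle]; assumption. }
  destruct (Hmax J HJ) as [HJI|HJall].
  - intros p Hp. split; [auto|]. exists p, 0. split; [assumption|split; [lra|]].
    intros x _. lra.
  - apply Hnf, HJI. split; [assumption|]. exists (fun _ => 0), 1.
    split; [assumption|split; [lra|]]. intros x _. rewrite Rabs_R0. lra.
  - destruct (HJall (fun _ => 1)) as [_ [h [m [Hh [Hm Hle]]]]]; [apply RX_PL, PL_const|].
    set (k := fun y => Rabs (h y) + Rabs (g y)).
    assert (Hk : I k) by (apply (Hadd (fun y => Rabs (h y)) (fun y => Rabs (g y))); auto).
    assert (Hkpos : forall x, X x -> 0 < k x).
    { intros x Hx. unfold k. pose proof (Rabs_pos (h x)). pose proof (Rabs_pos (g x)).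
      destruct (Req_dec (g x) 0) as [E|E]; [|apply Rabs_pos_lt in E; lra].
      specialize (Hle x Hx). rewrite (Hz x Hx E), Rabs_R0, Rabs_R1 in Hle. lra. }
    (* Dividing the maximum of |f| by the minimum of [k] bounds |f| by a multiple of [k], so [f]
       would lie in [I]. *)
    destruct (RX_max (fun y => -1 * k y)) as [x [Hx Hmin]]; [apply RX_scale; auto|].
    destruct (RX_max (fun y => Rabs (f y))) as [z [Hzx Hfz]]; [apply RX_abs; auto|].
    specialize (Hkpos x Hx). apply Hnf.
    apply (Hsol f (fun y => Rabs (f z) / k x * k y)); [apply Hsc; assumption|assumption|].
    intros y Hy. specialize (Hmin y Hy). simpl in Hmin. specialize (Hfz y Hy).
    simpl in Hfz. set (B := Rabs (f z)) in *. assert (HB : 0 <= B) by apply Rabs_pos.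
    assert (Hi : 0 < / k x) by (apply Rinv_0_lt_compat; assumption).
    assert (Hq : 0 <= B / k x) by (unfold Rdiv; nra).
    assert (Hqk : B / k x * k x = B) by (field; lra).
    assert (Hxy : B / k x * k x <= B / k x * k y) by (apply Rmult_le_compat_l; lra).
    rewrite (Rabs_pos_eq (B / k x * k y)); lra.
Qed.

Lemma finite_ratio_bound (f g : vec -> R) (ps : list vec) :
  (forall p, In p ps -> g p = 0 -> f p = 0) ->
  exists m : nat, forall p, In p ps -> Rabs (f p) <= INR m * Rabs (g p).
Proof.
  induction ps as [|p ps IH]; intros H; [exists O; intros p []|].
  destruct IH as [m Hm]; [intros; apply H; [right|]; assumption|].
  assert (Hp : exists m', Rabs (f p) <= INR m' * Rabs (g p)).
  { destruct (Req_dec (g p) 0) as [E|E].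
    - exists O. rewrite (H p (or_introl eq_refl) E), Rabs_R0. simpl. lra.
    - apply Rabs_pos_lt in E. destruct (INR_unbounded (Rabs (f p) / Rabs (g p))) as [m' Hm'].
      exists m'. assert (Hq : Rabs (f p) / Rabs (g p) * Rabs (g p) = Rabs (f p)) by (field; lra).
      rewrite <- Hq. apply Rmult_le_compat_r; lra. }
  destruct Hp as [m' Hm'].
  assert (Hmon : forall j r, (j <= max m m')%nat -> 0 <= r -> INR j * r <= INR (max m m') * r).
  { intros j r Hj Hr. apply Rmult_le_compat_r; [assumption|apply le_INR; assumption]. }
  exists (max m m'). intros q [<-|Hq].
  - eapply Rle_trans; [exact Hm'|]. apply Hmon; [lia|apply Rabs_pos].
  - eapply Rle_trans; [apply Hm; assumption|]. apply Hmon; [lia|apply Rabs_pos].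
Qed.

(** The pieces resolved are those of |hf| and |hg|: both sides of the bound are then affine on every
    member, and it is enough to compare them at the vertices, which lie in [X]. *)
Lemma polytope_ratio_bound f g :
  is_polytope n X -> in_RX n X f -> in_RX n X g -> (forall x, X x -> g x = 0 -> f x = 0) ->
  exists m : nat, forall x, X x -> Rabs (f x) <= INR m * Rabs (g x).
Proof.
  intros [ps [_ HX]] Hf Hg Hz.
  apply in_RX_PL in Hf as [hf [Hhf Ef]]. apply in_RX_PL in Hg as [hg [Hhg Eg]].
  destruct (PL_pieces n _ (PL_abs n hf Hhf)) as [L1 [M1 H1]].
  destruct (PL_pieces n _ (PL_abs n hg Hhg)) as [L2 [M2 H2]].
  destruct (refine_hyperplanes n (L1 ++ L2) (ps :: nil)) as [T [[HA [HB _]] Hos]].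
  assert (HTX : forall S p, In S T -> In p S -> X p).
  { intros S p HS Hp. destruct (HA S HS) as [S' [[<-|[]] Hin]]. apply HX; auto. }
  destruct (finite_ratio_bound hf hg (concat T)) as [m Hm].
  - intros p Hp E. apply in_concat in Hp as [S [HS Hp]].
    assert (Hx : X p) by (apply (HTX S); assumption).
    rewrite <- Ef by assumption. apply Hz; [assumption|]. rewrite Eg; assumption.
  - exists m. intros x Hx. rewrite Ef, Eg by assumption.
    destruct (HB ps x) as [S [HS HxS]]; [left; reflexivity|apply HX; assumption|].
    destruct (PL_sign_constant_affine n L1 M1 _ S H1) as [l1 [_ A1]].
    { intros l Hl; apply Hos; [assumption|apply in_or_app; auto]. }
    destruct (PL_sign_constant_affine n L2 M2 _ S H2) as [l2 [_ A2]].
    { intros l Hl; apply Hos; [assumption|apply in_or_app; auto]. }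
    simpl in A1, A2. rewrite A1, A2 by assumption.
    apply (in_conv_ind (fun y => aff n l1 y <= INR m * aff n l2 y) S); [| |assumption].
    + intros y z t Hy Hzz Ht. rewrite !aff_comb. nra.
    + intros p Hp. rewrite <- A1, <- A2 by (apply in_conv_In; assumption).
      apply Hm, in_concat. eauto.
Qed.

(** The maximal ideals used are those of the zeros of [g]. If [g] has no zero on [X], the family is
    empty and the principal ideal is all of R(X). *)
Lemma polytope_strongly_semisimple : is_polytope n X -> strongly_semisimple n X.
Proof.
  intros HP g Hg. exists (fun I => exists x, X x /\ g x = 0 /\ I = point_ideal n X x).
  split; [intros I [x [Hx [_ ->]]]; apply point_ideal_maximal; assumption|].
  intros f. split.
  - intros [Hf [m Hm]]. split; [assumption|]. intros I [x [Hx [E ->]]].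
    split; [assumption|]. specialize (Hm x Hx). rewrite E, Rabs_R0 in Hm.
    apply NNPP; intros Hn. apply Rabs_pos_lt in Hn. lra.
  - intros [Hf HI]. split; [assumption|]. apply polytope_ratio_bound; try assumption.
    intros x Hx E. destruct (HI (point_ideal n X x)) as [_ Ex]; [|assumption].
    exists x. auto.
Qed.

Lemma strongly_semisimple_ratio_bound f g :
  strongly_semisimple n X -> in_RX n X f -> in_RX n X g ->
  (forall x, X x -> g x = 0 -> f x = 0) ->
  exists m : nat, forall x, X x -> Rabs (f x) <= INR m * Rabs (g x).
Proof.
  intros HS Hf Hg Hz. destruct (HS g Hg) as [F [HF HFg]].
  apply (HFg f). split; [assumption|]. intros I HI.
  apply (maximal_ideal_zeros I f g); auto.
  apply (HFg g); [|assumption]. split; [assumption|]. exists 1%nat. intros x _. simpl. lra.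
Qed.

End Ideals.

(** * Frenet frames *)

Definition ev (Q : nat -> Prop) : Prop := exists N, forall i, (N <= i)%nat -> Q i.

Lemma ev_mono (P Q : nat -> Prop) : (forall i, P i -> Q i) -> ev P -> ev Q.
Proof. intros H [N HN]. exists N. auto. Qed.

Lemma ev_and (P Q : nat -> Prop) : ev P -> ev Q -> ev (fun i => P i /\ Q i).
Proof.
  intros [N HN] [N' HN']. exists (max N N'). intros i Hi.
  split; [apply HN|apply HN']; lia.
Qed.

Lemma ev_all k (Q : nat -> nat -> Prop) :
  (forall j, (j < k)%nat -> ev (fun i => Q i j)) ->
  ev (fun i => forall j, (j < k)%nat -> Q i j).
Proof.
  induction k as [|k IH]; intros H; [exists O; intros; lia|].
  destruct (ev_and _ _ (IH ltac:(intros; apply H; lia)) (H k ltac:(lia))) as [N HN].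
  exists N. intros i Hi j Hj. destruct (HN i Hi) as [H1 H2].
  destruct (Nat.eq_dec j k) as [->|]; [assumption|apply H1; lia].
Qed.

Lemma cv_ev u l eps : Un_cv u l -> 0 < eps -> ev (fun i => Rabs (u i - l) < eps).
Proof. intros H He. destruct (H eps He) as [N HN]. exists N. intros; apply HN; lia. Qed.

Lemma dot_residual n j u y v :
  (forall l, (l < j)%nat -> dot n (u l) v = 0) -> dot n (residual n j u y) v = dot n y v.
Proof.
  intros H. unfold residual. rewrite dot_sub_l. unfold proj.
  rewrite (dot_sum_l n j (fun l => dot n y (u l))), sumR_0; [ring|].
  intros l Hl. rewrite H by assumption. ring.
Qed.

Lemma residual_S n j u y i :
  residual n (S j) u y i = residual n j u y i - dot n y (u j) * u j i.
Proof. unfold residual, vsub, proj. simpl. ring. Qed.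

(** [N] is the yardstick, in the applications the norm of a residual: eventually a > N/2 and |p| <
    (eps/2) N. *)
Lemma ratio_small (p a N : nat -> R) eps :
  (forall i, 0 < N i) -> Un_cv (fun i => a i / N i) 1 -> Un_cv (fun i => p i / N i) 0 ->
  0 < eps -> ev (fun i => Rabs (p i) <= eps * a i).
Proof.
  intros HN Ha Hp He.
  apply (ev_mono (fun i => Rabs (a i / N i - 1) < / 2 /\ Rabs (p i / N i - 0) < eps / 2)).
  - intros i [H1 H2]. specialize (HN i). apply Rabs_def2 in H1.
    rewrite Rminus_0_r in H2. apply Rabs_def2 in H2.
    assert (E1 : a i / N i * N i = a i) by (field; lra).
    assert (E2 : p i / N i * N i = p i) by (field; lra).
    assert (Ea : / 2 * N i <= a i) by nra.
    assert (Eea : eps * (/ 2 * N i) <= eps * a i) by (apply Rmult_le_compat_l; lra).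
    assert (Ep : - (eps / 2) * N i <= p i / N i * N i <= eps / 2 * N i)
      by (split; apply Rmult_le_compat_r; lra).
    apply Rabs_le. lra.
  - apply ev_and; apply cv_ev; try assumption; lra.
Qed.

Section Frame.
Variables (n : nat) (s : nat -> vec) (x : vec) (k : nat) (u : nat -> vec).
Hypotheses (Hcv : converges n s x) (HF : frenet_frame n s x k u).

Let a (i j : nat) : R := dot n (vsub (s i) x) (u j).
Let N (j i : nat) : R := norm n (residual n j u (vsub (s i) x)).

Lemma frame_unit l : (l < k)%nat -> dot n (u l) (u l) = 1.
Proof. intros Hl. apply norm_dot_1. destruct HF as [_ [H _]]. apply H; assumption. Qed.

Lemma frame_norm_pos j i : (j < k)%nat -> 0 < N j i.
Proof.
  intros Hj. destruct HF as [_ [_ [_ H]]]. destruct (H j Hj) as [Hne _].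
  specialize (Hne i). pose proof (norm_nonneg n (residual n j u (vsub (s i) x))).
  fold (N j i) in *. lra.
Qed.

Lemma frame_coord j c :
  (j < k)%nat -> (c < n)%nat ->
  Un_cv (fun i => residual n j u (vsub (s i) x) c / N j i) (u j c).
Proof.
  intros Hj Hc. destruct HF as [_ [_ [_ H]]]. destruct (H j Hj) as [_ Hcvj].
  rewrite converges_iff in Hcvj. eapply cv_ext; [|exact (Hcvj c Hc)].
  intros i. unfold vscale, N, Rdiv. ring.
Qed.

(** For [l >= j], projecting out [u 0], ..., [u (j-1)] leaves the coordinate along [u l] unchanged,
    so it can be read off the residual, whose direction tends to [u j]. With l = j the limit is 1
    and with l = j + 1 it is 0: coordinates become positive, and each is negligible against the
    preceding one. *)
Lemma frame_dot j l :
  (j <= l)%nat -> (l < k)%nat -> Un_cv (fun i => a i l / N j i) (dot n (u j) (u l)).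
Proof.
  intros Hj Hl. destruct HF as [_ [_ [Hort _]]].
  apply (cv_ext (fun i => dot n (fun c => residual n j u (vsub (s i) x) c / N j i) (u l))).
  - intros i. unfold a.
    rewrite <- (dot_residual n j u (vsub (s i) x) (u l)) by (intros; apply Hort; lia).
    unfold Rdiv. rewrite Rmult_comm, <- dot_scale_l.
    apply sumR_ext; intros; unfold vscale; ring.
  - apply cv_dot; intros c Hc; [apply frame_coord; [lia|assumption]|apply cv_const].
Qed.

Lemma frame_diag j : (j < k)%nat -> Un_cv (fun i => a i j / N j i) 1.
Proof. intros Hj. rewrite <- (frame_unit j Hj). apply frame_dot; lia. Qed.

Lemma frame_pos j : (j < k)%nat -> ev (fun i => 0 < a i j).
Proof.
  intros Hj. eapply ev_mono; [|apply (cv_ev _ _ (/ 2) (frame_diag j Hj)); lra].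
  intros i H. simpl in H. apply Rabs_def2 in H. pose proof (frame_norm_pos j i Hj).
  assert (a i j / N j i * N j i = a i j) by (field; lra). nra.
Qed.

Lemma frame_ratio j eps :
  (S j < k)%nat -> 0 < eps -> ev (fun i => Rabs (a i (S j)) <= eps * a i j).
Proof.
  intros Hj He. apply (ratio_small _ _ (N j)); [| |  |assumption].
  - intros i. apply frame_norm_pos; lia.
  - apply frame_diag; lia.
  - destruct HF as [_ [_ [Hort _]]]. rewrite <- (Hort j (S j)) by lia. apply frame_dot; lia.
Qed.

(** The next residual is the present one minus its component along [u j]; divided by [N j i], both
    terms tend to [u j]. *)
Lemma frame_residual j c eps :
  (j < k)%nat -> (c < n)%nat -> 0 < eps ->
  ev (fun i => Rabs (residual n (S j) u (vsub (s i) x) c) <= eps * a i j).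
Proof.
  intros Hj Hc He. apply (ratio_small _ _ (N j)); [| | |assumption].
  - intros i. apply frame_norm_pos; lia.
  - apply frame_diag; lia.
  - replace 0 with (u j c - 1 * u j c) by ring.
    apply (cv_ext (fun i => residual n j u (vsub (s i) x) c / N j i - a i j / N j i * u j c)).
    + intros i. rewrite residual_S. unfold a, Rdiv. ring.
    + apply CV_minus; [apply frame_coord; assumption|].
      apply (CV_mult (fun i => a i j / N j i) (fun _ => u j c));
        [apply frame_diag; assumption|apply cv_const].
Qed.

Lemma frame_small j eps : 0 < eps -> ev (fun i => Rabs (a i j) < eps).
Proof.
  intros He. assert (Hc : Un_cv (fun i => a i j) 0).
  { replace 0 with (dot n (vsub x x) (u j)) by (rewrite dot_sub_l; ring).
    rewrite converges_iff in Hcv. apply cv_dot; intros c Hc; [|apply cv_const].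
    apply CV_minus; [auto|apply cv_const]. }
  eapply ev_mono; [|apply (cv_ev _ _ eps Hc He)]. intros i H. simpl in H.
  rewrite Rminus_0_r in H. assumption.
Qed.

End Frame.

(** * Outgoing tangents destroy strong semisimplicity *)

(** If [tau l] is the coordinate along [lam l] times [u l], and [tau k = 0], these are the
    barycentric weights on the vertices of the chain. [chain_weight_sum] is summation by parts; the
    simplex is thereby described by 1 >= tau 0 >= tau 1 >= ... >= 0. *)
Definition chain_weight (tau : nat -> R) (m : nat) : R :=
  match m with O => 1 - tau O | S m' => tau m' - tau (S m') end.

Lemma chain_weight_sum tau k (P : nat -> R) :
  sumR (S k) (fun m => chain_weight tau m * P m) =
  P O + sumR k (fun l => tau l * (P (S l) - P l)) - tau k * P k.
Proof. induction k as [|k IH]; [simpl; ring|]. simpl in *. rewrite IH. ring. Qed.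

Section Outgoing.
Variables (n : nat) (x : vec) (k : nat) (u : nat -> vec) (lam : nat -> R).
Hypotheses (Hk : (1 <= k)%nat) (Hlam : forall j, (j < k)%nat -> lam j > 0)
  (Hort : forall l m, (l < k)%nat -> (m < k)%nat -> l <> m -> dot n (u l) (u m) = 0).

(** The value 0 at index [k] makes the last weight equal to [tau (k-1)]. *)
Let tau (y : vec) (m : nat) : R :=
  if lt_dec m k then dot n (vsub y x) (u m) / lam m else 0.

(** The first sum measures the component orthogonal to the frame, the second is twice the sum of the
    negative parts of the weights. *)
Definition chain_gauge (y : vec) : R :=
  sumR n (fun c => Rabs (residual n k u (vsub y x) c)) +
  sumR (S k) (fun m => Rabs (chain_weight (tau y) m) - chain_weight (tau y) m).

Lemma PL_dot_from v : PL n (fun y => dot n (vsub y x) v).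
Proof.
  apply (PL_ext n (fun y => dot n y v - dot n x v)); [intros; rewrite dot_sub_l; reflexivity|].
  apply PL_sub; [apply PL_dot|apply PL_const].
Qed.

Lemma PL_chain_gauge : PL n chain_gauge.
Proof.
  assert (Htau : forall m, PL n (fun y => tau y m)).
  { intros m. unfold tau. destruct (lt_dec m k); [|apply PL_const].
    apply (PL_ext n (fun y => / lam m * dot n (vsub y x) (u m)));
      [intros; unfold Rdiv; ring|]. apply PL_scale, PL_dot_from. }
  assert (HW : forall m, PL n (fun y => chain_weight (tau y) m)).
  { intros [|m]; simpl; apply PL_sub; auto using PL_const. }
  apply PL_add.
  - apply (PL_sum n n (fun c y => Rabs (residual n k u (vsub y x) c))).
    intros c Hc. apply PL_abs.
    apply (PL_ext n (fun y => (y c - x c) - sumR k (fun l => u l c * dot n (vsub y x) (u l)))).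
    + intros y. rewrite (sumR_ext k _ (fun l => dot n (vsub y x) (u l) * u l c))
        by (intros; ring). reflexivity.
    + apply PL_sub; [apply PL_sub; [apply PL_coord; assumption|apply PL_const]|].
      apply (PL_sum n k (fun l y => u l c * dot n (vsub y x) (u l))). intros l _.
      apply PL_scale, PL_dot_from.
  - apply (PL_sum n (S k) (fun m y => Rabs (chain_weight (tau y) m) - chain_weight (tau y) m)).
    intros m _. apply PL_sub; [apply PL_abs|]; apply HW.
Qed.

Lemma Rabs_minus_self_nonneg r : 0 <= Rabs r - r.
Proof. pose proof (Rle_abs r). lra. Qed.

Lemma chain_gauge_zero y :
  Rn n x -> (forall l, (l < k)%nat -> Rn n (u l)) -> Rn n y -> chain_gauge y = 0 ->
  in_conv (chain_pts x lam u k) y.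
Proof.
  intros Hx Hu Hy E. unfold chain_gauge in E.
  assert (H1 : 0 <= sumR n (fun c => Rabs (residual n k u (vsub y x) c)))
    by (apply sumR_nonneg; intros; apply Rabs_pos).
  assert (H2 : 0 <= sumR (S k)
    (fun m => Rabs (chain_weight (tau y) m) - chain_weight (tau y) m))
    by (apply sumR_nonneg; intros; apply Rabs_minus_self_nonneg).
  assert (Hres : forall c, (c < n)%nat -> residual n k u (vsub y x) c = 0).
  { intros c Hc. apply NNPP; intros Hne. apply Rabs_pos_lt in Hne.
    pose proof (sumR_ge_term n (fun c => Rabs (residual n k u (vsub y x) c)) c
      ltac:(intros; apply Rabs_pos) Hc). simpl in H. lra. }
  assert (HW : forall m, (m < S k)%nat -> 0 <= chain_weight (tau y) m).
  { intros m Hm. pose proof (sumR_ge_term (S k)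
      (fun m => Rabs (chain_weight (tau y) m) - chain_weight (tau y) m) m
      ltac:(intros; apply Rabs_minus_self_nonneg) Hm). cbv beta in H.
    pose proof (Rabs_pos (chain_weight (tau y) m)). lra. }
  assert (Htk : tau y k = 0) by (unfold tau; destruct (lt_dec k k); [lia|reflexivity]).
  exists (map (chain_weight (tau y)) (seq 0 (S k))). repeat split.
  - unfold chain_pts. rewrite !length_map. reflexivity.
  - apply Forall_map, Forall_forall. intros m Hm. apply in_seq in Hm. apply HW; lia.
  - rewrite (lin_one _ (chain_pts x lam u k))
      by (unfold chain_pts; rewrite !length_map; reflexivity).
    unfold chain_pts. rewrite lin_map_seq.
    rewrite (chain_weight_sum (tau y) k (fun _ => 1)), Htk, sumR_0; [ring|].
    intros; ring.
  - extensionality c. rewrite lin_lincomb. unfold chain_pts. rewrite lin_map_seq.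
    rewrite (chain_weight_sum (tau y) k
      (fun m => x c + sumR m (fun l => lam l * u l c))), Htk.
    rewrite (sumR_ext k _ (fun l => dot n (vsub y x) (u l) * u l c)).
    + destruct (Nat.lt_ge_cases c n) as [Hc|Hc].
      * specialize (Hres c Hc). unfold residual, proj, vsub at 1 in Hres.
        unfold vsub at 1 in Hres. simpl. lra.
      * rewrite (Hy c Hc), (sumR_0 k (fun l => dot n (vsub y x) (u l) * u l c))
          by (intros l Hl; rewrite (Hu l Hl c Hc); ring).
        rewrite (Hx c Hc). simpl. ring.
    + intros l Hl. simpl. unfold tau. destruct (lt_dec l k); [|lia].
      specialize (Hlam l Hl). field. lra.
Qed.

Lemma chain_face_orthogonal y :
  in_conv (chain_pts x lam u (k - 1)) y -> dot n (vsub y x) (u (k - 1)%nat) = 0.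
Proof.
  apply (in_conv_ind (fun y => dot n (vsub y x) (u (k - 1)%nat) = 0)).
  - intros p q t Hp Hq _. rewrite dot_sub_l in *.
    rewrite dot_add_l, !dot_scale_l. nra.
  - intros p Hp. unfold chain_pts in Hp. apply in_map_iff in Hp as [m [<- Hm]].
    apply in_seq in Hm.
    replace (vsub (fun i => x i + sumR m (fun l => lam l * u l i)) x)
      with (fun i => sumR m (fun l => lam l * u l i))
      by (extensionality i; unfold vsub; ring).
    rewrite (dot_sum_l n m lam), sumR_0; [reflexivity|].
    intros l Hl. rewrite Hort by lia. ring.
Qed.

(** The first weight is handled by convergence to [x], the middle ones by [frame_ratio] with ratio
    [lam (S m) / lam m], and the last one by [frame_pos]. *)
Lemma chain_weight_eventually_nonneg s :
  converges n s x -> frenet_frame n s x k u ->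
  ev (fun i => forall m, (m < S k)%nat -> 0 <= chain_weight (tau (s i)) m).
Proof.
  intros Hcv HF. apply (ev_all (S k) (fun i m => 0 <= chain_weight (tau (s i)) m)).
  intros [|m] Hm; simpl; unfold tau.
  - destruct (lt_dec 0 k) as [H0|]; [|lia].
    eapply ev_mono; [|apply (frame_small n s x u Hcv 0 (lam O)), Hlam, H0].
    intros i H. simpl in H. apply Rabs_def2 in H. specialize (Hlam O H0).
    assert (Hi : 0 < / lam O) by (apply Rinv_0_lt_compat; lra).
    assert (E : lam O * / lam O = 1) by (field; lra). unfold Rdiv. nra.
  - destruct (lt_dec m k) as [Hmk|]; [|lia].
    pose proof (Hlam m Hmk) as Hl.
    assert (Hi : 0 < / lam m) by (apply Rinv_0_lt_compat; lra).
    destruct (lt_dec (S m) k) as [HSk|HSk].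
    + pose proof (Hlam (S m) HSk) as Hl'.
      assert (Hi' : 0 < / lam (S m)) by (apply Rinv_0_lt_compat; lra).
      eapply ev_mono; [|apply (frame_ratio n s x k u HF m (lam (S m) / lam m) HSk)].
      * intros i H. simpl in H. apply (Rle_trans _ _ _ (Rle_abs _)) in H.
        apply Rmult_le_compat_r with (r := / lam (S m)) in H; [|lra].
        replace (lam (S m) / lam m * dot n (vsub (s i) x) (u m) * / lam (S m))
          with (dot n (vsub (s i) x) (u m) / lam m) in H by (field; lra).
        unfold Rdiv in *. lra.
      * unfold Rdiv. nra.
    + eapply ev_mono; [|apply (frame_pos n s x k u HF m Hmk)].
      intros i H. simpl in H. unfold Rdiv. nra.
Qed.

End Outgoing.

Lemma strongly_semisimple_no_outgoing n X :
  (forall x, X x -> Rn n x) -> (exists x, X x) -> compact_set n X ->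
  strongly_semisimple n X -> ~ has_outgoing_tangent n X.
Proof.
  intros HXn Hne Hcpt Hss [x [k [u [Hx [[s [HsX [Hcv HF]]] [lam [Hlam Hout]]]]]]].
  assert (HF' := HF). destruct HF' as [Hk [Hu [Hort _]]].
  set (f := fun y => Rabs (dot n (vsub y x) (u (k - 1)%nat))).
  set (g := chain_gauge n x k u lam).
  destruct (strongly_semisimple_ratio_bound n X HXn Hne Hcpt f g Hss) as [m Hm].
  - apply RX_PL; auto. apply PL_abs, PL_dot_from.
  - apply RX_PL; auto. apply PL_chain_gauge.
  - intros y Hy E. assert (Hy' : in_conv (chain_pts x lam u k) y)
      by (apply (chain_gauge_zero n x k u lam); auto; intros l Hl; apply Hu; assumption).
    destruct (Hout y) as [Hout' _]. destruct (Hout' (conj Hy' Hy)) as [Hface _].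
    unfold f. rewrite (chain_face_orthogonal n x k u lam Hk Hort y Hface). apply Rabs_R0.
  (* Chosen so that m n eps < 1: late terms satisfy f = a and g <= n eps a with a > 0, which
     contradicts f <= m g. *)
  - set (eps := / (2 * (INR m * INR n + 1))).
    assert (Hmn : 0 <= INR m * INR n) by (apply Rmult_le_pos; apply pos_INR).
    assert (Heps : 0 < eps) by (apply Rinv_0_lt_compat; lra).
    assert (Heps' : eps * (2 * (INR m * INR n + 1)) = 1) by (unfold eps; field; lra).
    assert (Hk1 : (k - 1 < k)%nat) by lia.
    destruct (ev_and _ _ (frame_pos n s x k u HF (k - 1) Hk1)
      (ev_and _ _ (chain_weight_eventually_nonneg n x k u lam Hk Hlam s Hcv HF)
        (ev_all n (fun i c => Rabs (residual n (S (k - 1)) u (vsub (s i) x) c) <=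
          eps * dot n (vsub (s i) x) (u (k - 1)%nat))
          (fun c Hc => frame_residual n s x k u HF (k - 1) c eps Hk1 Hc Heps)))) as [i0 Hi].
    destruct (Hi i0 (le_n _)) as [Hpos [HW Hres]].
    replace (S (k - 1)) with k in Hres by lia.
    specialize (Hm (s i0) (HsX i0)). unfold f in Hm. rewrite Rabs_Rabsolu in Hm.
    set (a := dot n (vsub (s i0) x) (u (k - 1)%nat)) in *.
    assert (Hg : 0 <= g (s i0) <= INR n * (eps * a)).
    { unfold g, chain_gauge. rewrite (sumR_0 (S k)).
      - rewrite Rplus_0_r. split; [apply sumR_nonneg; intros; apply Rabs_pos|].
        rewrite <- sumR_const. apply sumR_le. assumption.
      - intros j Hj. rewrite Rabs_pos_eq by (apply HW; assumption). ring. }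
    rewrite Rabs_pos_eq in Hm by lra. rewrite (Rabs_pos_eq (g (s i0))) in Hm by lra.
    assert (Hle : INR m * g (s i0) <= INR m * (INR n * (eps * a)))
      by (apply Rmult_le_compat_l; [apply pos_INR|lra]).
    assert (Hsm : INR m * INR n * eps < 1) by nra. nra.
Qed.

(** * Extreme points *)

(** The terms are written (1-t)p + tz, and subsequences are extracted first for t, then for z. The
    one-point list is separate because a term equal to p is written with t = 0 and some z from the
    remaining hull, which must be nonempty. *)
Lemma in_conv_seq_compact l : seq_compact (in_conv l).
Proof.
  induction l as [|p l IH]; intros s Hs; [destruct (in_conv_nil _ (Hs O))|].
  destruct l as [|q l].
  - exists (fun k => k), p. split; [intros k; lia|split; [apply in_conv_In; left; reflexivity|]].
    intros i. apply (cv_ext (fun _ => p i)); [|apply cv_const]. intros k.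
    destruct (in_conv_cons _ _ _ (Hs k)) as [->|[t [z [_ [Hz _]]]]]; [reflexivity|].
    destruct (in_conv_nil _ Hz).
  - destruct (choice_fun nat (R * vec) (fun k tz => 0 <= fst tz <= 1 /\
      in_conv (q :: l) (snd tz) /\
      s k = vadd (vscale (1 - fst tz) p) (vscale (fst tz) (snd tz)))) as [f Hf].
    { intros k. destruct (in_conv_cons _ _ _ (Hs k)) as [E|[t [z H]]]; [|exists (t, z); exact H].
      exists (0, q). cbn [fst snd]. split; [lra|split; [apply in_conv_In; left; reflexivity|]].
      rewrite E. extensionality i. unfold vadd, vscale. ring. }
    destruct (bolzano_weierstrass (fun k => fst (f k)) 1) as [sg [t [Hsg Ht]]].
    { intros k. destruct (Hf k) as [H _]. rewrite Rabs_pos_eq; lra. }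
    destruct (IH (fun k => snd (f (sg k)))) as [tu [z [Htu [Hz Hcz]]]];
      [intros k; apply Hf|].
    assert (Ht' := cv_subseq _ _ _ Htu Ht). cbv beta in Ht'.
    exists (fun k => sg (tu k)), (vadd (vscale (1 - t) p) (vscale t z)).
    split; [apply index_incr_comp; assumption|split].
    + apply in_conv_convex.
      * apply in_conv_In; left; reflexivity.
      * apply (in_conv_incl (q :: l)); [apply incl_tl, incl_refl|assumption].
      * split.
        -- apply (cv_le (fun _ => 0) _ _ _ (fun k => proj1 (proj1 (Hf (sg (tu k)))))
             (cv_const 0) Ht').
        -- apply (cv_le _ (fun _ => 1) _ _ (fun k => proj2 (proj1 (Hf (sg (tu k)))))
             Ht' (cv_const 1)).
    + intros i. apply (cv_ext (fun k => (1 - fst (f (sg (tu k)))) * p i +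
        fst (f (sg (tu k))) * snd (f (sg (tu k))) i)).
      * intros k. destruct (Hf (sg (tu k))) as [_ [_ E]]. rewrite E. reflexivity.
      * unfold vadd, vscale. apply CV_plus.
        -- apply CV_mult; [apply CV_minus; [apply cv_const|exact Ht']|apply cv_const].
        -- apply CV_mult; [exact Ht'|apply Hcz].
Qed.

(** [a] points from the nearest point z of the hull to y. Moving from z towards a vertex e does not
    come closer to y, which gives <a, e - z> <= 0; the margin is |y - z|^2. *)
Lemma separation n l y :
  (forall e, In e l -> Rn n e) -> Rn n y -> ~ in_conv l y ->
  exists a eta, 0 < eta /\ forall e, In e l -> dot n a e <= dot n a y - eta.
Proof.
  intros Hl Hy Hn. destruct l as [|p l].
  { exists vzero, 1. split; [lra|]. intros e []. }
  set (ps := p :: l) in *.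
  destruct (seq_compact_max (in_conv ps) (fun z => - dot n (vsub y z) (vsub y z)))
    as [z [Hz Hmin]].
  - exists p. apply in_conv_In; left; reflexivity.
  - apply in_conv_seq_compact.
  - intros s z _ Hs. apply CV_opp.
    apply cv_dot; intros i _; (apply CV_minus; [apply cv_const|apply Hs]).
  - set (a := vsub y z).
    assert (HzR : Rn n z).
    { apply (in_conv_ind (Rn n) ps); [|assumption|assumption].
      intros u v t Hu Hv _. apply Rn_add; apply Rn_scale; assumption. }
    assert (Ha : 0 < dot n a a).
    { destruct (Rle_lt_or_eq_dec _ _ (dot_self_nonneg n a)) as [|E]; [assumption|].
      exfalso. apply Hn. rewrite (vsub_0 y z); [assumption|].
      apply (dot_self_0 n); [apply Rn_sub; assumption|auto]. }
    exists a, (dot n a a). split; [assumption|]. intros e He.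
    set (d := vsub e z).
    assert (Had : dot n a d <= 0).
    { assert (Ht : forall t, 0 <= t <= 1 -> 2 * t * dot n a d <= t * t * dot n d d).
      { intros t Ht. specialize (Hmin _ (in_conv_convex ps z e t Hz (in_conv_In _ _ He) Ht)).
        simpl in Hmin. fold a in Hmin.
        replace (vsub y (vadd (vscale (1 - t) z) (vscale t e))) with (vsub a (vscale t d))
          in Hmin by (extensionality i; unfold a, d, vsub, vadd, vscale; ring).
        rewrite !dot_sub_l, !dot_sub_r, !dot_scale_l, !dot_scale_r, (dot_sym n d a) in Hmin.
        lra. }
      apply Rnot_lt_le. intros Hlt. pose proof (dot_self_nonneg n d) as Hd.
      assert (Hsum : 0 < dot n d d + dot n a d) by lra.
      (* Write A = <a, d> > 0 and D = <d, d>. This t lies in (0, 1] and satisfies t D = (1 - t) A <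
         2 A, against [Ht]; the summand A keeps the denominator positive when D = 0. *)
      set (t := dot n a d / (dot n d d + dot n a d)).
      assert (Hi : 0 < / (dot n d d + dot n a d)) by (apply Rinv_0_lt_compat; assumption).
      assert (Et : t * (dot n d d + dot n a d) = dot n a d) by (unfold t; field; lra).
      assert (Ht0 : 0 < t) by (unfold t, Rdiv; nra).
      assert (Ht1 : t <= 1) by nra.
      specialize (Ht t ltac:(lra)). nra. }
    assert (E : dot n a d = dot n a e - dot n a y + dot n a a).
    { unfold d. replace (dot n a a) with (dot n a (vsub y z)) by reflexivity.
      rewrite !dot_sub_r. ring. }
    lra.
Qed.

Definition extreme (X : vec -> Prop) (e : vec) : Prop :=
  X e /\ forall p q t, X p -> X q -> 0 < t < 1 ->
    e = vadd (vscale (1 - t) p) (vscale t q) -> p = q.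

(* For small [d] the strictly convex function [a.z + d |z|^2] is larger at [y] than on [l];
   its maximum over [X] is attained at an extreme point. *)
Lemma new_extreme_point n X l y :
  (forall x, X x -> Rn n x) -> compact_set n X -> (forall e, In e l -> X e) ->
  X y -> ~ in_conv l y -> exists e, extreme X e /\ ~ In e l.
Proof.
  intros HXn Hcpt Hl Hy Hn.
  destruct (separation n l y) as [a [eta [Heta Ha]]]; auto.
  destruct Hcpt as [Hcl [M HM]].
  assert (HB : forall z, X z -> dot n z z <= M * M).
  { intros z Hz. rewrite <- norm_sqr. specialize (HM z Hz). pose proof (norm_nonneg n z). nra. }
  assert (Hi : 0 < / (M * M + 1)) by (apply Rinv_0_lt_compat; nra).
  (* Then d M^2 < eta, so the quadratic term cannot outweigh the margin of the separation. *)
  set (d := eta * / (M * M + 1)). assert (Hd : 0 < d) by (unfold d; nra).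
  assert (HdM : d * (M * M + 1) = eta) by (unfold d; field; nra).
  set (phi := fun z => dot n a z + d * dot n z z).
  destruct (seq_compact_max X phi) as [e [He Hmax]].
  - eauto.
  - apply (compact_seq_compact n); [assumption|split; [|exists M]; assumption].
  - intros s z _ Hs. apply CV_plus.
    + apply (cv_dot n (fun _ => a)); intros i _; [apply cv_const|apply Hs].
    + apply (CV_mult (fun _ => d)); [apply cv_const|].
      apply cv_dot; intros i _; apply Hs.
  - exists e. split; [split; [assumption|]|].
    + intros p q t Hp Hq Ht E. apply vsub_0, (dot_self_0 n); [apply Rn_sub; auto|].
      (* The convexity defect is exactly d t (1 - t) |p - q|^2, and maximality of [phi] at [e]
         forces it to be 0. *)
      assert (Ephi : phi e = (1 - t) * phi p + t * phi q -
        d * (t * (1 - t)) * dot n (vsub p q) (vsub p q)).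
      { rewrite E. unfold phi.
        rewrite !dot_sub_l, !dot_sub_r, !dot_add_l, !dot_add_r, !dot_scale_l, !dot_scale_r,
          (dot_sym n q p). ring. }
      pose proof (Hmax p Hp). pose proof (Hmax q Hq).
      pose proof (dot_self_nonneg n (vsub p q)) as H1.
      assert (Hc : 0 < d * (t * (1 - t))) by (apply Rmult_lt_0_compat; nra).
      assert (H2 : (1 - t) * phi p + t * phi q <= phi e) by nra.
      nra.
    + intros Hin. specialize (Ha e Hin). specialize (Hmax y Hy). unfold phi in Hmax.
      pose proof (HB e He). pose proof (dot_self_nonneg n y).
      pose proof (dot_self_nonneg n e). nra.
Qed.

(** A finite list of extreme points never generates [X], so [new_extreme_point] keeps adding new
    ones. The resulting points are distinct, hence at most one of them is the limit of a convergent
    subsequence, and it is avoided by dropping initial terms. *)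
Lemma extreme_sequence n X :
  (forall x, X x -> Rn n x) -> compact_set n X -> convex_set X -> ~ is_polytope n X ->
  exists s x, X x /\ (forall i, extreme X (s i)) /\ (forall i, s i <> x) /\ cvp s x.
Proof.
  intros HXn Hcpt Hcvx Hnp.
  destruct (choice_fun (list vec) vec (fun l e => (forall e', In e' l -> extreme X e') ->
    extreme X e /\ ~ In e l)) as [f Hf].
  { intros l. destruct (classic (forall e', In e' l -> extreme X e')) as [Hl|Hl];
      [|exists vzero; tauto].
    destruct (classic (exists y, X y /\ ~ in_conv l y)) as [[y [Hy Hny]]|Hn].
    - destruct (new_extreme_point n X l y) as [e He]; auto; [|exists e; auto].
      intros e He. apply Hl; assumption.
    - exfalso. apply Hnp. exists l. split.
      + apply Forall_forall. intros e He. apply HXn, Hl, He.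
      + intros y. split.
        * intros Hy. apply NNPP. intros Hny. apply Hn. eauto.
        * apply in_conv_ind; [assumption|]. intros e He. apply Hl, He. }
  set (L := fix L k := match k with O => nil | S k' => f (L k') :: L k' end).
  assert (HL : forall k e, In e (L k) -> extreme X e).
  { induction k as [|k IH]; simpl; [tauto|]. intros e [<-|He]; [|auto]. apply Hf, IH. }
  set (s := fun k => f (L k)).
  assert (HsL : forall i j, (i < j)%nat -> In (s i) (L j)).
  { intros i j Hij; induction Hij as [|j Hij IH]; simpl; auto. }
  assert (Hinj : forall i j, (i < j)%nat -> s i <> s j).
  { intros i j Hij E. destruct (Hf (L j) (HL j)) as [_ Hnin]. apply Hnin.
    fold (s j). rewrite <- E. apply HsL; assumption. }
  assert (Hext : forall k, extreme X (s k)) by (intros k; apply Hf, HL).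
  destruct (compact_seq_compact n X HXn Hcpt s) as [sg [x [Hsg [Hx Hcv]]]];
    [intros k; apply Hext|].
  assert (Hne : exists N, forall i, (N <= i)%nat -> s (sg i) <> x).
  { destruct (classic (exists i, s (sg i) = x)) as [[i Hi]|Hn].
    - exists (S i). intros j Hj E. apply (Hinj (sg i) (sg j)); [|congruence].
      apply index_incr_lt; [assumption|lia].
    - exists O. intros i _ E. apply Hn. eauto. }
  destruct Hne as [N HN].
  exists (fun i => s (sg (N + i)%nat)), x. repeat split; auto; try apply Hext.
  - intros i. apply HN. lia.
  - apply (cvp_subseq (fun k => s (sg k)) x (fun i => (N + i)%nat)); [|assumption].
    intros k; lia.
Qed.

(** * Extraction of a Frenet frame *)

(** A Frenet frame that may be empty, so that the extraction can start from length 0. *)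
Definition pre_frame (n : nat) (s : nat -> vec) (x : vec) (k : nat) (u : nat -> vec) : Prop :=
  (forall l, (l < k)%nat -> Rn n (u l) /\ norm n (u l) = 1) /\
  (forall l m, (l < k)%nat -> (m < k)%nat -> l <> m -> dot n (u l) (u m) = 0) /\
  (forall j, (j < k)%nat ->
     (forall i, norm n (residual n j u (vsub (s i) x)) <> 0) /\
     converges n (fun i => vscale (/ norm n (residual n j u (vsub (s i) x)))
                                  (residual n j u (vsub (s i) x))) (u j)).

Lemma pre_frame_subseq n s x k u (sg : nat -> nat) :
  index_incr sg -> pre_frame n s x k u -> pre_frame n (fun i => s (sg i)) x k u.
Proof.
  intros Hsg [H1 [H2 H3]]. split; [assumption|split; [assumption|]]. intros j Hj.
  destruct (H3 j Hj) as [Hne Hcv]. split; [intros i; apply Hne|].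
  intros eps He. destruct (Hcv eps He) as [N HN]. exists N. intros i Hi.
  apply (HN (sg i)). pose proof (index_incr_ge sg Hsg i). lia.
Qed.

Lemma dot_residual_frame n s x k u y l :
  pre_frame n s x k u -> (l < k)%nat -> dot n (residual n k u y) (u l) = 0.
Proof.
  intros [H1 [H2 _]] Hl. unfold residual. rewrite dot_sub_l. unfold proj.
  rewrite (dot_sum_l n k (fun l => dot n y (u l))), (sumR_single k _ l); [|assumption|].
  - replace (dot n (u l) (u l)) with 1 by (symmetry; apply norm_dot_1, H1, Hl). ring.
  - intros j Hj Hjl. rewrite H2 by assumption. ring.
Qed.

Lemma bessel n s x k u y :
  pre_frame n s x k u -> sumR k (fun l => dot n y (u l) * dot n y (u l)) <= dot n y y.
Proof.
  intros HF. set (r := residual n k u y).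
  assert (E1 : dot n r y = dot n y y - sumR k (fun l => dot n y (u l) * dot n y (u l))).
  { unfold r, residual. rewrite dot_sub_l. unfold proj.
    rewrite (dot_sum_l n k (fun l => dot n y (u l))). f_equal.
    apply sumR_ext; intros l _. rewrite (dot_sym n (u l) y). reflexivity. }
  assert (E2 : dot n r r = dot n r y).
  { unfold r at 2, residual. rewrite dot_sub_r, (dot_sym n r (proj n k u y)). unfold proj.
    rewrite (dot_sum_l n k (fun l => dot n y (u l))), sumR_0; [ring|].
    intros l Hl. rewrite (dot_sym n (u l) r). unfold r.
    rewrite (dot_residual_frame n s x k u y l HF Hl). ring. }
  pose proof (dot_self_nonneg n r). lra.
Qed.

(** Double counting of the squared entries of the frame: each of the k vectors contributes 1, and
    each of the n coordinates at most 1 by [bessel] applied to a standard basis vector. *)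
Lemma pre_frame_le n s x k u : pre_frame n s x k u -> (k <= n)%nat.
Proof.
  intros HF. apply INR_le. rewrite <- (Rmult_1_r (INR k)), <- (Rmult_1_r (INR n)).
  rewrite <- !sumR_const.
  rewrite (sumR_ext k (fun _ => 1) (fun l => sumR n (fun i => u l i * u l i))).
  - rewrite sumR_swap. apply sumR_le. intros i Hi.
    apply Rle_trans with (dot n (evec i) (evec i)).
    + eapply Rle_trans; [|apply (bessel n s x k u (evec i) HF)]. right.
      apply sumR_ext. intros l _. rewrite (dot_evec n i (u l) Hi). reflexivity.
    + rewrite dot_evec by assumption. unfold evec. destruct (Nat.eq_dec i i); [lra|congruence].
  - intros l Hl. destruct HF as [H1 _]. symmetry. apply norm_dot_1, H1, Hl.
Qed.

Lemma residual_ext n j u u' y :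
  (forall l, (l < j)%nat -> u l = u' l) -> residual n j u y = residual n j u' y.
Proof.
  intros H. extensionality i. unfold residual, proj, vsub. f_equal.
  apply sumR_ext. intros l Hl. rewrite H by assumption. reflexivity.
Qed.

(** Terms with zero residual are dropped, the other residuals are normalised, and a limit of a
    subsequence is taken on the unit sphere. It is orthogonal to the frame because every residual
    is. *)
Lemma pre_frame_extend n s x k u :
  (forall i, Rn n (s i)) -> Rn n x -> pre_frame n s x k u ->
  (forall N, exists i, (N <= i)%nat /\ norm n (residual n k u (vsub (s i) x)) <> 0) ->
  exists sg u', index_incr sg /\ pre_frame n (fun i => s (sg i)) x (S k) u'.
Proof.
  intros Hs Hx HF Hne.
  destruct (extraction (fun _ i => norm n (residual n k u (vsub (s i) x)) <> 0))
    as [tu [Htu Hne']]; [intros _; exact Hne|].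
  set (r := fun i => residual n k u (vsub (s (tu i)) x)).
  assert (HrN : forall i, 0 < norm n (r i)).
  { intros i. pose proof (norm_nonneg n (r i)). specialize (Hne' i). fold (r i) in Hne'. lra. }
  set (v := fun i => vscale (/ norm n (r i)) (r i)).
  assert (Hv1 : forall i, norm n (v i) = 1).
  { intros i. unfold v. specialize (HrN i). rewrite norm_scale, Rabs_pos_eq.
    - field. lra.
    - apply Rlt_le, Rinv_0_lt_compat; assumption. }
  destruct (bolzano_weierstrass_vec n v 1) as [sg [w [Hsg [Hw Hcv]]]].
  { intros i c Hc. rewrite <- (Hv1 i). apply norm_coord; assumption. }
  set (u' := fun l => if Nat.eq_dec l k then w else u l).
  assert (Hu'k : u' k = w) by (unfold u'; destruct (Nat.eq_dec k k); congruence).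
  assert (Hu' : forall l, (l < k)%nat -> u' l = u l)
    by (intros l Hl; unfold u'; destruct (Nat.eq_dec l k); [lia|reflexivity]).
  exists (fun i => tu (sg i)), u'. split; [apply index_incr_comp; assumption|].
  assert (HF' : pre_frame n (fun i => s (tu (sg i))) x k u)
    by (apply (pre_frame_subseq n s); [apply index_incr_comp; assumption|assumption]).
  assert (Hort : forall l, (l < k)%nat -> dot n w (u l) = 0).
  { intros l Hl. apply (UL_sequence (fun i => dot n (v (sg i)) (u l))).
    - apply cv_dot; intros c Hc; [apply Hcv; assumption|apply cv_const].
    - apply (cv_ext (fun _ => 0)); [|apply cv_const]. intros i. unfold v.
      rewrite dot_scale_l. unfold r. rewrite (dot_residual_frame n s x k u _ l HF Hl). ring. }
  destruct HF' as [H1 [H2 H3]]. split; [|split].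
  - intros l Hl. destruct (Nat.eq_dec l k) as [->|Hlk].
    + rewrite Hu'k. split; [assumption|]. apply norm_dot_1.
      apply (UL_sequence (fun i => dot n (v (sg i)) (v (sg i)))).
      * apply cv_dot; intros c Hc; apply Hcv; assumption.
      * apply (cv_ext (fun _ => 1)); [|apply cv_const]. intros i.
        symmetry. apply norm_dot_1, Hv1.
    + rewrite Hu' by lia. apply H1; lia.
  - intros l m Hl Hm Hlm. destruct (Nat.eq_dec l k) as [->|Hlk].
    + rewrite Hu'k, Hu' by lia. apply Hort; lia.
    + destruct (Nat.eq_dec m k) as [->|Hmk].
      * rewrite Hu'k, Hu', dot_sym by lia. apply Hort; lia.
      * rewrite !Hu' by lia. apply H2; lia.
  - intros j Hj.
    assert (Er : forall y, residual n j u' y = residual n j u y)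
      by (intros y; apply residual_ext; intros l Hl; apply Hu'; lia).
    destruct (Nat.eq_dec j k) as [->|Hjk].
    + split.
      * intros i. rewrite Er. apply Hne'.
      * apply converges_iff. intros c Hc. rewrite Hu'k.
        eapply cv_ext; [|exact (Hcv c Hc)]. intros i. cbv beta. rewrite Er. reflexivity.
    + destruct (H3 j ltac:(lia)) as [Hn Hc]. split.
      * intros i. rewrite Er. apply Hn.
      * rewrite Hu' by lia. intros eps He. destruct (Hc eps He) as [N HN]. exists N.
        intros i Hi. rewrite Er. apply HN; assumption.
Qed.

(** A frame can be lengthened while infinitely many residuals are nonzero, and its length is at most
    n; when this stops, all late residuals vanish. Then k >= 1, because the residual for k = 0 is
    s_i - x itself. *)
Lemma frenet_extraction n s x :
  (forall i, Rn n (s i)) -> Rn n x -> (forall i, s i <> x) ->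
  exists sg k u, index_incr sg /\ frenet_frame n (fun i => s (sg i)) x k u /\
    forall i, norm n (residual n k u (vsub (s (sg i)) x)) = 0.
Proof.
  intros Hs Hx Hne. apply NNPP. intros Hn.
  assert (H : forall k, exists sg u, index_incr sg /\ pre_frame n (fun i => s (sg i)) x k u).
  { induction k as [|k [sg [u [Hsg HF]]]].
    - exists (fun i => i), (fun _ => vzero). split; [intros i; lia|].
      repeat split; intros; lia.
    - destruct (classic (forall N, exists i, (N <= i)%nat /\
        norm n (residual n k u (vsub (s (sg i)) x)) <> 0)) as [Hinf|Hfin].
      + destruct (pre_frame_extend n (fun i => s (sg i)) x k u) as [tu [u' [Htu HF']]]; auto.
        exists (fun i => sg (tu i)), u'. split; [apply index_incr_comp|]; assumption.
      + exfalso. apply not_all_ex_not in Hfin as [N HN].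
        assert (Hz : forall i, norm n (residual n k u (vsub (s (sg (N + i)%nat)) x)) = 0).
        { intros i. apply NNPP. intros Hi. apply HN. exists (N + i)%nat. split; [lia|assumption]. }
        apply Hn. exists (fun i => sg (N + i)%nat), k, u.
        split; [intros i; simpl; apply index_incr_lt; [assumption|lia]|split; [|assumption]].
        assert (HF' : pre_frame n (fun i => s (sg (N + i)%nat)) x k u).
        { apply (pre_frame_subseq n (fun i => s (sg i)) x k u (fun i => (N + i)%nat));
            [intros i; lia|assumption]. }
        split; [|exact HF']. destruct k as [|k]; [exfalso|lia].
        apply (Hne (sg (N + 0)%nat)), vsub_0, (dot_self_0 n); [apply Rn_sub; auto|].
        apply norm_0_dot. rewrite <- (Hz O). f_equal. extensionality c.
        unfold residual, proj, vsub. simpl. ring. }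
  destruct (H (S n)) as [sg [u [_ HF]]]. apply pre_frame_le in HF. lia.
Qed.

(** * Convex sets without outgoing tangents *)

Lemma sumR_trunc m k f :
  (m <= k)%nat -> sumR k (fun l => if lt_dec l m then f l else 0) = sumR m f.
Proof.
  intros Hmk. induction Hmk as [|k Hmk IH].
  - apply sumR_ext. intros l Hl. destruct (lt_dec l m); [reflexivity|lia].
  - simpl. rewrite IH. destruct (lt_dec k m); [lia|ring].
Qed.

Lemma chain_pts_span x k (u : nat -> vec) z :
  in_conv (chain_pts x (fun _ => 1) u k) z ->
  exists c, forall i, z i = x i + sumR k (fun l => c l * u l i).
Proof.
  apply (in_conv_ind (fun z => exists c, forall i, z i = x i + sumR k (fun l => c l * u l i))).
  - intros p q t [c Hc] [d Hd] _. exists (fun l => (1 - t) * c l + t * d l). intros i.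
    unfold vadd, vscale. rewrite Hc, Hd.
    rewrite (sumR_ext k (fun l => ((1 - t) * c l + t * d l) * u l i)
      (fun l => (1 - t) * (c l * u l i) + t * (d l * u l i))) by (intros; ring).
    rewrite sumR_plus, !sumR_scal. ring.
  - intros p Hp. unfold chain_pts in Hp. apply in_map_iff in Hp as [m [<- Hm]].
    apply in_seq in Hm. exists (fun l => if lt_dec l m then 1 else 0). intros i. f_equal.
    rewrite <- (sumR_trunc m k) by lia. apply sumR_ext. intros l _.
    destruct (lt_dec l m); ring.
Qed.

(** The failure is tested with all [lam] equal to 1: a point of [X] in the simplex outside the
    smaller one has positive weight on the last vertex [P], the only one involving [u k], so its
    coordinate along [u k] is positive. *)
Lemma not_outgoing_point n X x k u :
  ~ is_outgoing n X x (S k) u ->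
  exists y t, X y /\ 0 < t k /\ forall i, y i = x i + sumR (S k) (fun l => t l * u l i).
Proof.
  intros Hno. apply NNPP. intros Hn. apply Hno. exists (fun _ => 1).
  split; [intros; lra|]. intros y. replace (S k - 1)%nat with k by lia.
  set (P := fun i => x i + sumR (S k) (fun l => 1 * u l i)).
  assert (Hch : chain_pts x (fun _ => 1) u (S k) = chain_pts x (fun _ => 1) u k ++ P :: nil).
  { unfold chain_pts. rewrite (seq_S (S k)), map_app. reflexivity. }
  rewrite Hch. split; intros [Hy HX]; (split; [|assumption]).
  - apply (in_conv_incl _ (P :: chain_pts x (fun _ => 1) u k)) in Hy.
    2:{ intros p Hp. apply in_app_or in Hp. destruct Hp as [Hp|[<-|[]]];
        [right; assumption|left; reflexivity]. }
    apply in_conv_cons in Hy as [->|[t [z [Ht [Hz E]]]]].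
    + exfalso. apply Hn. exists P, (fun _ => 1). split; [assumption|split; [lra|]].
      reflexivity.
    + destruct (Req_dec t 1) as [->|Ht1].
      * replace y with z; [assumption|]. rewrite E. extensionality i.
        unfold vadd, vscale. ring.
      * exfalso. apply Hn. destruct (chain_pts_span _ _ _ _ Hz) as [c Hc].
        exists y, (fun l => (1 - t) + t * (if lt_dec l k then c l else 0)).
        split; [assumption|split].
        -- destruct (lt_dec k k); [lia|lra].
        -- intros i. rewrite E. unfold vadd, vscale, P. rewrite Hc.
           rewrite (sumR_ext (S k) (fun l => ((1 - t) + t * (if lt_dec l k then c l else 0)) * u l i)
             (fun l => (1 - t) * (1 * u l i) + t * (if lt_dec l k then c l * u l i else 0)))
             by (intros l _; destruct (lt_dec l k); ring).
           rewrite sumR_plus, !sumR_scal.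
           rewrite (sumR_trunc k (S k) (fun l => c l * u l i)) by lia. ring.
  - apply (in_conv_incl (chain_pts x (fun _ => 1) u k)); [|assumption].
    apply incl_appl, incl_refl.
Qed.

(* Back substitution in a triangular system whose right-hand side decays fast keeps the
   solution positive and small. *)
Lemma triangular_solve k (t : nat -> nat -> R) :
  (forall j, (j < k)%nat -> 0 < t j j) -> (forall j l, (j < l)%nat -> t j l = 0) ->
  forall eta, 0 < eta -> exists d, 0 < d /\
  forall a, (forall l, (l < k)%nat -> 0 < a l) -> ((0 < k)%nat -> a O < d) ->
    (forall l, (S l < k)%nat -> a (S l) <= d * a l) ->
  exists b, (forall j, (j < k)%nat -> 0 < b j) /\ sumR k b < eta /\
    forall l, (l < k)%nat -> a l = sumR k (fun j => b j * t j l).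
Proof.
  intros Ht Hup. induction k as [|k IH]; intros eta Heta.
  { exists 1. split; [lra|]. intros a _ _ _. exists (fun _ => 0).
    split; [intros; lia|split; [simpl; lra|intros; lia]]. }
  destruct (IH ltac:(intros; apply Ht; lia) (eta / 2) ltac:(lra)) as [d' [Hd' IH']].
  set (T := t k k). assert (HT : 0 < T) by (apply Ht; lia).
  set (C := sumR k (fun l => Rabs (t k l))).
  assert (HC : 0 <= C) by (apply sumR_nonneg; intros; apply Rabs_pos).
  assert (HCi : 0 < / (2 * (C + 1))) by (apply Rinv_0_lt_compat; lra).
  set (e := T * / (2 * (C + 1))). assert (He : 0 < e) by (unfold e; nra).
  assert (HeC : e * (2 * (C + 1)) = T) by (unfold e; field; lra).
  (* The bound 1 makes the decay relation transitive; [d' / 3] absorbs the passage to [a'], which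
     lies between a/2 and 3a/2; [e] makes the correction [bk * t k l] at most a l / 2; [eta / 2 * T]
     keeps the last unknown below eta/2. *)
  exists (Rmin (Rmin 1 (d' / 3)) (Rmin e (eta / 2 * T))).
  set (d := Rmin (Rmin 1 (d' / 3)) (Rmin e (eta / 2 * T))).
  assert (Hd0 : 0 < d) by (unfold d; repeat apply Rmin_glb_lt; nra).
  assert (Hd1 : d <= 1)
    by (eapply Rle_trans; [apply Rmin_l|apply Rmin_l]).
  assert (Hd2 : d <= d' / 3)
    by (eapply Rle_trans; [apply Rmin_l|apply Rmin_r]).
  assert (Hd3 : d <= e)
    by (eapply Rle_trans; [apply Rmin_r|apply Rmin_l]).
  assert (Hd4 : d <= eta / 2 * T)
    by (eapply Rle_trans; [apply Rmin_r|apply Rmin_r]).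
  clearbody d. split; [assumption|]. intros a Hpos H0 Hdec.
  assert (Hmono : forall l, (l < k)%nat -> a k <= d * a l).
  { intros l Hl. assert (Hgen : forall m, (l < m <= k)%nat -> a m <= d * a l); [|apply Hgen; lia].
    intros m. induction m as [|m IHm]; intros Hm; [lia|].
    specialize (Hdec m ltac:(lia)). destruct (Nat.eq_dec m l) as [->|Hml]; [assumption|].
    specialize (IHm ltac:(lia)). assert (0 < a m) by (apply Hpos; lia). nra. }
  set (bk := a k / T). assert (Hak : 0 < a k) by (apply Hpos; lia).
  assert (HTi : 0 < / T) by (apply Rinv_0_lt_compat; assumption).
  assert (Hbk : 0 < bk) by (unfold bk, Rdiv; nra).
  assert (EbT : bk * T = a k) by (unfold bk; field; lra).
  assert (Hakd : a k < d).
  { destruct (Nat.eq_dec k 0) as [E|E].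
    - rewrite E in *. apply H0. lia.
    - assert (0 < a O) by (apply Hpos; lia). specialize (Hmono O ltac:(lia)).
      specialize (H0 ltac:(lia)). nra. }
  (* The right-hand side after eliminating the last unknown, whose value [bk] is read off equation
     [k]. *)
  set (a' := fun l => a l - bk * t k l).
  assert (Ha' : forall l, (l < k)%nat -> a l / 2 <= a' l <= 3 / 2 * a l).
  { intros l Hl. assert (Hal : 0 < a l) by (apply Hpos; lia). specialize (Hmono l Hl).
    assert (HtC : Rabs (t k l) <= C).
    { apply (sumR_ge_term k (fun l => Rabs (t k l))); [intros; apply Rabs_pos|assumption]. }
    assert (Hsmall : Rabs (bk * t k l) <= a l / 2).
    { rewrite Rabs_mult, (Rabs_pos_eq bk) by lra.
      apply Rle_trans with (bk * C); [apply Rmult_le_compat_l; lra|].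
      assert (HbT : bk * T <= e * a l) by nra.
      assert (HeT : bk * (2 * (C + 1)) * e <= a l * e) by nra.
      apply Rmult_le_reg_r in HeT; [|assumption]. lra. }
    revert Hsmall. unfold a', Rabs. destruct (Rcase_abs (bk * t k l)); lra. }
  destruct (IH' a') as [b [Hb [Hsum Hsol]]].
  - intros l Hl. specialize (Ha' l Hl). assert (0 < a l) by (apply Hpos; lia). lra.
  - intros Hk. specialize (Ha' O Hk). specialize (H0 ltac:(lia)). lra.
  - intros l Hl. pose proof (Ha' l ltac:(lia)). pose proof (Ha' (S l) Hl).
    specialize (Hdec l ltac:(lia)). assert (0 < a l) by (apply Hpos; lia). nra.
  - set (b' := fun j => if Nat.eq_dec j k then bk else b j).
    assert (Hb'k : b' k = bk) by (unfold b'; destruct (Nat.eq_dec k k); congruence).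
    assert (Hb' : forall j, (j < k)%nat -> b' j = b j)
      by (intros j Hj; unfold b'; destruct (Nat.eq_dec j k); [lia|reflexivity]).
    exists b'. split; [|split].
    + intros j Hj. destruct (Nat.eq_dec j k) as [->|]; [rewrite Hb'k; assumption|].
      rewrite Hb' by lia. apply Hb; lia.
    + simpl. rewrite Hb'k, (sumR_ext k b' b) by assumption.
      assert (bk < eta / 2); [|lra]. apply Rmult_lt_reg_r with T; lra.
    + intros l Hl. simpl. rewrite Hb'k.
      rewrite (sumR_ext k _ (fun j => b j * t j l)) by (intros j Hj; rewrite Hb'; auto).
      destruct (Nat.eq_dec l k) as [->|Hlk].
      * rewrite sumR_0; [fold T; lra|]. intros j Hj. rewrite Hup by assumption. ring.
      * rewrite <- Hsol by lia. unfold a'. ring.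
Qed.

Lemma convex_combination X x k (y : nat -> vec) b :
  convex_set X -> X x -> (forall j, (j < k)%nat -> X (y j)) ->
  (forall j, (j < k)%nat -> 0 <= b j) -> sumR k b <= 1 ->
  X (fun i => x i + sumR k (fun j => b j * (y j i - x i))).
Proof.
  intros HX Hx Hy Hb Hsum.
  apply (in_conv_ind X (x :: map y (seq 0 k))); [assumption| |].
  - intros p [<-|Hp]; [assumption|]. apply in_map_iff in Hp as [j [<- Hj]].
    apply in_seq in Hj. apply Hy; lia.
  - exists ((1 - sumR k b) :: map b (seq 0 k)). repeat split.
    + simpl. rewrite !length_map. reflexivity.
    + constructor; [lra|]. apply Forall_map, Forall_forall. intros j Hj. apply in_seq in Hj.
      apply Hb; lia.
    + simpl. rewrite (lin_one _ (map y (seq 0 k))) by (rewrite !length_map; reflexivity).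
      rewrite lin_map_seq, (sumR_ext k (fun j => b j * 1) b) by (intros; ring). ring.
    + extensionality i. simpl. rewrite lin_lincomb, lin_map_seq.
      rewrite (sumR_ext k (fun j => b j * (y j i - x i)) (fun j => b j * y j i - x i * b j))
        by (intros; ring).
      rewrite sumR_minus, sumR_scal. ring.
Qed.

Lemma frenet_frame_prefix n s x k j u :
  (1 <= j <= k)%nat -> frenet_frame n s x k u -> frenet_frame n s x j u.
Proof.
  intros Hj [_ [H1 [H2 H3]]]. split; [lia|split; [|split]].
  - intros l Hl; apply H1; lia.
  - intros l m Hl Hm; apply H2; lia.
  - intros l Hl; apply H3; lia.
Qed.

(* If no prefix of the frame is outgoing, [X] contains points [y_j] with triangular
   coordinates in the frame, and late terms of the sequence are proper convex
   combinations of [x] and the [y_j]. *)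
Lemma no_outgoing_polytope n X :
  (forall x, X x -> Rn n x) -> compact_set n X -> convex_set X ->
  ~ has_outgoing_tangent n X -> is_polytope n X.
Proof.
  intros HXn Hcpt Hcvx Hno. apply NNPP. intros Hnp.
  destruct (extreme_sequence n X HXn Hcpt Hcvx Hnp) as [s0 [x [Hx [Hext0 [Hne0 Hcv0]]]]].
  destruct (frenet_extraction n s0 x) as [sg [k [u [Hsg [HF Hres]]]]]; auto.
  { intros i. apply HXn, Hext0. }
  set (s := fun i => s0 (sg i)) in *.
  assert (HsX : forall i, X (s i)) by (intros i; apply Hext0).
  assert (Hcv : converges n s x).
  { apply converges_cvp; auto. apply (cvp_subseq s0); assumption. }
  destruct (choice_fun nat (vec * (nat -> R)) (fun j yt => (j < k)%nat ->
    X (fst yt) /\ 0 < snd yt j /\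
    forall i, fst yt i = x i + sumR (S j) (fun l => snd yt l * u l i))) as [f Hf].
  { intros j. destruct (lt_dec j k) as [Hj|Hj]; [|exists (vzero, fun _ => 0); tauto].
    destruct (not_outgoing_point n X x j u) as [y [t H]].
    - intros Hout. apply Hno. exists x, (S j), u. split; [auto|split; [|assumption]].
      exists s. split; [assumption|split; [assumption|]].
      apply (frenet_frame_prefix n s x k); [lia|assumption].
    - exists (y, t). intros _. exact H. }
  set (y := fun j => fst (f j)).
  (* Only the entries up to index [j] describe [y j]; the others are set to 0 to make the system
     triangular. *)
  set (t := fun j l => if lt_dec l (S j) then snd (f j) l else 0).
  assert (Hy : forall j i, (j < k)%nat -> y j i - x i = sumR k (fun l => t j l * u l i)).
  { intros j i Hj. destruct (Hf j Hj) as [_ [_ E]]. unfold y. rewrite E.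
    rewrite <- (sumR_trunc (S j) k) by lia. unfold Rminus.
    rewrite Rplus_comm, <- Rplus_assoc, Rplus_opp_l, Rplus_0_l. apply sumR_ext. intros l _.
    unfold t. destruct (lt_dec l (S j)); ring. }
  (* A total weight below [eta = 1] leaves positive weight on [x]. *)
  destruct (triangular_solve k t) with (eta := 1) as [d [Hd Hsolve]]; [| |lra|].
  { intros j Hj. unfold t. destruct (lt_dec j (S j)); [apply Hf; assumption|lia]. }
  { intros j l Hjl. unfold t. destruct (lt_dec l (S j)); [lia|reflexivity]. }
  assert (Hk : (1 <= k)%nat) by apply HF.
  destruct (ev_and _ _ (ev_all k (fun i j => 0 < dot n (vsub (s i) x) (u j))
      (frame_pos n s x k u HF))
    (ev_and _ _ (frame_small n s x u Hcv 0 d Hd)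
      (ev_all (k - 1) (fun i j => Rabs (dot n (vsub (s i) x) (u (S j))) <=
         d * dot n (vsub (s i) x) (u j))
        (fun j Hj => frame_ratio n s x k u HF j d ltac:(lia) Hd)))) as [i0 Hi].
  destruct (Hi i0 (le_n _)) as [Hpos [H0 Hdec]].
  destruct (Hsolve (fun l => dot n (vsub (s i0) x) (u l))) as [b [Hb [Hsum Hsol]]].
  { assumption. }
  { intros _. apply Rabs_def2 in H0. lra. }
  { intros l Hl. eapply Rle_trans; [apply Rle_abs|]. apply Hdec. lia. }
  set (B := sumR k b) in *.
  assert (HB : 0 < B).
  { unfold B. apply Rlt_le_trans with (b O); [apply Hb; lia|].
    apply (sumR_ge_term k b); [|lia]. intros j Hj. apply Rlt_le, Hb, Hj. }
  assert (Es : forall i, s i0 i = x i + sumR k (fun j => b j * (y j i - x i))).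
  { intros i.
    rewrite (sumR_ext k _ (fun j => sumR k (fun l => b j * (t j l * u l i))))
      by (intros j Hj; rewrite Hy, sumR_scal by assumption; reflexivity).
    rewrite sumR_swap.
    rewrite (sumR_ext k _ (fun l => dot n (vsub (s i0) x) (u l) * u l i)).
    (* The residual of full order vanishes, so the frame coordinates determine [s i0] exactly. *)
    - assert (Er : residual n k u (vsub (s i0) x) = vzero).
      { apply (dot_self_0 n); [|apply norm_0_dot, Hres].
        intros c Hc. unfold residual, proj, vsub at 1. rewrite sumR_0.
        - unfold vsub. rewrite (HXn _ (HsX i0) c Hc), (HXn x Hx c Hc). ring.
        - intros l Hl. destruct HF as [_ [Hu _]]. destruct (Hu l Hl) as [Hul _].
          rewrite (Hul c Hc). ring. }
      assert (Eri := f_equal (fun g => g i) Er). unfold residual, proj, vzero in Eri.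
      unfold vsub at 1 2 in Eri. lra.
    - intros l Hl. rewrite Hsol by assumption. rewrite Rmult_comm, <- sumR_scal.
      apply sumR_ext; intros; ring. }
  assert (HBi : 0 < / B) by (apply Rinv_0_lt_compat; assumption).
  (* With the weights normalised, [s i0] becomes a proper combination of [x] and the point [z] of
     [X]; extremality gives z = x, and hence [s i0 = x], which is excluded. *)
  set (z := fun i => x i + sumR k (fun j => / B * b j * (y j i - x i))).
  assert (HzX : X z).
  { apply (convex_combination X x k y (fun j => / B * b j)); try assumption.
    - intros j Hj. apply Hf; assumption.
    - intros j Hj. specialize (Hb j Hj). nra.
    - rewrite sumR_scal. fold B. right. field. lra. }
  destruct (Hext0 (sg i0)) as [_ Hextr].
  assert (Ez : s i0 = vadd (vscale (1 - B) x) (vscale B z)).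
  { extensionality i. unfold vadd, vscale, z. rewrite Es.
    rewrite (sumR_ext k (fun j => / B * b j * (y j i - x i))
      (fun j => / B * (b j * (y j i - x i)))) by (intros; ring).
    rewrite sumR_scal. field. lra. }
  assert (E := Hextr x z B Hx HzX ltac:(lra) Ez).
  apply (Hne0 (sg i0)). fold (s i0). rewrite Ez, <- E. extensionality i.
  unfold vadd, vscale. ring.
Qed.

Theorem theorem6p4 (n : nat) (X : vec -> Prop)
  (HXn : forall x, X x -> Rn n x)
  (Hne : exists x, X x)
  (Hcpt : compact_set n X)
  (Hcvx : convex_set X) :
  (strongly_semisimple n X <-> is_polytope n X) /\
  (is_polytope n X <-> ~ has_outgoing_tangent n X).
Proof.
  assert (H12 := polytope_strongly_semisimple n X HXn Hcpt).
  assert (H23 := strongly_semisimple_no_outgoing n X HXn Hne Hcpt).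
  assert (H31 := no_outgoing_polytope n X HXn Hcpt Hcvx).
  tauto.
Qed.
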